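(* Let $q>0$ and let $\mathcal{A}=\mathbb{C}\langle x,x^*\mid xx^*=qx^*x\rangle$. Let $f=f^*\in\mathcal{A}$ with $\deg f=4m$, $m\in\mathbb{N}$. Suppose that: (i) for every $q$-normal operator $X$ there exists $\varepsilon_X>0$ such that $\langle f(X,X^* )\varphi,\varphi\rangle\ge\varepsilon_X\langle\varphi,\varphi\rangle$ for all $\varphi\in\mathcal{D}^\infty(X)$; (ii) $\sigma_f(\omega,\overline\omega)>0$ for all $\omega\in\mathbb{C}$ with $|\omega|=q^{1/2}$. Then there exists an element $b\in\mathcal{N}$ such that $b^*fb\in\sum\mathcal{A}^2$.
   Context: $\mathcal{A}$ is the unital complex $*$-algebra with single generator $x$ and defining relation $xx^*=qx^*x$; the set $\{x^{*i}x^j: i,j\in\mathbb{N}_0\}$ is a vector space basis of $\mathcal{A}$. For $f=\sum_{i,j}a_{ij}x^{*i}x^j$ the degree is $\deg f=\max\{i+j: a_{ij}\ne0\}$. $\sum\mathcal{A}^2$ denotes the set of finite sums $\sum_j a_j^*a_j$ with $a_j\in\mathcal{A}$. A densely defined operator $X$ on a Hilbert space is called $q$-normal if $\mathcal{D}(X)=\mathcal{D}(X^* )$ and $\|X^*g\|=\sqrt q\,\|Xg\|$ for all $g\in\mathcal{D}(X)$. Put $\mathcal{D}^\infty(X)=\bigcap_{n\ge1}\mathcal{D}(X^n)$, and $f(X,X^* )=\sum_{i,j}a_{ij}X^{*i}X^j$. $\mathcal{N}\subset\mathcal{A}$ is the set consisting of $1$ and all finite products of elements $q^kx^*x+1$ with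 $k\in\mathbb{Z}$. Symbol: let $\deg f=M=4m$ and let $f_M=\sum_{i+j=M}a_{ij}x^{*i}x^j$ be the highest degree part of $f$. It can be written uniquely as $$f_M=\sum_{r=0}^{M/2}b_r(x^*x)^rx^{M-2r}+\sum_{r=0}^{M/2-1}b'_{r}\,x^{*(M-2r)}(x^*x)^r,\qquad b_r,b'_r\in\mathbb{C}.$$ The symbol of $f$ is the function on $\mathbb{C}\setminus\{0\}$ $$\sigma_f(\omega,\overline\omega)=\sum_{r=0}^{M/2}b_r|\omega|^{-r(M-2r)}\omega^{\frac M2-r}+\sum_{r=0}^{M/2-1}b'_{r}\,\overline\omega^{\frac M2-r}|\omega|^{-r(M-2r)}.$$ *)

(* Defs.v *)
From HB Require Import structures.
From mathcomp Require Import all_boot all_order all_algebra.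
From mathcomp Require Import complex polyXY.
From mathcomp Require Import ring zify.
From mathcomp Require Import boolp classical_sets reals topology normedtype.

Set Implicit Arguments.
Unset Strict Implicit.
Unset Printing Implicit Defensive.

Import Order.TTheory GRing.Theory Num.Theory ComplexField.
Import numFieldNormedType.Exports.

Local Open Scope classical_set_scope.
Local Open Scope complex_scope.
Local Open Scope ring_scope.

(* The unital complex algebra on x and its adjoint xs with relation
   x xs = q xs x, realized as the skew polynomial ring C[xs][x; xs |-> q xs]:
   f`_j`_i is the coefficient of xs^i x^j. The parameter q only selects the
   product (see qx_qxs for the relation and qplane_universal for the universal
   property). *)
Definition qplane (R : rcfType) (q : R) := {poly {poly R[i]}}.

Definition qshift (R : rcfType) (q : R) (j : nat) (p : {poly R[i]}) :
  {poly R[i]} := p \Po ((q ^+ j)%:C *: 'X).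

(* Encodes x^j g(xs) = g(q^j xs) x^j. *)
HB.lock Definition qmul (R : rcfType) (q : R) (f g : {poly {poly R[i]}}) :
  {poly {poly R[i]}} :=
  \sum_(j < size f) f`_j *: ('X^j * map_poly (qshift q j) g).

Section QPlane.
Variables (R : rcfType) (q : R).
Local Notation C := R[i].
Local Notation P := {poly {poly R[i]}}.
Implicit Types f g h : P.

Local Notation qshift := (@qshift R q).
Local Notation qmul := (@qmul R q).

Let qshiftE j p : qshift j p = p \Po ((q ^+ j)%:C *: 'X).
Proof. by []. Qed.

Let qshiftD j : {morph qshift j : a b / a - b}.
Proof. by move=> a b; rewrite !qshiftE raddfB. Qed.

HB.instance Definition _ j :=
  GRing.isZmodMorphism.Build {poly C} {poly C} (qshift j) (@qshiftD j).

Let qshiftM j : monoid_morphism (qshift j).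
Proof. by split=> [|a b]; rewrite !qshiftE ?rmorph1 ?rmorphM. Qed.

HB.instance Definition _ j :=
  GRing.isMonoidMorphism.Build {poly C} {poly C} (qshift j) (@qshiftM j).

Let qshift_comp j k p : qshift j (qshift k p) = qshift (j + k) p.
Proof.
rewrite !qshiftE -comp_polyA comp_polyZ comp_polyX scalerA.
by rewrite -rmorphM -exprD addnC.
Qed.

Let qshift0 p : qshift 0 p = p.
Proof. by rewrite !qshiftE expr0 scale1r comp_polyXr. Qed.

Let qshiftC j a : qshift j a%:P = a%:P.
Proof. by rewrite !qshiftE comp_polyC. Qed.

Let qmul_wid n f g : (size f <= n)%N ->
  qmul f g = \sum_(j < n) f`_j *: ('X^j * map_poly (qshift j) g).
Proof.
move=> le_fn; rewrite qmul.unlock -[LHS](big_mkord xpredT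
  (fun j => f`_j *: ('X^j * map_poly (qshift j) g))).
rewrite -[RHS](big_mkord xpredT
  (fun j => f`_j *: ('X^j * map_poly (qshift j) g))).
rewrite (big_cat_nat (leq0n (size f)) le_fn) /= [X in _ + X]big_nat_cond.
rewrite [X in _ + X]big1 ?addr0 // => j /andP[/andP[/leq_sizeP fj _] _].
by rewrite fj // scale0r.
Qed.

Let qmulDl : left_distributive qmul +%R.
Proof.
move=> f g h; pose n := maxn (size f) (size g).
rewrite !(@qmul_wid n) ?leq_maxl ?leq_maxr ?(leq_trans (size_polyD _ _)) //.
by rewrite -big_split /=; apply: eq_bigr => j _; rewrite coefD scalerDl.
Qed.

Let qmulDr : right_distributive qmul +%R.
Proof.
move=> f g h; rewrite qmul.unlock -big_split /=; apply: eq_bigr => j _.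
by rewrite rmorphD mulrDr scalerDr.
Qed.

Let qmul0l g : qmul 0 g = 0.
Proof. by rewrite qmul.unlock size_poly0 big_ord0. Qed.

Let qmulr0 g : qmul g 0 = 0.
Proof. by rewrite qmul.unlock big1 // => j _; rewrite rmorph0 mulr0 scaler0. Qed.

Let qmul_suml n (F : 'I_n -> P) g :
  qmul (\sum_(i < n) F i) g = \sum_(i < n) qmul (F i) g.
Proof. exact: (big_morph (qmul^~ g) (fun a b => qmulDl a b g) (qmul0l g)). Qed.

Let qmul_sumr n (F : 'I_n -> P) f :
  qmul f (\sum_(i < n) F i) = \sum_(i < n) qmul f (F i).
Proof. exact: (big_morph (qmul f) (qmulDr f) (qmulr0 f)). Qed.

Let qmulX a j g : qmul (a *: 'X^j) g = a *: ('X^j * map_poly (qshift j) g).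
Proof.
rewrite (@qmul_wid j.+1); last first.
  by rewrite (leq_trans (size_scale_leq _ _)) // size_polyXn.
rewrite big_ord_recr big1 /= ?add0r => [|i _].
  by rewrite coefZ coefXn eqxx mulr1.
by rewrite coefZ coefXn (ltn_eqF (ltn_ord i)) mulr0 scale0r.
Qed.

Let polyE f : f = \sum_(j < size f) f`_j *: 'X^j.
Proof. by rewrite -poly_def coefK. Qed.

Let map_qshiftZX j a k :
  map_poly (qshift j) (a *: 'X^k) = qshift j a *: 'X^k.
Proof. by rewrite map_polyZ map_polyXn. Qed.

Let qmulA : associative qmul.
Proof.
move=> f g h; rewrite (polyE f) [LHS]qmul_suml [X in _ = qmul X _]qmul_suml.
rewrite [RHS]qmul_suml; apply: eq_bigr => j _.
rewrite (polyE g) [X in qmul _ X = _]qmul_suml [X in _ = qmul X _]qmul_sumr.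
rewrite [LHS]qmul_sumr [RHS]qmul_suml; apply: eq_bigr => k _.
rewrite !qmulX map_qshiftZX -!scalerAr scalerA -exprD qmulX.
rewrite map_polyZ rmorphM /= map_polyXn -scalerAr scalerA mulrA -exprD.
congr (_ *: (_ * _)).
by rewrite -map_poly_comp; apply: eq_map_poly => p /=; rewrite qshift_comp.
Qed.

Let qmul1l : left_id 1 qmul.
Proof.
move=> g; rewrite -[1]scale1r -(expr0 'X) qmulX scale1r expr0 mul1r.
by apply: map_poly_id => p _; rewrite qshift0.
Qed.

Let qmul1r : right_id 1 qmul.
Proof.
move=> f; rewrite [RHS]polyE qmul.unlock; apply: eq_bigr => j _.
by rewrite rmorph1 mulr1.
Qed.

HB.instance Definition _ := GRing.Zmodule.copy (qplane q) P.

HB.instance Definition _ := GRing.Zmodule_isNzRing.Build (qplane q)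
  qmulA qmul1l qmul1r qmulDl qmulDr (oner_neq0 P).

Definition qscale (a : C) (f : qplane q) : qplane q := (a%:P : {poly C}) *: (f : P).

Let qscaleA a b f : qscale a (qscale b f) = qscale (a * b) f.
Proof. by rewrite /qscale scalerA polyCM. Qed.
Let qscale1 : left_id 1 qscale.
Proof. by move=> f; rewrite /qscale scale1r. Qed.
Let qscaleDr : right_distributive qscale +%R.
Proof. by move=> a f g; rewrite /qscale scalerDr. Qed.
Let qscaleDl f : {morph qscale^~ f : a b / a + b}.
Proof. by move=> a b; rewrite /qscale polyCD scalerDl. Qed.

HB.instance Definition _ := GRing.Zmodule_isLmodule.Build C (qplane q)
  qscaleA qscale1 qscaleDr qscaleDl.

Let qmul_scalel (a : {poly C}) f g : a *: qmul f g = qmul (a *: f) g.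
Proof.
rewrite (polyE f) [in RHS]scaler_sumr [X in _ *: X = _]qmul_suml.
rewrite [RHS]qmul_suml scaler_sumr.
by apply: eq_bigr => j _; rewrite scalerA !qmulX scalerA.
Qed.

Let qscaleAl (a : C) (f g : qplane q) : a *: (f * g) = (a *: f) * g.
Proof. exact: qmul_scalel. Qed.

HB.instance Definition _ := GRing.Lmodule_isLalgebra.Build C (qplane q) qscaleAl.

Let qscaleAr (a : C) (f g : qplane q) : a *: (f * g) = f * (a *: g).
Proof.
rewrite -[RHS]/(qmul f (a%:P *: (g : P))) -[LHS]/(a%:P *: qmul f g).
rewrite qmul.unlock scaler_sumr; apply: eq_bigr => j _.
by rewrite map_polyZ /= qshiftC -scalerAr !scalerA mulrC.
Qed.

HB.instance Definition _ := GRing.Lalgebra_isAlgebra.Build C (qplane q) qscaleAr.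

Definition qx : qplane q := ('X : P).
Definition qxs : qplane q := ('X%:P : P).

Definition qcoef (f : qplane q) (i j : nat) : C := (f : P)`_j`_i.

Definition qstar (f : qplane q) : qplane q :=
  swapXY (map_poly (map_poly Num.conj) (f : P)).

Let qxXn j : qx ^+ j = ('X^j : P) :> P.
Proof.
elim: j => [|j IHj]; first by rewrite !expr0.
rewrite exprS -[LHS]/(qmul 'X (qx ^+ j)) IHj.
by rewrite -[X in qmul X _]scale1r -[X in 1 *: X]expr1 qmulX map_polyXn scale1r -exprD.
Qed.

Let qxsM p : (qxs * p : qplane q) = ('X : {poly C}) *: (p : P) :> P.
Proof.
rewrite -[LHS]/(qmul 'X%:P p) -[X in qmul X _]mulr1 mul_polyC -[X in _ *: X](expr0 'X).
rewrite qmulX expr0 mul1r.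
by rewrite map_poly_id // => r _; rewrite qshift0.
Qed.

Lemma qmonE (i j : nat) :
  (qxs ^+ i * qx ^+ j : qplane q) = ('X^i : {poly C}) *: ('X^j : P) :> P.
Proof.
elim: i => [|i IHi]; first by rewrite !expr0 mul1r qxXn scale1r.
by rewrite exprS -mulrA qxsM IHi scalerA -exprS.
Qed.

Lemma qcoef_mon (k l i j : nat) :
  qcoef (qxs ^+ k * qx ^+ l) i j = ((i == k) && (j == l))%:R.
Proof.
rewrite /qcoef qmonE coefZ coefXn.
case: (j =P l) => _; last by rewrite andbF mulr0 coef0.
by rewrite andbT mulr1 coefXn.
Qed.

Lemma qplane_expand (f : qplane q) : f =
  \sum_(j < size (f : P)) \sum_(i < size (f : P)`_j)
    qcoef f i j *: (qxs ^+ i * qx ^+ j).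
Proof.
rewrite [LHS](polyE f); apply: eq_bigr => j _.
rewrite -[in LHS](coefK (f : P)`_j) poly_def scaler_suml.
apply: eq_bigr => i _; rewrite -[RHS]/(_%:P *: (_ : P)) qmonE.
by rewrite scalerA mul_polyC.
Qed.

Lemma qx_qxs : qx * qxs = q%:C *: (qxs * qx).
Proof.
rewrite -[RHS]/(q%:C%:P *: (qxs * qx : P)) qxsM scalerA mul_polyC.
rewrite -[LHS]/(qmul 'X 'X%:P) -[X in qmul X _]scale1r -[X in 1 *: X]expr1 qmulX.
rewrite map_polyC /= !qshiftE comp_polyX !expr1 scale1r.
by rewrite mulrC mul_polyC.
Qed.

Lemma qx_qxsX (j k : nat) :
  qx ^+ j * qxs ^+ k = (q ^+ (j * k))%:C *: (qxs ^+ k * qx ^+ j).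
Proof.
have qx1 i : qx * qxs ^+ i = (q ^+ i)%:C *: (qxs ^+ i * qx).
  elim: i => [|i IHi]; first by rewrite !expr0 mulr1 mul1r scale1r.
  rewrite exprS mulrA qx_qxs -scalerAl -(mulrA qxs qx) IHi -scalerAr scalerA mulrA.
  by rewrite -rmorphM -(exprS q).
elim: j => [|j IHj]; first by rewrite mul0n !expr0 mulr1 mul1r scale1r.
rewrite exprS -mulrA IHj -scalerAr (mulrA qx) qx1 -scalerAl scalerA -(mulrA (qxs ^+ k)).
by rewrite -rmorphM -exprD addnC -mulSn -exprS.
Qed.

Lemma qmonM (i j k l : nat) : (qxs ^+ i * qx ^+ j) * (qxs ^+ k * qx ^+ l) =
  (q ^+ (j * k))%:C *: (qxs ^+ (i + k) * qx ^+ (j + l)).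
Proof.
rewrite -mulrA (mulrA (qx ^+ j)) qx_qxsX -scalerAl -scalerAr.
by rewrite -mulrA -exprD mulrA -exprD.
Qed.

Lemma qstarB : {morph qstar : f g / f - g}.
Proof. by move=> f g; rewrite /qstar !raddfB. Qed.

HB.instance Definition _ :=
  GRing.isZmodMorphism.Build (qplane q) (qplane q) qstar qstarB.

Lemma qstarZ (a : C) (f : qplane q) : qstar (a *: f) = a^* *: qstar f.
Proof.
rewrite -[a *: f]/(a%:P *: (f : P)) -[RHS]/((a^*)%:P *: (qstar f : P)) /qstar.
rewrite -mul_polyC !rmorphM /= !map_polyC /= map_polyC /= swapXY_polyC.
by rewrite map_polyC /= mul_polyC.
Qed.

Lemma qcoef_star (f : qplane q) i j : qcoef (qstar f) i j = (qcoef f j i)^*.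
Proof. by rewrite /qcoef /qstar coef_swapXY !coef_map. Qed.

Lemma qcoefP (f g : qplane q) :
  (forall i j, qcoef f i j = qcoef g i j) -> f = g.
Proof. by move=> efg; apply/polyP => j; apply/polyP => i; apply: efg. Qed.

Lemma qstar_mon (i j : nat) :
  qstar (qxs ^+ i * qx ^+ j) = qxs ^+ j * qx ^+ i.
Proof.
by apply: qcoefP => k l; rewrite qcoef_star !qcoef_mon conjC_nat andbC.
Qed.

Lemma qstarK : involutive qstar.
Proof. by move=> f; apply: qcoefP => i j; rewrite !qcoef_star conjCK. Qed.

Let conjCR (a : R) : (a%:C)^* = a%:C :> C.
Proof. exact: conjc_real. Qed.

Lemma qstarM (f g : qplane q) : qstar (f * g) = qstar g * qstar f.
Proof.
rewrite (qplane_expand f) mulr_suml !raddf_sum mulr_sumr.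
apply: eq_bigr => j _ /=; rewrite mulr_suml !raddf_sum mulr_sumr.
apply: eq_bigr => i _ /=; rewrite (qplane_expand g) mulr_sumr !raddf_sum.
rewrite mulr_suml; apply: eq_bigr => l _ /=; rewrite mulr_sumr !raddf_sum.
rewrite mulr_suml; apply: eq_bigr => k _ /=.
rewrite -scalerAl -scalerAr qmonM !qstarZ !qstar_mon -scalerAl -scalerAr qmonM.
rewrite !scalerA conjCR [(j * k)%N]mulnC.
by rewrite [(j + l)%N]addnC [(i + k)%N]addnC; congr (_ *: _); ring.
Qed.

Lemma qstar_qx : qstar qx = qxs.
Proof. by have := qstar_mon 0 1; rewrite !expr0 !expr1 mul1r mulr1. Qed.

End QPlane.

Arguments qx {R}.
Arguments qxs {R}.

Section Universal.
Variables (R : rcfType) (q : R) (B : algType R[i]) (y ys : B).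
Hypothesis yys : y * ys = q%:C *: (ys * y).
Local Notation P := {poly {poly R[i]}}.

Let lift (f : qplane q) : B :=
  \sum_(j < size (f : P)) horner_alg ys (f : P)`_j * y ^+ j.

Let lift_wid n (f : qplane q) : (size (f : P) <= n)%N ->
  lift f = \sum_(j < n) horner_alg ys (f : P)`_j * y ^+ j.
Proof.
move=> le_fn; rewrite /lift -[LHS](big_mkord xpredT
  (fun j => horner_alg ys (f : P)`_j * y ^+ j)).
rewrite -[RHS](big_mkord xpredT (fun j => horner_alg ys (f : P)`_j * y ^+ j)).
rewrite (big_cat_nat (leq0n (size (f : P))) le_fn) /= [X in _ + X]big_nat_cond.
rewrite [X in _ + X]big1 ?addr0 // => j /andP[/andP[/leq_sizeP fj _] _].
by rewrite fj // rmorph0 mul0r.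
Qed.

Let liftB : zmod_morphism lift.
Proof.
move=> f g; pose n := maxn (size (f : P)) (size (g : P)).
rewrite !(@lift_wid n) ?leq_maxl ?leq_maxr //; last first.
  by rewrite (leq_trans (size_polyD _ _)) // size_polyN.
by rewrite -sumrB; apply: eq_bigr => j _; rewrite coefB rmorphB mulrBl.
Qed.

Let liftZ : scalable lift.
Proof.
move=> a f; rewrite (@lift_wid (size (f : P))) ?size_scale_leq //.
rewrite /lift scaler_sumr; apply: eq_bigr => j _.
by rewrite coefZ rmorphM /= horner_algC mulr_algl scalerAl.
Qed.

HB.instance Definition _ := GRing.isZmodMorphism.Build (qplane q) B lift liftB.
HB.instance Definition _ :=
  GRing.isScalable.Build R[i] (qplane q) B *:%R lift liftZ.

Let lift_mon (i j : nat) : lift (qxs q ^+ i * qx q ^+ j) = ys ^+ i * y ^+ j.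
Proof.
rewrite (@lift_wid j.+1); last first.
  by rewrite qmonE (leq_trans (size_scale_leq _ _)) // size_polyXn.
rewrite qmonE big_ord_recr big1 /= ?add0r => [|k _].
  by rewrite coefZ coefXn eqxx mulr1 rmorphXn /= horner_algX.
by rewrite coefZ coefXn (ltn_eqF (ltn_ord k)) mulr0 rmorph0 mul0r.
Qed.

Let yysX (j k : nat) :
  y ^+ j * ys ^+ k = (q ^+ (j * k))%:C *: (ys ^+ k * y ^+ j).
Proof.
have y1 i : y * ys ^+ i = (q ^+ i)%:C *: (ys ^+ i * y).
  elim: i => [|i IHi]; first by rewrite !expr0 mulr1 mul1r scale1r.
  rewrite exprS mulrA yys -scalerAl -(mulrA ys y) IHi -scalerAr scalerA mulrA.
  by rewrite -rmorphM -(exprS q).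
elim: j => [|j IHj]; first by rewrite mul0n !expr0 mulr1 mul1r scale1r.
rewrite exprS -mulrA IHj -scalerAr (mulrA y) y1 -scalerAl scalerA.
by rewrite -(mulrA (ys ^+ k)) -rmorphM -exprD addnC -mulSn -exprS.
Qed.

Let liftM : monoid_morphism lift.
Proof.
split=> [|f g].
  by have := lift_mon 0 0; rewrite !expr0 !mulr1.
rewrite (qplane_expand f) mulr_suml !raddf_sum mulr_suml.
apply: eq_bigr => j _ /=; rewrite mulr_suml !raddf_sum mulr_suml.
apply: eq_bigr => i _ /=; rewrite (qplane_expand g) mulr_sumr !raddf_sum.
rewrite mulr_sumr; apply: eq_bigr => l _ /=; rewrite mulr_sumr !raddf_sum.
rewrite mulr_sumr; apply: eq_bigr => k _ /=.
rewrite -scalerAl -scalerAr qmonM !linearZ /= !lift_mon -scalerAl -scalerAr.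
do 2!congr (_ *: _).
rewrite -[RHS]mulrA (mulrA (y ^+ j)) yysX -scalerAl -scalerAr.
by rewrite -[in RHS]mulrA -exprD mulrA -exprD.
Qed.

HB.instance Definition _ :=
  GRing.isMonoidMorphism.Build (qplane q) B lift liftM.

Lemma qplane_universal : exists phi : {lrmorphism qplane q -> B},
  [/\ phi (qx q) = y, phi (qxs q) = ys &
   forall psi : {lrmorphism qplane q -> B},
     psi (qx q) = y -> psi (qxs q) = ys -> psi =1 phi].
Proof.
exists lift; split=> [||psi psix psixs f].
- by have := lift_mon 0 1; rewrite !expr0 !expr1 !mul1r.
- by have := lift_mon 1 0; rewrite !expr0 !expr1 !mulr1.
rewrite (qplane_expand f) !raddf_sum; apply: eq_bigr => j _.
rewrite !raddf_sum; apply: eq_bigr => i _ /=.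
by rewrite !linearZ /= lift_mon rmorphM !rmorphXn /= psix psixs.
Qed.

End Universal.

Section Degree.
Variables (R : rcfType) (q : R).
Local Notation C := R[i].
Local Notation x := (qx q).
Local Notation xs := (qxs q).
Implicit Types f : qplane q.

(* The zero element gets degree 0. *)
Definition qdeg f : nat :=
  \max_(j < size (f : {poly {poly C}}))
    \max_(i < size ((f : {poly {poly C}})`_j)%R | (qcoef f i j != 0)%R) (i + j).

Lemma qdegP f n :
  reflect (forall i j, qcoef f i j != 0 -> (i + j <= n)%N) (qdeg f <= n)%N.
Proof.
apply: (iffP idP) => [le_fn i j fij|le_fn].
  have ltj : (j < size (f : {poly {poly C}}))%N.
    by rewrite ltnNge; apply: contra fij => /leq_sizeP fj;
       rewrite /qcoef fj // coef0.
  have lti : (i < size ((f : {poly {poly C}})`_j)%R)%N.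
    by rewrite ltnNge; apply: contra fij => /leq_sizeP fi; rewrite /qcoef fi.
  apply: leq_trans le_fn.
  apply: leq_trans (leq_bigmax (Ordinal ltj)).
  exact: (leq_bigmax_cond (Ordinal lti)).
by apply/bigmax_leqP => j _; apply/bigmax_leqP => i; apply: le_fn.
Qed.

Definition qtop f : qplane q :=
  \sum_(i < (qdeg f).+1)
    qcoef f i (qdeg f - i) *: (xs ^+ i * x ^+ (qdeg f - i)).

Definition qsymbol_form (M : nat)
    (b : {ffun 'I_(M./2).+1 -> C} * {ffun 'I_(M./2) -> C}) : qplane q :=
  \sum_(r < (M./2).+1) b.1 r *: ((xs * x) ^+ r * x ^+ (M - 2 * r))
  + \sum_(r < M./2) b.2 r *: (xs ^+ (M - 2 * r) * (xs * x) ^+ r).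

(* The default value is irrelevant when q != 0 and the degree of f is even:
   see qsymbol_form_unique. *)
Definition qsymbol_coef f :=
  xget ([ffun=> 0], [ffun=> 0]) [set b | qtop f = @qsymbol_form (qdeg f) b].

Definition qsymbol f (w : C) : C :=
  let M := qdeg f in
  \sum_(r < (M./2).+1)
    (qsymbol_coef f).1 r * `|w| ^- (r * (M - 2 * r)) * w ^+ (M./2 - r)
  + \sum_(r < M./2)
    (qsymbol_coef f).2 r * (w^*) ^+ (M./2 - r) * `|w| ^- (r * (M - 2 * r)).

Let qxsqxX r : (xs * x) ^+ r = (q ^+ 'C(r, 2))%:C *: (xs ^+ r * x ^+ r).
Proof.
elim: r => [|r IHr]; first by rewrite !expr0 mulr1 scale1r.
rewrite exprS IHr -scalerAr.
have := qmonM q 1 1 r r; rewrite !expr1 => ->.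
by rewrite scalerA -rmorphM -exprD !add1n mul1n binS bin1.
Qed.

Lemma qsymbol_formE M b : ~~ odd M -> qsymbol_form (M := M) b =
  \sum_(r < (M./2).+1)
    (b.1 r * (q ^+ 'C(r, 2))%:C) *: (xs ^+ r * x ^+ (M - r)) +
  \sum_(r < M./2) (b.2 r * (q ^+ 'C(r, 2))%:C) *: (xs ^+ (M - r) * x ^+ r).
Proof.
move=> evenM; have M2 : M = (M./2 + M./2)%N.
  by rewrite addnn -[LHS]odd_double_half (negPf evenM).
congr (_ + _); apply: eq_bigr => r _; rewrite qxsqxX.
  rewrite -scalerAl scalerA -mulrA -exprD; congr (_ *: (_ * _ ^+ _)).
  by have := ltn_ord r; lia.
rewrite -scalerAr scalerA mulrA -exprD; congr (_ *: (_ ^+ _ * _)).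
by have := ltn_ord r; lia.
Qed.

Lemma qsymbol_form_unique f : q != 0 -> ~~ odd (qdeg f) ->
  exists! b, qtop f = @qsymbol_form (qdeg f) b.
Proof.
move=> q0; rewrite /qtop; move: (qdeg f) => M evenM.
have M2 : M = (M./2 + M./2)%N.
  by rewrite addnn -[LHS]odd_double_half (negPf evenM).
have c0 r : (q ^+ 'C(r, 2))%:C != 0 :> C by rewrite fmorph_eq0 expf_neq0.
have qcoef_sum n (F : 'I_n -> qplane q) i j :
    qcoef (\sum_(k < n) F k) i j = \sum_(k < n) qcoef (F k) i j.
  by rewrite /qcoef !coef_sum.
have qcoefZ a (g : qplane q) i j : qcoef (a *: g) i j = a * qcoef g i j.
  rewrite /qcoef -[a *: g]/(a%:P *: (g : {poly {poly C}})) coefZ mul_polyC.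
  by rewrite coefZ.
have qcoefD (g h : qplane q) i j : qcoef (g + h) i j = qcoef g i j + qcoef h i j.
  by rewrite /qcoef !coefD.
have coefM1 b (r : 'I_(M./2).+1) :
    qcoef (qsymbol_form b) r (M - r) = b.1 r * (q ^+ 'C(r, 2))%:C.
  rewrite qsymbol_formE // qcoefD !qcoef_sum.
  rewrite [X in _ + X]big1 ?addr0 => [|k _]; last first.
    rewrite qcoefZ qcoef_mon; have := ltn_ord k; have := ltn_ord r.
    by case: eqP => [|_ _ _]; rewrite ?mulr0 //; lia.
  rewrite (bigD1 r) //= big1 ?addr0 => [|k nkr].
    by rewrite qcoefZ qcoef_mon !eqxx mulr1.
  by rewrite qcoefZ qcoef_mon eq_sym val_eqE (negPf nkr) mulr0.
have coefM2 b (r : 'I_M./2) :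
    qcoef (qsymbol_form b) (M - r) r = b.2 r * (q ^+ 'C(r, 2))%:C.
  rewrite qsymbol_formE // qcoefD !qcoef_sum.
  rewrite big1 ?add0r => [|k _]; last first.
    rewrite qcoefZ qcoef_mon; have := ltn_ord k; have := ltn_ord r.
    by case: eqP => [|_ _ _]; rewrite ?mulr0 //; lia.
  rewrite (bigD1 r) //= big1 ?addr0 => [|k nkr].
    by rewrite qcoefZ qcoef_mon !eqxx mulr1.
  by rewrite qcoefZ qcoef_mon andbC eq_sym val_eqE (negPf nkr) mulr0.
have qcoef_top i j : (i + j = M)%N ->
    qcoef (\sum_(k < M.+1) qcoef f k (M - k) *: (xs ^+ k * x ^+ (M - k))) i j =
    qcoef f i j.
  move=> ijM; have ltiM : (i < M.+1)%N by lia.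
  rewrite qcoef_sum (bigD1 (Ordinal ltiM)) //= big1 ?addr0 => [|k nki].
    by rewrite qcoefZ qcoef_mon eqxx -ijM addKn eqxx mulr1.
  rewrite qcoefZ qcoef_mon; case: eqP => [ik|_]; last by rewrite mulr0.
  by case/eqP: nki; apply: val_inj.
exists ([ffun r : 'I_(M./2).+1 => qcoef f r (M - r) / (q ^+ 'C(r, 2))%:C],
        [ffun r : 'I_M./2 => qcoef f (M - r) r / (q ^+ 'C(r, 2))%:C]).
split=> [|b eb].
  rewrite qsymbol_formE //=.
  under [X in _ = X + _]eq_bigr do rewrite ffunE divfK //.
  under [X in _ = _ + X]eq_bigr do rewrite ffunE divfK //.
  rewrite -(big_mkord xpredT (fun r => qcoef f r (M - r) *: (xs ^+ r * x ^+ (M - r)))).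
  have le2 : ((M./2).+1 <= M.+1)%N by lia.
  rewrite (big_cat_nat (leq0n _) le2) /= big_mkord; congr (_ + _).
  rewrite -(big_mkord xpredT (fun r => qcoef f (M - r) r *: (xs ^+ (M - r) * x ^+ r))).
  rewrite big_nat_rev /= -{1}[(M./2).+1]add0n big_addn.
  have -> : (M.+1 - (M./2).+1 = M./2)%N by lia.
  rewrite !big_mkord; apply: eq_bigr => r _.
  have -> : ((M./2).+1 + M.+1 - (r + (M./2).+1).+1 = M - r)%N.
    by have := ltn_ord r; lia.
  by rewrite subKn //; have := ltn_ord r; lia.
case: b eb => b b' eb; congr (_, _); apply/ffunP => r; rewrite ffunE.
  have := coefM1 (b, b') r; rewrite -eb qcoef_top => [->|]; first by rewrite mulfK.
  by have := ltn_ord r; lia.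
have := coefM2 (b, b') r; rewrite -eb qcoef_top => [->|]; first by rewrite mulfK.
by have := ltn_ord r; lia.
Qed.

End Degree.

Section Cones.
Variables (R : rcfType) (q : R).
Local Notation x := (qx q).
Local Notation xs := (qxs q).

Definition qden (b : qplane q) : Prop :=
  exists s : seq int, b = \prod_(k <- s) ((q ^ k)%:C *: (xs * x) + 1).

Definition qsos (a : qplane q) : Prop :=
  exists s : seq (qplane q), a = \sum_(g <- s) qstar g * g.

End Cones.

(* The inner product is linear in its first argument. *)
Record hilbertType (R : realType) := HilbertType {
  hilbert_sort :> completeNormedModType R[i];
  hdot : {dot hilbert_sort for Num.conj};
  hdot_norm : forall u, `|u| ^+ 2 = hdot u u }.

Section Operators.
Variables (R : realType) (H : hilbertType R).
Local Notation C := R[i].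
Local Notation "''[' u , v ]" := (@hdot R H u v).

Record partial_op := PartialOp { dom : set H; app :> H -> H }.
Implicit Types S T : partial_op.

Definition op_id := PartialOp setT id.

Definition op_comp S T := PartialOp (dom T `&` (T @^-1` dom S)) (S \o T).

Definition op_pow T (n : nat) := iter n (op_comp T) op_id.

Definition op_linear T : Prop :=
  dom T 0 /\ forall (a : C) u v, dom T u -> dom T v ->
    dom T (a *: u + v) /\ T (a *: u + v) = a *: T u + T v.

(* Single-valued, hence independent of the choice made by xget, when dom T is
   dense. *)
Definition op_adjoint T :=
  let graph v := [set w : H | forall u, dom T u -> '[T u, v] = '[u, w]] in
  PartialOp [set v | graph v !=set0] (fun v => xget 0 (graph v)).

Definition smooth_dom T : set H :=
  \bigcap_(n in [set n | (1 <= n)%N]) dom (op_pow T n).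

Definition qnormal (q : R) T : Prop :=
  [/\ op_linear T, dense (dom T), dom T = dom (op_adjoint T) &
      forall g, dom T g -> `|op_adjoint T g| = (Num.sqrt q)%:C * `|T g|].

(* The operator f(T, adjoint of T) with its natural domain; the monomials of zero
   coefficient put no constraint on the domain. *)
Definition qeval (q : R) (f : qplane q) T :=
  let mon i j := op_comp (op_pow (op_adjoint T) i) (op_pow T j) in
  PartialOp
    [set u | forall i j, qcoef f i j != 0 -> dom (mon i j) u]
    (fun u => \sum_(j < size (f : {poly {poly C}}))
       \sum_(i < size (f : {poly {poly C}})`_j) qcoef f i j *: mon i j u).

End Operators.

(* Main.v *)
Require Import Defs.
From HB Require Import structures.
From mathcomp Require Import all_boot all_order all_algebra.
From mathcomp Require Import complex polyrcf ring lra zify.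
From mathcomp Require Import boolp classical_sets functions reals topology normedtype sequences.
From mathcomp Require Import derive realfun trigo.
Set Implicit Arguments.
Unset Strict Implicit.
Unset Printing Implicit Defensive.
Import Order.TTheory GRing.Theory Num.Theory ComplexField.
Import numFieldNormedType.Exports.
Local Open Scope classical_set_scope.
Local Open Scope complex_scope.
Local Open Scope ring_scope.

(** The element f is first compared with the weight w = (1 + xs x)^(2 m), and the
    comparison is then made into a sum of squares by dividing by w.

    Positivity. Write s for the square root of q. The bilateral shifts
    e_k |-> r s^-k e_(k+1) are q-normal, and so is any countable direct sum of them.
    Applied to a direct sum of would-be counterexamples, the lower bound on q-normal
    operators therefore gives an eps which is the same for all shifts
    ([fiber_positive]). In the basis
    (e_k), suitably rescaled, the part of f of degree 4 m is the Toeplitz form of the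
    symbol on the circle of radius s, so that positivity of the symbol and compactness
    of the circle bound it from below by a multiple of (xs x)^(2 m). The terms of lower degree are
    absorbed with the help of eps. This gives d w <= f <= K w for some d, K > 0
    ([qpos_lower], [qpos_upper]), where the order refers to the forms of all shifts. Put
    deg (xs^i x^j) = j - i. By [qexp_fiber] the order can be described inside the
    algebra: a >= 0 if and only if for all b the part of degree 0 of star b * a * b is, as
    a polynomial in xs x, nonnegative on the half-line.

    Dividing by the weight. Let c = (K + d) w - f. Formally h = w^(-1/2) c w^(-1/2)
    satisfies 0 <= h <= K, and f = w^(1/2) (K + d - h) w^(1/2). Set alpha = K + d/2. The
    polynomial alpha - X + alpha (X / alpha)^(2 N) is nonnegative on the whole real line, so
    its value at h is a square, and K + d - h differs from it by
    d/2 - alpha (h / alpha)^(2 N), in which the second term is at most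
    alpha (K / alpha)^(2 N). The powers of h are made sense of in the algebra by
    multiplying with denominators: these satisfy an Ore condition ([affine_ore]), because
    passing a homogeneous element only rescales them, and so there are elements z_j with
    z_0 a denominator and c z_j = w z_(j+1) ([ore_chain]). The elements
    star z_i * w * z_j depend on i + j only, and therefore the square is a square in the
    algebra ([qsos_hankel]).

    The remainder. It has the form (d/2) beta^2 - E, where beta is a denominator,
    0 <= E <= eta beta^2, and all degrees of E are at most L = 8 m N in absolute value. The
    components of E of degrees n and -n are removed by completing a square, which costs
    2 eta beta^2 ([qsos_offdiag]); what is left after each of these steps is a polynomial in
    xs x that is nonnegative on the half-line, and such polynomials are sums of squares
    ([qsos_pol]). The total cost is (1 + 2 L) eta. Since L grows linearly with N while eta
    decreases geometrically ([geometric_small]), it is at most d/2 for large N. *)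

(** * Square-summable complex sequences *)

Lemma ge0_cvg_to (K : numFieldType) (T : Type) (F : set_system T)
    (FF : ProperFilter F) (f : T -> K) (l : K) :
  f @ F --> l -> (\near F, 0 <= f F) -> 0 <= l.
Proof.
move=> fl f0; have fnl : f @ F --> `|l|.
  apply: cvg_trans (cvg_norm fl); apply: near_eq_cvg.
  by near=> t; rewrite ger0_norm //; near: t.
by rewrite (cvg_unique _ fl fnl).
Unshelve. all: by end_near. Qed.

Lemma cvg_sum_sqr_norm (K : numFieldType) (T : Type) (F : set_system T)
    (FF : Filter F) n (f : nat -> T -> K) (l : nat -> K) :
  (forall i, f i @ F --> l i) ->
  (fun t => \sum_(i < n) `|f i t| ^+ 2) @ F --> \sum_(i < n) `|l i| ^+ 2.
Proof.
move=> fl; elim: n => [|n IHn].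
  by under eq_fun do rewrite big_ord0; rewrite big_ord0; apply: cvg_cst.
under eq_fun do rewrite big_ord_recr; rewrite big_ord_recr /=.
apply: cvgD => //; under eq_fun do rewrite expr2; rewrite expr2.
by apply: cvgM; apply: cvg_norm; apply: fl.
Qed.

(** The limit laws for sums and products require the complex numbers as a normed
    module over themselves. *)
HB.instance Definition _ (R : realType) :=
  NormedModule.copy R[i] (R[i] : numFieldType)^o.

Section SeriesC.
Variable R : realType.
Local Notation C := R[i].
Implicit Types a b : nat -> C.

Lemma normCR (x : C) : `|x| = (complex.Re `|x|)%:C.
Proof. by rewrite RRe_real // normr_real. Qed.

Lemma cvg_complex (T : Type) (F : set_system T) {FF : Filter F}
    (f g : T -> R) (a b : R) :
  f @ F --> a -> g @ F --> b -> (fun t => f t +i* g t) @ F --> a +i* b.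
Proof.
move=> /cvgrPdist_le fa /cvgrPdist_le gb; apply/cvgrPdist_le => e e0.
have eE : e = (complex.Re e)%:C by rewrite RRe_real // gtr0_real.
have e20 : 0 < complex.Re e / 2.
  by rewrite divr_gt0 // -ltcR -eE.
near=> t.
have -> : a +i* b - (f t +i* g t) = (a - f t)%:C + 'i%C * (b - g t)%:C.
  by simpc.
apply: le_trans (ler_normD _ _) _; rewrite normrM.
have -> : `|'i%C : C| = 1 by rewrite complexiE normCi.
rewrite mul1r eE [complex.Re e]splitr [leRHS]rmorphD; apply: lerD.
  rewrite normc_def /= expr0n addr0 sqrtr_sqr lecR.
  by near: t; exact: fa.
rewrite normc_def /= expr0n addr0 sqrtr_sqr lecR.
by near: t; exact: gb.
Unshelve. all: by end_near. Qed.

Lemma sum_complex n (r s : nat -> R) :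
  (\sum_(k < n) r k) +i* (\sum_(k < n) s k) = \sum_(k < n) (r k +i* s k).
Proof. by elim: n => [|n IHn]; rewrite ?big_ord0 // !big_ord_recr -IHn. Qed.

(** The real and the imaginary parts are absolutely summable real series. *)
Lemma bounded_series_cvg a (B : R) :
  (forall n, \sum_(i < n) `|a i| <= B%:C) ->
  exists l : C, (fun n => \sum_(i < n) a i : C) @ \oo --> l.
Proof.
move=> aB.
have real_case (r : nat -> R) : (forall i, `|r i|%:C <= `|a i|) ->
    cvgn (series r).
  move=> ra; apply: normed_cvg; apply: nondecreasing_is_cvgn.
    by apply: nondecreasing_series => n * /=; exact: normr_ge0.
  exists B => _ [n _ <-]; rewrite /normed_series_of seriesEord /= -lecR rmorph_sum /=.
  by apply: le_trans (aB n); apply: ler_sum.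
have cr := real_case (fun i => complex.Re (a i)) (fun i => normc_ge_Re _).
have ci : cvgn (series (fun i => complex.Im (a i))).
  apply: real_case => i; rewrite -[complex.Im _]opprK -ReiNIm normrN.
  apply: le_trans (normc_ge_Re _) _; rewrite normrM.
  have -> : `|'i%C : C| = 1 by rewrite complexiE normCi.
  by rewrite mulr1.
exists (lim (series (fun i => complex.Re (a i)) @ \oo) +i*
        lim (series (fun i => complex.Im (a i)) @ \oo)).
have := cvg_complex cr ci; set l := (_ +i* _) => al.
apply: cvg_trans (al _); apply: near_eq_cvg; near=> n.
rewrite !seriesEord /=.
by apply: (etrans (@sum_complex n (fun k => complex.Re (a k))
  (fun k => complex.Im (a k)))); apply: eq_bigr => i _; case: (a i).
Unshelve. all: by end_near. Qed.

End SeriesC.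

Section DotSchwarz.
Variables (K : numClosedFieldType) (U : lmodType K) (form : {dot U for Num.conj}).
Local Notation "''[' u , v ]" := (form u%R v%R).
Local Notation "''[' u ]" := '[u, u].

(** Expand the nonnegative squared norm of u minus its projection on v. *)
Lemma dot_CauchySchwarz (u v : U) : `|'[u, v]| ^+ 2 <= '[u] * '[v].
Proof.
have [->|v0] := eqVneq v 0; first by rewrite !linear0r normr0 expr0n.
have vp : 0 < '[v] by rewrite dnorm_gt0.
pose a := '[u, v] / '[v].
have := dnorm_ge0 form (u - a *: v); rewrite dnormB dnormZ /=.
rewrite linearZr_LR /= rmorphM fmorphV /= (geC0_conj (ltW vp)).
have -> : ('[u, v])^* / '[v] * '[u, v] = `|'[u, v]| ^+ 2 / '[v].
  by rewrite normCK mulrAC mulrC [_^* * _]mulrC mulrC.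
have cR : (`|'[u, v]| ^+ 2 / '[v])^* = `|'[u, v]| ^+ 2 / '[v].
  by rewrite geC0_conj // divr_ge0 ?exprn_ge0 // ltW.
rewrite cR normrM normfV (ger0_norm (ltW vp)) exprMn exprVn.
have -> : `|'[u, v]| ^+ 2 * '[v] ^- 2 * '[v] = `|'[u, v]| ^+ 2 / '[v].
  by rewrite expr2 invfM -!mulrA mulVf ?mulr1 // gt_eqF.
set x := _ / _; rewrite opprD addrA addrK subr_ge0 /x ler_pdivrMr //.
Qed.

Lemma dot_triangle (u v : U) :
  sqrtC '[u + v] <= sqrtC '[u] + sqrtC '[v].
Proof.
rewrite -ler_sqr ?nnegrE ?addr_ge0 ?sqrtC_ge0 ?dnorm_ge0 //.
rewrite sqrrD !sqrtCK dnormD addrAC lerD2r lerD2l mulr2n.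
have cs : `|'[u, v]| <= sqrtC '[u] * sqrtC '[v].
  rewrite -ler_sqr ?nnegrE ?mulr_ge0 ?sqrtC_ge0 ?dnorm_ge0 //.
  by rewrite exprMn !sqrtCK dot_CauchySchwarz.
have dR : '[u, v] + ('[u, v])^* \is Num.real.
  by rewrite CrealE rmorphD /= conjCK addrC.
apply: le_trans (real_ler_norm dR) _; apply: le_trans (ler_normD _ _) _.
by rewrite norm_conjC lerD.
Qed.

End DotSchwarz.

Section Ell2.
Variable R : realType.
Local Notation C := R[i].

(** Bounded partial sums rather than a convergent series: the bound passes to
    pointwise limits and to sub-families without any limit computation. *)
Definition square_summable : {pred nat -> C} :=
  [pred u : nat -> C | `[< exists B : R, forall n, \sum_(i < n) `|u i| ^+ 2 <= B%:C >]].

Lemma square_summableP (u : nat -> C) :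
  reflect (exists B : R, forall n, \sum_(i < n) `|u i| ^+ 2 <= B%:C)
          (u \in square_summable).
Proof. exact: asboolP. Qed.

Lemma sqr_normD_le (x y : C) : `|x + y| ^+ 2 <= 2 * `|x| ^+ 2 + 2 * `|y| ^+ 2.
Proof.
apply: (@le_trans _ _ ((`|x| + `|y|) ^+ 2)).
  by rewrite lerXn2r ?nnegrE ?addr_ge0 // ler_normD.
rewrite -subr_ge0.
have -> : 2 * `|x| ^+ 2 + 2 * `|y| ^+ 2 - (`|x| + `|y|) ^+ 2 = (`|x| - `|y|) ^+ 2.
  by ring.
by rewrite real_exprn_even_ge0 // rpredB // normr_real.
Qed.

Lemma square_summable_submod : submod_closed square_summable.
Proof.
split.
  by apply/square_summableP; exists 0 => n; rewrite big1 // => i _; rewrite normr0 expr0n.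
move=> a u v /square_summableP[A uA] /square_summableP[B vB].
apply/square_summableP; exists (2 * (complex.Re `|a|) ^+ 2 * A + 2 * B) => n.
apply: (@le_trans _ _ (2 * `|a| ^+ 2 * \sum_(i < n) `|u i| ^+ 2 +
                       2 * \sum_(i < n) `|v i| ^+ 2)).
  rewrite !mulr_sumr -big_split /=; apply: ler_sum => i _.
  by apply: le_trans (sqr_normD_le _ _) _; rewrite normrZ exprMn mulrA.
rewrite -[2%R in leLHS](rmorph_nat (real_complex R)) [`|a|]normCR -rmorphXn.
rewrite [leRHS]rmorphD !rmorphM.
apply: lerD; apply: ler_wpM2l => //; last by rewrite lecR.
by rewrite -!rmorphM ler0c mulr_ge0 // -expr2 sqr_ge0.
Qed.

HB.instance Definition _ := GRing.isSubmodClosed.Build _ _ square_summable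
  square_summable_submod.

Record ell2 := Ell2 { ell2_fun :> nat -> C; _ : ell2_fun \in square_summable }.
HB.instance Definition _ := [isSub for ell2_fun].
HB.instance Definition _ := [Choice of ell2 by <:].
HB.instance Definition _ := [SubChoice_isSubLmodule of ell2 by <:].

Implicit Types u v w : ell2.

Lemma ell2P u v : u =1 v -> u = v.
Proof. by move=> e; apply/val_inj/funext. Qed.

Lemma ell2_summable u : (u : nat -> C) \in square_summable.
Proof. exact: valP u. Qed.

Lemma ell2D u v i : (u + v) i = u i + v i. Proof. by []. Qed.
Lemma ell2Z a u i : (a *: u) i = a * u i. Proof. by []. Qed.
Lemma ell20 i : (0 : ell2) i = 0. Proof. by []. Qed.

Definition ell2_dot u v : C := lim ((fun n => \sum_(i < n) u i * (v i)^* : C) @ \oo).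

Lemma ell2_dot_cvg u v :
  (fun n => \sum_(i < n) u i * (v i)^* : C) @ \oo --> ell2_dot u v.
Proof.
have [[A uA] [B vB]] := (square_summableP _ (ell2_summable u),
  square_summableP _ (ell2_summable v)).
suff [l l_lim] : exists l : C, (fun n => \sum_(i < n) u i * (v i)^* : C) @ \oo --> l.
  by apply/cvg_ex; exists l.
apply: (@bounded_series_cvg R (fun i => u i * (v i)^*) (A + B)) => n.
rewrite rmorphD /=.
apply: le_trans (lerD (uA n) (vB n)); rewrite -big_split /=.
apply: ler_sum => i _; rewrite normrM norm_conjC.
rewrite -subr_ge0.
have -> : `|u i| ^+ 2 + `|v i| ^+ 2 - `|u i| * `|v i| =
  (`|u i| - `|v i|) ^+ 2 + `|u i| * `|v i| by ring.
apply: addr_ge0; last by rewrite mulr_ge0.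
by rewrite real_exprn_even_ge0 // rpredB // normr_real.
Qed.

Lemma ell2_dotE u v (l : C) :
  (fun n => \sum_(i < n) u i * (v i)^* : C) @ \oo --> l -> ell2_dot u v = l.
Proof. exact/cvg_unique/ell2_dot_cvg. Qed.

Lemma ell2_dotC u v : ell2_dot u v = (-1) ^+ false * (ell2_dot v u)^*.
Proof.
rewrite mul1r; apply: ell2_dotE; apply/cvgrPdist_le => e e0.
have /cvgrPdist_le/(_ _ e0) := @ell2_dot_cvg v u.
apply: filterS => n; rewrite -norm_conjC rmorphB /= rmorph_sum /=.
by under eq_bigr do rewrite rmorphM /= conjCK mulrC.
Qed.

Lemma ell2_dot_linear v : scalar (ell2_dot^~ v).
Proof.
move=> a u w; apply: ell2_dotE.
have := cvgD (cvgMl_tmp (a := a) (@ell2_dot_cvg u v)) (@ell2_dot_cvg w v).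
move/(_ _ _); apply: cvg_trans; apply: near_eq_cvg; near=> n => /=.
rewrite !fctE mulr_sumr -big_split /=; apply: eq_bigr => i _.
by rewrite [a *: _]/(a * _) mulrDl mulrA.
Unshelve. all: by end_near. Qed.

Lemma ell2_dot_linearr u :
  GRing.linear_for (Num.conj \; *%R : C -> C -> C) (ell2_dot u).
Proof.
move=> a v w; rewrite ell2_dotC mul1r ell2_dot_linear rmorphD rmorphM /=.
by rewrite [ell2_dot u v]ell2_dotC [ell2_dot u w]ell2_dotC !mul1r.
Qed.

HB.instance Definition _ := bilinear_isBilinear.Build _ _ _ _ _ _ ell2_dot
  (pair ell2_dot_linear ell2_dot_linearr).

HB.instance Definition _ := isHermitianSesquilinear.Build _ _ _ _ ell2_dot
  ell2_dotC.

Lemma ell2_dot_partial u n : \sum_(i < n) `|u i| ^+ 2 <= ell2_dot u u.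
Proof.
rewrite -subr_ge0; have /(_ _ _) := cvgB (@ell2_dot_cvg u u) (cvg_cst (\sum_(i < n) `|u i| ^+ 2)).
move/ge0_cvg_to; apply; near=> k.
have nk : (n <= k)%N by near: k; exists n.
rewrite !fctE /= subr_ge0 -(big_mkord xpredT (fun i => `|u i| ^+ 2)).
rewrite -(big_mkord xpredT (fun i => u i * (u i)^*)) (big_cat_nat (leq0n n) nk) /=.
under [X in _ <= X + _]eq_bigr do rewrite -normCK.
by rewrite lerDl sumr_ge0 // => i _; rewrite -normCK exprn_ge0.
Unshelve. all: by end_near. Qed.

Lemma ell2_dot_bound u (B : C) :
  (forall n, \sum_(i < n) `|u i| ^+ 2 <= B) -> ell2_dot u u <= B.
Proof.
move=> uB; rewrite -subr_ge0.
have /(_ _ _) := cvgB (cvg_cst B) (@ell2_dot_cvg u u).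
move/ge0_cvg_to; apply; near=> k; rewrite !fctE /= subr_ge0.
by apply: le_trans (uB k); apply: ler_sum => i _; rewrite normCK.
Unshelve. all: by end_near. Qed.

Lemma ell2_dot_gt0 u : u != 0 -> 0 < ell2_dot u u.
Proof.
move=> u0; have [i ui] : exists i, u i != 0.
  apply: contrapT => nu; case/eqP: u0; apply: ell2P => i; apply/eqP.
  by apply: contrapT => ui; apply: nu; exists i; apply/negP.
apply: lt_le_trans (ell2_dot_partial u i.+1).
rewrite big_ord_recr /=; apply: ltr_wpDl; last by rewrite exprn_gt0 ?normr_gt0.
by rewrite sumr_ge0 // => j _; rewrite exprn_ge0.
Qed.

HB.instance Definition _ := isDotProduct.Build _ _ ell2_dot ell2_dot_gt0.

Definition ell2_norm u : C := sqrtC (ell2_dot u u).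

Lemma ell2_normD u v : ell2_norm (u + v) <= ell2_norm u + ell2_norm v.
Proof. exact: dot_triangle. Qed.

Lemma ell2_normZ a u : ell2_norm (a *: u) = `|a| * ell2_norm u.
Proof.
by rewrite /ell2_norm dnormZ rootCMl ?exprn_ge0 // exprCK.
Qed.

Lemma ell2_norm0_eq0 u : ell2_norm u = 0 -> u = 0.
Proof.
by move/eqP; rewrite /ell2_norm sqrtC_eq0 dnorm_eq0 => /eqP.
Qed.

HB.instance Definition _ := Lmodule_isNormed.Build C ell2
  ell2_normD ell2_normZ ell2_norm0_eq0.

Lemma ell2_dot_norm u : `|u| ^+ 2 = ell2_dot u u.
Proof. exact: sqrtCK. Qed.

Lemma ell2_norm_partial u n : \sum_(i < n) `|u i| ^+ 2 <= `|u| ^+ 2.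
Proof. by rewrite ell2_dot_norm; apply: ell2_dot_partial. Qed.

Lemma ell2_norm_bound u (e : C) : 0 <= e ->
  (forall n, \sum_(i < n) `|u i| ^+ 2 <= e ^+ 2) -> `|u| <= e.
Proof.
move=> e0 ue; rewrite -(@ler_pXn2r _ 2) ?nnegrE // ell2_dot_norm.
exact: ell2_dot_bound.
Qed.

Lemma ell2_coord_le u i : `|u i| <= `|u|.
Proof.
rewrite -(@ler_pXn2r _ 2) ?nnegrE //; apply: le_trans (ell2_norm_partial u i.+1).
by rewrite big_ord_recr /= lerDr sumr_ge0 // => j _; rewrite exprn_ge0.
Qed.

(** The coordinates are 1-Lipschitz, so a Cauchy filter converges coordinatewise;
    the bounds on finite partial sums survive in the limit, which shows both that
    the limit is square-summable and that the convergence is in norm. *)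
Lemma ell2_complete (F : set_system ell2) :
  ProperFilter F -> cauchy F -> cvg F.
Proof.
move=> FF /cauchy_ballP Fc.
have coord_cvg (g : C -> R) i : {morph g : x y / x - y} ->
    (forall x, `|g x|%:C <= `|x|) -> cvg ((fun v : ell2 => g (v i)) @ F).
  move=> gB gle; apply/cauchy_cvgP/cauchy_exP => e e0.
  have e0' : 0 < e%:C :> C by rewrite ltcR.
  have /cauchy_ballP/cauchyP/(_ _ e0')[u Fu] := Fc.
  exists (g (u i)).
  suff: F [set v : ell2 | ball (g (u i)) e (g (v i))] by [].
  apply: filterS Fu => v uv; rewrite /=.
  rewrite /ball /= -ltcR -gB; apply: le_lt_trans (gle _) _.
  by apply: le_lt_trans (ell2_coord_le (u - v) i) _.
have rc i := coord_cvg (@complex.Re R) i (raddfB _) (@normc_ge_Re R).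
have ic i : cvg ((fun v : ell2 => complex.Im (v i)) @ F).
  apply: coord_cvg => [|x]; first exact: raddfB.
  rewrite -[complex.Im _]opprK -ReiNIm normrN.
  apply: le_trans (normc_ge_Re _) _; rewrite normrM.
  by rewrite complexiE normCi mulr1.
pose l i : C := lim ((fun v : ell2 => complex.Re (v i)) @ F) +i*
            lim ((fun v : ell2 => complex.Im (v i)) @ F).
have lP i : (fun v : ell2 => v i : C) @ F --> l i.
  have := cvg_complex (rc i) (ic i) => /(_ _).
  apply: cvg_trans; apply: near_eq_cvg; apply: nearW => v /=.
  by case: (v i).
(* Fatou: the partial sums of the distance to v are bounded along the filter. *)
have close (e : C) : 0 < e -> exists2 v : ell2,
    (forall n, \sum_(i < n) `|v i - l i| ^+ 2 <= e ^+ 2) & F (ball v e).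
  move=> e0; have /cauchy_ballP/cauchyP/(_ e e0)[v Fv] := Fc.
  exists v => // n; rewrite -subr_ge0.
  have : (fun w : ell2 => e ^+ 2 - \sum_(i < n) `|v i - w i| ^+ 2) @ F -->
      e ^+ 2 - \sum_(i < n) `|v i - l i| ^+ 2.
    apply: cvgB; first exact: cvg_cst.
    apply: (@cvg_sum_sqr_norm C _ F _ n (fun i (w : ell2) => v i - w i)
      (fun i => v i - l i)) => i; apply: cvgB; first exact: cvg_cst.
    exact: lP.
  move/ge0_cvg_to; apply; apply: filterS Fv => w vw.
  rewrite subr_ge0; apply: le_trans (ell2_norm_partial (v - w) n) _.
  by rewrite ler_sqr ?nnegrE ?normr_ge0 ?(ltW e0) // ltW.
have ls : l \in square_summable.
  have [v vl _] := close 1 ltr01.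
  have -> : l = (v : nat -> C) - ((v : nat -> C) - l) by rewrite opprB addrC subrK.
  apply: rpredB; first exact: ell2_summable.
  by apply/square_summableP; exists 1 => n; apply: le_trans (vl n) _; rewrite expr1n.
apply/cvg_ex; exists (Ell2 ls); apply/cvgrPdist_le => e e0.
have e20 : 0 < e / 2 by rewrite divr_gt0.
have [v vl Fv] := close _ e20.
apply: filterS Fv => w vw; rewrite [leRHS]splitr.
have -> : Ell2 ls - w = (v - w) - (v - Ell2 ls) by rewrite opprB [RHS]addrC addrA subrK.
apply: le_trans (ler_normB _ _) _; apply: lerD; first exact: ltW.
by apply: ell2_norm_bound; rewrite ?(ltW e20).
Qed.

HB.instance Definition _ := Uniform_isComplete.Build ell2 ell2_complete.

Definition ell2_hilbert : hilbertType R := HilbertType ell2_dot_norm.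

End Ell2.

(** * Weighted shifts as q-normal operators *)

Lemma conj_real (R : rcfType) (a : R) : (a%:C)^* = a%:C :> R[i].
Proof. exact: conjc_real. Qed.

Section Ell2Finite.
Variable R : realType.
Local Notation C := R[i].
Local Notation ell2 := (ell2 R).
Implicit Types u v : ell2.
Local Notation "''[' u , v ]" := (ell2_dot u v).

Lemma ler_sum_inj (F : nat -> C) (p : nat -> nat) n : injective p ->
  (forall i, 0 <= F i) -> exists N, \sum_(i < n) F (p i) <= \sum_(i < N) F i.
Proof.
move=> pI F0; pose s := [seq p i | i <- iota 0 n].
exists (\max_(i <- s) i).+1.
rewrite -(big_mkord xpredT (fun i => F (p i))) -(big_mkord xpredT F).
rewrite /index_iota !subn0 -(big_map p xpredT F) -/s.
rewrite [leRHS](bigID [in s]) /= -[X in _ <= X + _]big_filter.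
have sE : perm_eq s [seq x <- iota 0 (\max_(i <- s) i).+1 | x \in s].
  apply: uniq_perm; rewrite ?filter_uniq ?iota_uniq ?(map_inj_uniq pI) ?iota_uniq //.
  move=> x; rewrite mem_filter mem_iota /= add0n ltnS.
  by case: (boolP (x \in s)) => // xs; rewrite (@leq_bigmax_seq _ s xpredT id x xs).
by rewrite -(perm_big _ sE) lerDl sumr_ge0.
Qed.

Lemma square_summable_inj u (p : nat -> nat) : injective p ->
  (fun i => u (p i)) \in @square_summable R.
Proof.
move=> pI; have [B uB] := square_summableP _ (ell2_summable u).
apply/square_summableP; exists B => n.
have [i|N le] := @ler_sum_inj (fun i => `|u i| ^+ 2) p n pI; first exact: exprn_ge0.
exact: le_trans le (uB N).
Qed.

Definition ell2_reindex (p : nat -> nat) (pI : injective p) u : ell2 :=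
  Ell2 (square_summable_inj u pI).

(** Each partial sum of one series is dominated by a partial sum of the other. *)
Lemma ell2_reindex_norm (p p' : nat -> nat) (pI : injective p) u :
  cancel p p' -> cancel p' p -> '[ell2_reindex pI u, ell2_reindex pI u] = '[u, u].
Proof.
move=> pK p'K; apply/eqP; rewrite eq_le; apply/andP; split.
  apply: ell2_dot_bound => n.
  have [i|N le] := @ler_sum_inj (fun i => `|u i| ^+ 2) p n pI; first exact: exprn_ge0.
  exact: le_trans le (ell2_dot_partial u N).
apply: ell2_dot_bound => n.
have [i|N le] := @ler_sum_inj (fun i => `|ell2_reindex pI u i| ^+ 2) p' n (can_inj p'K).
  exact: exprn_ge0.
apply: le_trans (le_trans le (ell2_dot_partial _ N)).
by under [leRHS]eq_bigr do rewrite /= p'K.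
Qed.

(** Polarization of the preservation of the norm. *)
Lemma ell2_reindex_dot (p p' : nat -> nat) (pI : injective p) u v :
  cancel p p' -> cancel p' p -> '[ell2_reindex pI u, ell2_reindex pI v] = '[u, v].
Proof.
move=> pK p'K; pose S := ell2_reindex pI.
have S_norm x : '[S x, S x] = '[x, x] by apply: ell2_reindex_norm pK p'K.
have re x y : '[S x, S y] + '[S x, S y]^* = '[x, y] + '[x, y]^*.
  have := S_norm (x + y).
  have -> : S (x + y) = S x + S y by apply: ell2P.
  by rewrite !dnormD /= !S_norm => /addrI.
have := re ('i%R *: u) v.
have -> : S ('i%R *: u) = 'i%R *: S u by apply: ell2P.
rewrite !linearZl_LR /= !rmorphM /= conjCi !mulNr -!mulrBr => /(mulfI (neq0Ci _)) e1.
have e2 := re u v.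
have sumE (a b : C) : a - b + (a + b) = a * 2 by ring.
have /= := congr2 +%R e1 e2; rewrite !sumE => /mulIf; apply.
by rewrite pnatr_eq0.
Qed.

(** A dense space on which weighted shifts and their adjoints are defined and
    which they preserve; all computations with operators take place there. *)
Definition finsupp u := exists N, forall i, (N <= i)%N -> u i = 0.

Lemma dot_finsupp u v N : (forall i, (N <= i)%N -> u i = 0) ->
  '[u, v] = \sum_(i < N) u i * (v i)^*.
Proof.
move=> u0; apply: ell2_dotE.
have cs : (fun _ : nat => \sum_(i < N) u i * (v i)^* : C) @ \oo -->
    \sum_(i < N) u i * (v i)^* by apply: cvg_cst.
apply: cvg_trans cs; apply: near_eq_cvg; near=> n.
have Nn : (N <= n)%N by near: n; exists N.
rewrite -(big_mkord xpredT (fun i => u i * (v i)^*)).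
rewrite -[RHS](big_mkord xpredT (fun i => u i * (v i)^*)).
rewrite [RHS](big_cat_nat (leq0n N) Nn) /= [X in _ = _ + X]big_nat_cond.
by rewrite [X in _ + X]big1 ?addr0 // => i /andP[/andP[/u0-> _] _]; rewrite mul0r.
Unshelve. all: by end_near. Qed.

Lemma square_summable_finsupp (a : nat -> C) N :
  (forall i, (N <= i)%N -> a i = 0) -> a \in @square_summable R.
Proof.
move=> a0; apply/square_summableP.
exists (complex.Re (\sum_(i < N) `|a i| ^+ 2)) => n.
rewrite RRe_real ?ger0_real ?sumr_ge0 // => [|i _]; last exact: exprn_ge0.
rewrite -(big_mkord xpredT (fun i => `|a i| ^+ 2)).
rewrite -[leRHS](big_mkord xpredT (fun i => `|a i| ^+ 2)).
have [nN|/ltnW Nn] := leqP n N.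
  rewrite [leRHS](big_cat_nat (leq0n n) nN) /= lerDl sumr_ge0 // => i _.
  exact: exprn_ge0.
rewrite (big_cat_nat (leq0n N) Nn) /= [X in _ + X]big_nat_cond.
rewrite [X in _ + X]big1 ?addr0 // => i /andP[/andP[/a0-> _] _].
by rewrite normr0 expr0n.
Qed.

Lemma ell2_delta_subproof i : (fun j => (j == i)%:R : C) \in @square_summable R.
Proof. by apply: (@square_summable_finsupp _ i.+1) => j; case: eqP => // ->; rewrite ltnn. Qed.

Definition ell2_delta i : ell2 := Ell2 (ell2_delta_subproof i).

Lemma dot_delta i v : '[ell2_delta i, v] = (v i)^*.
Proof.
rewrite (@dot_finsupp _ _ i.+1) => [|j]; last by rewrite /=; case: eqP => // ->; rewrite ltnn.
rewrite big_ord_recr big1 => [|j _]; first by rewrite /= eqxx mul1r add0r.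
by rewrite /= (ltn_eqF (ltn_ord j)) mul0r.
Qed.

Lemma dot_delta2 i j : '[ell2_delta i, ell2_delta j] = (i == j)%:R.
Proof. by rewrite dot_delta /= conjC_nat. Qed.

Lemma ell2_trunc_subproof u n : (fun j => if (j < n)%N then u j else 0) \in @square_summable R.
Proof. by apply: (@square_summable_finsupp _ n) => j; rewrite ltnNge => ->. Qed.

Definition ell2_trunc u n : ell2 := Ell2 (ell2_trunc_subproof u n).

(** The tail of a convergent series with nonnegative terms is small. *)
Lemma ell2_trunc_near u (e : C) : 0 < e -> exists n, `|u - ell2_trunc u n| < e.
Proof.
move=> e0; have e20 : 0 < (e / 2) ^+ 2 by rewrite exprn_gt0 // divr_gt0.
have /cvgrPdist_lt/(_ _ e20)[n _ /(_ n (leqnn n)) /= le] := @ell2_dot_cvg _ u u.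
exists n; apply: (@le_lt_trans _ _ (e / 2)); last first.
  by rewrite ltr_pdivrMr // mulr_natr mulr2n ltrDl.
apply: ell2_norm_bound => [|k]; first by rewrite ltW // divr_gt0.
apply: le_trans (ltW le).
have sqE j : u j * (u j)^* = `|u j| ^+ 2 by rewrite normCK.
under [X in _ <= `| _ - X |]eq_bigr do rewrite sqE.
rewrite ger0_norm ?subr_ge0 ?ell2_dot_partial // lerBrDl.
apply: le_trans (ell2_dot_partial u (maxn n k)).
rewrite -(big_mkord xpredT (fun i => `|u i| ^+ 2)).
rewrite -[leRHS](big_mkord xpredT (fun i => `|u i| ^+ 2)).
rewrite -(big_mkord xpredT (fun i => `|(u - ell2_trunc u n) i| ^+ 2)).
rewrite [leRHS](big_cat_nat (leq0n n) (leq_maxl n k)) /= lerD2l.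
apply: (@le_trans _ _ (\sum_(0 <= i < maxn n k) `|(u - ell2_trunc u n) i| ^+ 2)).
  rewrite [leRHS](big_cat_nat (leq0n k) (leq_maxr n k)) /= lerDl sumr_ge0 // => i _.
  exact: exprn_ge0.
rewrite (big_cat_nat (leq0n n) (leq_maxl n k)) /= big_nat_cond big1 => [|i].
  rewrite add0r big_nat_cond [leRHS]big_nat_cond; apply: ler_sum => i.
  by case/andP=> /andP[ni _] _; rewrite !fctE ltnNge ni /= subr0.
by case/andP=> /andP[_ ni] _; rewrite !fctE ni subrr normr0 expr0n.
Qed.

End Ell2Finite.

Section WeightedShift.
Variables (R : realType) (q : R) (hq : 0 < q).
Local Notation C := R[i].
Local Notation ell2 := (ell2 R).
Local Notation H := (ell2_hilbert R).
Local Notation s := (Num.sqrt q).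
Variables (sg sg' : nat -> nat) (sgK : cancel sg sg') (sg'K : cancel sg' sg).
Variables (w : nat -> R) (hw : forall i, w i = s * w (sg i)).
Implicit Types u v : ell2.
Local Notation "''[' u , v ]" := (ell2_dot u v).

Let s_gt0 : 0 < s. Proof. by rewrite sqrtr_gt0. Qed.

(** The weighted shift is delta_i |-> w i delta_(sg i), unbounded in general. The
    permutation sg is arbitrary, so that a countable direct sum of bilateral shifts
    is again of this form once its index set is identified with nat; the relation
    between w i and w (sg i) is what q-normality amounts to. Off the domain the
    operator and its adjoint are given the value 0. *)
Definition wmul u : nat -> C := fun i => (w i)%:C * u i.
Definition wshift_dom : set ell2 := [set u | wmul u \in @square_summable R].
Definition wshift_app u : ell2 :=
  ell2_reindex (can_inj sg'K) (insubd (0 : ell2) (wmul u)).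
Definition wshift : partial_op H := @PartialOp R H wshift_dom wshift_app.
Definition wshift_adj u : ell2 :=
  insubd (0 : ell2) (fun i => (w i)%:C * u (sg i)).

Lemma wshift_appE u : wshift_dom u ->
  forall j, wshift_app u j = (w (sg' j))%:C * u (sg' j).
Proof. by move=> du j; rewrite /wshift_app /= insubdK. Qed.

Lemma wshift_adj_summable v : wshift_dom v ->
  (fun i => (w i)%:C * v (sg i)) \in @square_summable R.
Proof.
move=> dv; pose y : ell2 := Ell2 dv.
have := square_summable_inj (s%:C *: y) (can_inj sgK).
suff -> : (fun i => (s%:C *: y) (sg i)) = (fun i => (w i)%:C * v (sg i)) by [].
by apply/funext => i; rewrite ell2Z /= /wmul mulrA -rmorphM -hw.
Qed.

Lemma wshift_adjE v : wshift_dom v ->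
  forall i, wshift_adj v i = (w i)%:C * v (sg i).
Proof. by move=> dv i; rewrite /wshift_adj insubdK //; apply: wshift_adj_summable. Qed.

Lemma wshift_adjoint u v : wshift_dom u -> wshift_dom v ->
  '[wshift_app u, v] = '[u, wshift_adj v].
Proof.
move=> du dv.
rewrite -(ell2_reindex_dot (can_inj sgK) _ _ sgK sg'K); apply: ell2_dotE.
apply: cvg_trans (@ell2_dot_cvg _ u (wshift_adj v)); apply: near_eq_cvg.
apply: nearW => n; apply: eq_bigr => i _.
rewrite wshift_adjE // -[RHS]/(wshift_app u (sg i) * (v (sg i))^* ).
by rewrite wshift_appE // sgK /= rmorphM /= conj_real; ring.
Qed.

Lemma finsupp_dom u : finsupp u -> wshift_dom u.
Proof.
case=> N u0; apply: (@square_summable_finsupp _ _ N) => i Ni.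
by rewrite /wmul u0 // mulr0.
Qed.

Lemma finsupp_delta i : finsupp (ell2_delta R i).
Proof. by exists i.+1 => j; rewrite /=; case: eqP => // ->; rewrite ltnn. Qed.

Lemma bounded_image (p : nat -> nat) N : exists M, forall i, (i < N)%N -> (p i < M)%N.
Proof.
exists (\max_(i < N) p i).+1 => i iN; rewrite ltnS.
exact: (@leq_bigmax _ (fun i : 'I_N => p i) (Ordinal iN)).
Qed.

Lemma finsupp_app u : finsupp u -> finsupp (wshift_app u).
Proof.
move=> fu; have du := finsupp_dom fu; have [N u0] := fu.
have [M sM] := bounded_image sg N.
exists M => j Mj; rewrite wshift_appE // u0 ?mulr0 // leqNgt; apply/negP => jN.
by have := sM _ jN; rewrite sg'K ltnNge Mj.
Qed.

Lemma finsupp_adj u : finsupp u -> finsupp (wshift_adj u).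
Proof.
move=> fu; have du := finsupp_dom fu; have [N u0] := fu.
have [M sM] := bounded_image sg' N.
exists M => j Mj; rewrite wshift_adjE // u0 ?mulr0 // leqNgt; apply/negP => jN.
by have := sM _ jN; rewrite sgK ltnNge Mj.
Qed.

(** Test the defining identity of the adjoint on the basis vectors. *)
Lemma adjoint_graph_unique v (z : ell2) :
  (forall u, wshift_dom u -> '[wshift_app u, v] = '[u, z]) ->
  forall i, z i = (w i)%:C * v (sg i).
Proof.
move=> gz i; apply: (can_inj (@conjCK _)).
have di := finsupp_dom (finsupp_delta i).
rewrite -dot_delta -gz //.
have -> : wshift_app (ell2_delta R i) = (w i)%:C *: ell2_delta R (sg i).
  apply: ell2P => j; rewrite wshift_appE // ell2Z /=.
  have [<-|ne] := eqVneq (sg' j) i; first by rewrite sg'K eqxx.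
  have [je|_] := eqVneq j (sg i); first by rewrite je sgK eqxx in ne.
  by rewrite !mulr0.
by rewrite linearZl_LR /= dot_delta rmorphM /= conj_real.
Qed.

Lemma op_adjoint_dom : dom (op_adjoint wshift) = wshift_dom.
Proof.
rewrite predeqE => v; split=> [[z gz]|dv]; last first.
  by exists (wshift_adj v) => u du; apply: wshift_adjoint.
have zE := adjoint_graph_unique gz.
have := square_summable_inj (s%:C^-1 *: z) (can_inj sg'K).
rewrite /wshift_dom /=; suff -> : (fun i => (s%:C^-1 *: z) (sg' i)) = wmul v by [].
apply/funext => j; rewrite ell2Z zE sg'K /wmul [w (sg' j)]hw sg'K rmorphM mulrA mulKf //.
by rewrite fmorph_eq0 gt_eqF.
Qed.

Lemma op_adjoint_app v : wshift_dom v -> op_adjoint wshift v = wshift_adj v.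
Proof.
move=> dv; rewrite /op_adjoint /=.
case: xgetP => [z _ gz|]; last by move/(_ (wshift_adj v)); case=> u du; apply: wshift_adjoint.
by apply: ell2P => i; rewrite wshift_adjE // (adjoint_graph_unique gz).
Qed.

Lemma wshift_linear (a : C) u v : wshift_dom u -> wshift_dom v ->
  wshift_dom (a *: u + v) /\ wshift_app (a *: u + v) = a *: wshift_app u + wshift_app v.
Proof.
move=> du dv; have duv : wshift_dom (a *: u + v).
  rewrite /wshift_dom /=; have -> : wmul (a *: u + v) = a *: wmul u + wmul v.
    by apply/funext => i; rewrite /wmul !fctE ell2D ell2Z mulrDr mulrCA.
  by rewrite rpredD // rpredZ.
split=> //; apply: ell2P => j; rewrite ell2D ell2Z !wshift_appE //.
by rewrite ell2D ell2Z mulrDr mulrCA.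
Qed.

(** The norms of the operator and of its adjoint at g are the norms of two
    reindexings of w g, the second one scaled by the square root of q. *)
Lemma wshift_qnormal : qnormal q wshift.
Proof.
split.
- split; first by apply: finsupp_dom; exists 0.
  exact: wshift_linear.
- move=> O [u Ou] oO.
  have /nbhs_ballP[e /= e0 eO] : nbhs u O by apply: open_nbhs_nbhs.
  have [n un] := ell2_trunc_near u e0.
  exists (ell2_trunc u n); split; last first.
    apply: finsupp_dom; exists n => i; rewrite /= leqNgt => /negPf ->; done.
  exact: eO.
- by rewrite op_adjoint_dom.
- move=> g dg; rewrite op_adjoint_app //; pose y : ell2 := Ell2 dg.
  have -> : wshift_adj g = s%:C *: ell2_reindex (can_inj sgK) y.
    apply: ell2P => i; rewrite wshift_adjE // ell2Z /= /wmul.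
    by rewrite mulrA -rmorphM -hw.
  have -> : wshift g = ell2_reindex (can_inj sg'K) y.
    by apply: ell2P => i; rewrite [LHS]wshift_appE.
  rewrite normrZ ger0_norm ?ler0c ?(ltW s_gt0) //; congr (_ * _).
  rewrite [LHS]/(sqrtC _) [RHS]/(sqrtC _); congr sqrtC.
  by rewrite (ell2_reindex_norm _ _ sgK sg'K) (ell2_reindex_norm _ _ sg'K sgK).
Qed.

Lemma finsupp_iter u n : finsupp u -> finsupp (iter n wshift_app u).
Proof. by move=> fu; elim: n => //= n; apply: finsupp_app. Qed.

Lemma finsupp_iter_adj u n : finsupp u -> finsupp (iter n wshift_adj u).
Proof. by move=> fu; elim: n => //= n; apply: finsupp_adj. Qed.

Lemma op_pow_wshift n u : finsupp u ->
  dom (op_pow wshift n) u /\ op_pow wshift n u = iter n wshift_app u.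
Proof.
move=> fu; elim: n => [//|n [dn en]]; split.
  by split=> //=; rewrite /preimage /= en; apply/finsupp_dom/finsupp_iter.
by rewrite /= en.
Qed.

Lemma op_pow_adjoint n u : finsupp u ->
  op_pow (op_adjoint wshift) n u = iter n wshift_adj u.
Proof.
move=> fu; elim: n => [//|n en].
rewrite -[LHS]/(op_adjoint wshift (op_pow (op_adjoint wshift) n u)) en.
by rewrite op_adjoint_app //; apply/finsupp_dom/finsupp_iter_adj.
Qed.

Lemma smooth_wshift u : finsupp u -> smooth_dom wshift u.
Proof. by move=> fu n _; have [] := op_pow_wshift n fu. Qed.

Lemma dot_iter_adj u v n : finsupp u -> finsupp v ->
  '[iter n wshift_adj u, v] = '[u, iter n wshift_app v].
Proof.
move=> fu; elim: n v => [//|n IHn] v fv.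
rewrite [in RHS]iterSr -IHn; last exact: finsupp_app.
rewrite /= [LHS]ell2_dotC [RHS]ell2_dotC !mul1r; congr (_^* ).
by rewrite wshift_adjoint //; apply: finsupp_dom => //; apply: finsupp_iter_adj.
Qed.

Lemma dot_qeval (f : qplane q) u : finsupp u ->
  hdot H (qeval f wshift u) u =
  \sum_(j < size (f : {poly {poly C}})) \sum_(i < size (f : {poly {poly C}})`_j)
    qcoef f i j * '[iter j wshift_app u, iter i wshift_app u].
Proof.
move=> fu; rewrite /qeval /= linear_sumlz; apply: eq_bigr => j _.
rewrite linear_sumlz; apply: eq_bigr => i _.
rewrite linearZl_LR /= (op_pow_wshift j fu).2 op_pow_adjoint; last exact: finsupp_iter.
by rewrite dot_iter_adj //; apply: finsupp_iter.
Qed.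

End WeightedShift.

(** * A lower bound uniform over all shifts *)

Section Functional.
Variables (R : rcfType) (q : R).
Local Notation C := R[i].
Local Notation P := {poly {poly C}}.
Local Notation x := (qx q).
Local Notation xs := (qxs q).
Implicit Types f g : qplane q.
Implicit Types W : nat -> nat -> C.

Lemma qcoefD f g i j : qcoef (f + g) i j = qcoef f i j + qcoef g i j.
Proof. by rewrite /qcoef !coefD. Qed.

Lemma qcoefZ a f i j : qcoef (a *: f) i j = a * qcoef f i j.
Proof. by rewrite /qcoef -[a *: f]/(a%:P *: (f : P)) coefZ mul_polyC coefZ. Qed.

Definition qlam W f : C := \sum_(j < size (f : P)) \sum_(i < size (f : P)`_j)
  qcoef f i j * W i j.

Lemma qcoef_gt f n i j : (qdeg f <= n)%N -> (n < i + j)%N -> qcoef f i j = 0.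
Proof.
move=> /qdegP fn; rewrite ltnNge => ij; apply/eqP; apply: contraNT ij; exact: fn.
Qed.

Lemma big_ord_widen0 (n m : nat) (F : nat -> C) : (n <= m)%N ->
  (forall i, (n <= i)%N -> F i = 0) -> \sum_(i < n) F i = \sum_(i < m) F i.
Proof.
move=> nm F0; rewrite -(big_mkord xpredT F) -[RHS](big_mkord xpredT F).
rewrite [RHS](big_cat_nat (leq0n n) nm) /= [X in _ = _ + X]big_nat_cond.
by rewrite [X in _ + X]big1 ?addr0 // => i /andP[/andP[/F0-> _] _].
Qed.

Lemma qlam_wid W f n : (qdeg f < n)%N ->
  qlam W f = \sum_(j < n) \sum_(i < n) qcoef f i j * W i j.
Proof.
move=> fn; pose m := maxn n (maxn (size (f : P)) (\max_(j < size (f : P)) size ((f : P)`_j)%R)%N).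
have nm : (n <= m)%N by rewrite leq_maxl.
have inner j : \sum_(i < size (f : P)`_j) qcoef f i j * W i j =
    \sum_(i < m) qcoef f i j * W i j.
  apply: (@big_ord_widen0 _ _ (fun i => qcoef f i j * W i j)) => [|i ji]; last first.
    by rewrite /qcoef (leq_sizeP _ _ (leqnn _)) ?mul0r.
  have [jf|jf] := ltnP j (size (f : P)).
    rewrite /m !leq_max; apply/orP; right; apply/orP; right.
    exact: (@leq_bigmax _ (fun j : 'I__ => size ((f : P)`_j)%R) (Ordinal jf)).
  by rewrite (leq_sizeP _ _ (leqnn _)) // size_poly0.
have -> : qlam W f = \sum_(j < m) \sum_(i < m) qcoef f i j * W i j.
  rewrite /qlam; under eq_bigr do rewrite inner.
  apply: (@big_ord_widen0 _ _ (fun j => \sum_(i < m) qcoef f i j * W i j)) => [|j ji].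
    by rewrite /m !leq_max leqnn orbT.
  rewrite big1 // => i _; rewrite /qcoef [(f : P)`_j](leq_sizeP _ _ (leqnn _)) //.
  by rewrite coef0 mul0r.
symmetry; rewrite -(@big_ord_widen0 n m (fun j => \sum_(i < m) qcoef f i j * W i j)) //.
  apply: eq_bigr => j _.
  apply: (@big_ord_widen0 _ _ (fun i => qcoef f i j * W i j)) => // i ni.
  by rewrite (@qcoef_gt f (qdeg f)) ?mul0r //; lia.
by move=> j nj; rewrite big1 // => i _; rewrite (@qcoef_gt f (qdeg f)) ?mul0r //; lia.
Qed.

Lemma qlam_linear W : scalar (qlam W).
Proof.
move=> a f g; pose n := (maxn (qdeg (a *: f + g)) (maxn (qdeg f) (qdeg g))).+1.
rewrite !(@qlam_wid W _ n) ?ltnS ?leq_max ?leqnn ?orbT //.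
rewrite mulr_sumr -big_split /=; apply: eq_bigr => j _.
rewrite mulr_sumr -big_split /=; apply: eq_bigr => i _.
by rewrite qcoefD qcoefZ; ring.
Qed.

HB.instance Definition _ W := GRing.isLinear.Build C (qplane q) C *%R (qlam W)
  (qlam_linear W).

Lemma qlam_mon W i j : qlam W (xs ^+ i * x ^+ j) = W i j.
Proof.
have dg : (qdeg (xs ^+ i * x ^+ j)%R < (i + j).+1)%N.
  rewrite ltnS; apply/qdegP => k l; rewrite qcoef_mon.
  by have [->|] := eqVneq k i; have [->|] := eqVneq l j; rewrite ?eqxx.
have li : (i < (i + j).+1)%N by rewrite ltnS leq_addr.
have lj : (j < (i + j).+1)%N by rewrite ltnS leq_addl.
rewrite (qlam_wid _ dg) (bigD1 (Ordinal lj)) //= (bigD1 (Ordinal li)) //=.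
rewrite qcoef_mon !eqxx mul1r big1 => [|k kj]; last first.
  rewrite qcoef_mon andbC; have [ki|_] := eqVneq (k : nat) i; last by rewrite andbF mul0r.
  by case/eqP: kj; apply: val_inj.
rewrite addr0 big1 ?addr0 // => l lij; rewrite big1 // => k _.
rewrite qcoef_mon; have [ki|_] := eqVneq (l : nat) j; last by rewrite andbF mul0r.
by case/eqP: lij; apply: val_inj.
Qed.

Lemma qcoef_top (f : qplane q) i j :
  qcoef (qtop f) i j = if (i + j == qdeg f)%N then qcoef f i j else 0.
Proof.
have E n (F : nat -> qplane q) : qcoef (\sum_(k < n) F k) i j = \sum_(k < n) qcoef (F k) i j.
  elim: n => [|n IHn]; first by rewrite !big_ord0 /qcoef !coef0.
  by rewrite !big_ord_recr /= qcoefD IHn.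
rewrite /qtop (E _ (fun k => qcoef f k (qdeg f - k) *: (xs ^+ k * x ^+ (qdeg f - k)))).
case: eqP => [ij|nij].
  have iM : (i < (qdeg f).+1)%N by lia.
  rewrite (bigD1 (Ordinal iM)) //= big1 => [|k ki].
    by rewrite addr0 qcoefZ qcoef_mon eqxx -ij addKn eqxx mulr1.
  rewrite qcoefZ qcoef_mon; case: eqP => [ik|_]; last by rewrite mulr0.
  by case/eqP: ki; apply: val_inj.
rewrite big1 // => k _; rewrite qcoefZ qcoef_mon.
case: eqP => [ik|_] /=; last by rewrite mulr0.
case: eqP => [jk|_]; last by rewrite mulr0.
by case: nij; rewrite ik jk subnKC // -ltnS.
Qed.

End Functional.

Section Fiber.
Variables (R : realType) (q : R) (hq : 0 < q).
Local Notation C := R[i].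
Local Notation ell2 := (ell2 R).
Local Notation s := (Num.sqrt q).

(** Let T be the bilateral shift e_k |-> r s^-k e_(k+1), s the square root of q.
    This is the weight of T^j at e_k. *)
Definition shift_weight (r : R) (k j : nat) : R := \prod_(a < j) (r * s ^- (k + a)).

(** The inner product of T^j phi and T^i phi for this T and for the vector phi with
    coordinates phi 0, ..., phi (n - 1); it is what the monomial xs^i x^j contributes
    to the form of f at phi. *)
Definition fiber_mon (r : R) (n : nat) (phi : nat -> C) (i j : nat) : C :=
  \sum_(k < n) \sum_(l < n) ((k + j)%N == (l + i)%N)%:R *
    (shift_weight r k j * shift_weight r l i)%:C * (phi k * (phi l)^* ).

Let s_gt0 : 0 < s. Proof. by rewrite sqrtr_gt0. Qed.

Section Embed.
Variables (sg sg' : nat -> nat) (sgK : cancel sg sg') (sg'K : cancel sg' sg).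
Variables (w : nat -> R) (hw : forall i, w i = s * w (sg i)).
Variables (e : nat -> nat) (eI : injective e) (sge : forall k, sg (e k) = e k.+1).
Local Notation app := (wshift_app sg'K w).
Local Notation "''[' u , v ]" := (ell2_dot u v).

Lemma wshift_delta i : app (ell2_delta R i) = (w i)%:C *: ell2_delta R (sg i).
Proof.
have di := finsupp_dom w (finsupp_delta R i).
apply: ell2P => j; rewrite wshift_appE // ell2Z /=.
have [<-|ne] := eqVneq (sg' j) i; first by rewrite sg'K eqxx.
have [je|_] := eqVneq j (sg i); first by rewrite je sgK eqxx in ne.
by rewrite !mulr0.
Qed.

Lemma finsuppD (a : C) (u v : ell2) : finsupp u -> finsupp v -> finsupp (a *: u + v).
Proof.
move=> [N u0] [M v0]; exists (maxn N M) => i; rewrite geq_max => /andP[Ni Mi].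
by rewrite ell2D ell2Z u0 // v0 // mulr0 addr0.
Qed.

Lemma finsupp_sum n (c : nat -> C) (d : nat -> nat) :
  finsupp (\sum_(k < n) c k *: ell2_delta R (d k)).
Proof.
elim: n => [|n IHn]; first by rewrite big_ord0; exists 0.
by rewrite big_ord_recr /= addrC; apply: finsuppD => //; apply: finsupp_delta.
Qed.

Lemma wshift_sum n (c : nat -> C) (d : nat -> nat) :
  app (\sum_(k < n) c k *: ell2_delta R (d k)) =
  \sum_(k < n) (c k * (w (d k))%:C) *: ell2_delta R (sg (d k)).
Proof.
elim: n => [|n IHn].
  rewrite !big_ord0; apply: ell2P => j.
  by rewrite wshift_appE ?ell20 ?mulr0 //; apply: finsupp_dom; exists 0.
rewrite big_ord_recr [RHS]big_ord_recr /= addrC.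
have [_ ->] := wshift_linear sg'K (w := w) (c n)
  (finsupp_dom w (finsupp_delta R (d n))) (finsupp_dom w (finsupp_sum n c d)).
by rewrite IHn wshift_delta scalerA addrC.
Qed.

Lemma wshift_iter_sum n (c : nat -> C) j :
  iter j app (\sum_(k < n) c k *: ell2_delta R (e k)) =
  \sum_(k < n) (c k * (\prod_(a < j) w (e (k + a)))%:C) *: ell2_delta R (e (k + j)).
Proof.
elim: j => [|j IHj] /=.
  by apply: eq_bigr => k _; rewrite big_ord0 mulr1 addn0.
rewrite IHj (wshift_sum n (fun k => c k * (\prod_(a < j) w (e (k + a)))%:C)
  (fun k => e (k + j))).
by apply: eq_bigr => k _; rewrite sge big_ord_recr /= -mulrA -rmorphM addnS.
Qed.

Lemma dot_sum n (c d : nat -> C) (a b : nat -> nat) :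
  '[\sum_(k < n) c k *: ell2_delta R (e (a k)), \sum_(k < n) d k *: ell2_delta R (e (b k))]
  = \sum_(k < n) \sum_(l < n) (a k == b l)%:R * (c k * (d l)^* ).
Proof.
rewrite linear_sumlz; apply: eq_bigr => k _; rewrite linear_sumr; apply: eq_bigr => l _.
by rewrite linearZl_LR linearZr_LR /= dot_delta2 (inj_eq eI); ring.
Qed.

Lemma dot_iter n (phi : nat -> C) r i j :
  (forall k, w (e k) = r * s ^- k) ->
  '[iter j app (\sum_(k < n) phi k *: ell2_delta R (e k)),
    iter i app (\sum_(k < n) phi k *: ell2_delta R (e k))] = fiber_mon r n phi i j.
Proof.
move=> we; rewrite !wshift_iter_sum.
rewrite (dot_sum n (fun k => phi k * (\prod_(a < j) w (e (k + a)))%:C)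
  (fun k => phi k * (\prod_(a < i) w (e (k + a)))%:C) (fun k => k + j)%N (fun k => k + i)%N).
apply: eq_bigr => k _; apply: eq_bigr => l _.
rewrite rmorphM /= conj_real /shift_weight.
under eq_bigr do rewrite we; under [in X in _ * (_ * X)]eq_bigr do rewrite we.
by rewrite rmorphM /=; ring.
Qed.

Lemma dot_embed n (phi : nat -> C) :
  '[\sum_(k < n) phi k *: ell2_delta R (e k), \sum_(k < n) phi k *: ell2_delta R (e k)]
  = \sum_(k < n) `|phi k| ^+ 2.
Proof.
rewrite (dot_sum n phi phi id id); apply: eq_bigr => k _.
rewrite (bigD1 k) //= eqxx mul1r -normCK big1 ?addr0 // => l lk.
by rewrite val_eqE eq_sym (negPf lk) mul0r.
Qed.

End Embed.

(** If no lower bound served all shifts, then for every N there would be a shift and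
    a vector that refute 1/(N+1). The direct sum of all these shifts is one q-normal
    operator, and the lower bound that the hypothesis gives for it is refuted by the
    N-th summand as soon as 1/(N+1) is below it. *)
Lemma fiber_positive (f : qplane q) :
  (forall (H : hilbertType R) (X : partial_op H), qnormal q X ->
    exists eps : R, 0 < eps /\ forall phi, smooth_dom X phi ->
      eps%:C * hdot H phi phi <= hdot H (qeval f X phi) phi) ->
  exists2 eps : R, 0 < eps & forall r n (phi : nat -> C),
    eps%:C * \sum_(k < n) `|phi k| ^+ 2 <= qlam (fiber_mon r n phi) f.
Proof.
move=> hpos; apply: contrapT => neg.
have /choice[F FP] N : exists p : R * nat * (nat -> C),
    ~ ((N.+1%:R^-1)%:C * \sum_(k < p.1.2) `|p.2 k| ^+ 2 <=
       qlam (fiber_mon p.1.1 p.1.2 p.2) f).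
  apply: contrapT => nex; apply: neg; exists (N.+1%:R^-1); first by rewrite invr_gt0.
  by move=> r n phi; apply: contrapT => nle; apply: nex; exists (r, n, phi).
(* Basis vectors are indexed by the pair of a summand and a position; codes of no
   pair are fixed by the permutation and get weight 0. *)
pose I : countType := (nat * int)%type.
pose tr (d : int) i := if @pickle_inv I i is Some (N, k) then @pickle I (N, k + d) else i.
have trK d d' : d + d' = 0 -> cancel (tr d) (tr d').
  move=> dd i; rewrite /tr; case E: (@pickle_inv I i) => [[N k]|]; last by rewrite E.
  rewrite pickleK_inv -addrA dd addr0.
  by have := @pickle_invK I i; rewrite E.
pose w i : R := if @pickle_inv I i is Some (N, k) then (F N).1.1 * s ^ (- k) else 0.
have hw i : w i = s * w (tr 1 i).
  rewrite /w /tr; case E: (@pickle_inv I i) => [[N k]|]; last by rewrite E mulr0.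
  rewrite pickleK_inv mulrCA opprD expfzDr ?gt_eqF // exprN1.
  by rewrite [s * _]mulrCA divff ?gt_eqF ?mulr1.
have sgK := trK 1 (-1) (subrr _); have sg'K := trK (-1) 1 (addNr _).
have [eps [eps0 epsP]] := hpos _ _ (wshift_qnormal hq sgK sg'K hw).
have [N Neps] : exists N, N.+1%:R^-1 < eps.
  exists (Num.bound eps^-1); rewrite -[ltRHS]invrK ltf_pV2 ?posrE ?invr_gt0 //.
  by apply: lt_le_trans (archi_boundP _) _; rewrite ?ler_nat // invr_ge0 ltW.
pose e k := @pickle I (N, k%:Z).
have eI : injective e by move=> k l /(pcan_inj (@pickleK_inv _)) [].
have sge k : tr 1 (e k) = e k.+1.
  by rewrite /tr /e pickleK_inv -PoszD addn1.
have we k : w (e k) = (F N).1.1 * s ^- k.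
  by rewrite /w /e pickleK_inv exprnN.
pose u := \sum_(k < (F N).1.2) (F N).2 k *: ell2_delta R (e k).
have fu : finsupp u by apply: finsupp_sum.
have sd : smooth_dom (wshift sg'K w) u by apply: smooth_wshift.
have := epsP u sd.
rewrite (dot_qeval sgK sg'K hw) //.
under eq_bigr do under eq_bigr do rewrite (dot_iter sgK sg'K eI sge _ _ _ _ we).
rewrite -/(qlam _ _) [hdot _ _ _](dot_embed eI) => le; apply: (FP N).
apply: le_trans le; apply: ler_wpM2r; last by rewrite lecR ltW.
by apply: sumr_ge0 => k _; rewrite exprn_ge0.
Qed.

End Fiber.

(** * Toeplitz forms and trigonometric polynomials *)

Section Circle.
Variable R : realType.
Local Notation C := R[i].
Implicit Types x y : R.

Definition cis x : C := cos x +i* sin x.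

Lemma cisD x y : cis (x + y) = cis x * cis y.
Proof. by rewrite /cis cosD sinD; simpc; rewrite [sin x * cos y + _]addrC. Qed.

Lemma cis0 : cis 0 = 1. Proof. by rewrite /cis cos0 sin0. Qed.

Lemma cisX x n : cis x ^+ n = cis (n%:R * x).
Proof.
elim: n => [|n IHn]; first by rewrite mul0r cis0.
by rewrite exprS IHn -cisD -{1}[x]mul1r -mulrDl -natr1 addrC.
Qed.

Lemma cis_conj x : (cis x)^* = cis (- x).
Proof. by rewrite /cis cosN sinN. Qed.

Lemma cisNr x : cis x * cis (- x) = 1.
Proof. by rewrite -cisD subrr cis0. Qed.

Lemma cis_norm x : `|cis x| = 1.
Proof. by rewrite normc_def /= cos2Dsin2 sqrtr1. Qed.

Lemma cis_neq1 x : 0 < x -> x < pi *+ 2 -> cis x != 1.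
Proof.
move=> x0 x2; apply/eqP => -[c1 _].
have s0 : 0 < sin (x / 2).
  apply: sin_gt0_pi; rewrite divr_gt0 //= ltr_pdivrMr //.
  by rewrite mulr_natr.
have := cosD (x / 2) (x / 2); rewrite -splitr c1.
have := cos2Dsin2 (x / 2); rewrite !expr2; nra.
Qed.

Lemma cis_2pi : cis (pi *+ 2) = 1.
Proof. by rewrite /cis cos2pi sin2pi. Qed.

Lemma twopi_gt0 : 0 < pi *+ 2 :> R.
Proof. by rewrite mulr2n addr_gt0 ?pi_gt0. Qed.

(** The sum is geometric, and its ratio is an L-th root of unity other than 1. *)
Lemma cis_root_sum (L d : nat) : (0 < d < L)%N ->
  \sum_(p < L) cis (pi *+ 2 / L%:R) ^+ (p * d) = 0.
Proof.
case/andP=> d0 dL; have L0 : (L%:R : R) != 0 by rewrite pnatr_eq0; lia.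
set z := cis _; have zL : z ^+ L = 1.
  by rewrite cisX mulrC divfK // cis_2pi.
have zd : z ^+ d != 1.
  rewrite cisX; apply: cis_neq1.
    by rewrite mulr_gt0 ?ltr0n // divr_gt0 ?ltr0n ?(leq_trans _ dL) // twopi_gt0.
  rewrite mulrCA gtr_pMr ?twopi_gt0 //.
  by rewrite ltr_pdivrMr ?ltr0n ?(leq_ltn_trans _ dL) // mul1r ltr_nat.
have := subrX1 (z ^+ d) L; rewrite -exprM mulnC exprM zL expr1n subrr.
move/esym/eqP; rewrite mulf_eq0 subr_eq0 (negPf zd) /= => /eqP e.
by apply: etrans e; apply: eq_bigr => p _; rewrite -exprM mulnC.
Qed.

Lemma cis_orthogonal (L a b : nat) : (a < L)%N -> (b < L)%N ->
  \sum_(p < L) cis (p%:R * (pi *+ 2 / L%:R)) ^+ a *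
     (cis (p%:R * (pi *+ 2 / L%:R)))^* ^+ b = (a == b)%:R * L%:R.
Proof.
set t := pi *+ 2 / L%:R.
have E (c d : nat) p : (c <= d)%N ->
    cis (p%:R * t) ^+ d * (cis (p%:R * t))^* ^+ c = cis t ^+ (p * (d - c)).
  move=> cd; rewrite cis_conj -[in LHS](subnK cd) exprD -mulrA -exprMn cisNr.
  by rewrite expr1n mulr1 -cisX -exprM.
move=> aL bL; have [-> |ne] := eqVneq a b.
  under eq_bigr do rewrite E // subnn muln0 expr0.
  by rewrite sumr_const card_ord mul1r.
rewrite mul0r; have [ab|ba] := ltnP a b; last first.
  under eq_bigr do rewrite E //; apply: cis_root_sum; lia.
apply: (can_inj (@conjCK _)); rewrite rmorph_sum rmorph0 /=.
under eq_bigr do rewrite rmorphM !rmorphXn /= conjCK mulrC E ?(ltnW ab) //.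
apply: cis_root_sum; lia.
Qed.

Definition trig_poly (M : nat) (al : nat -> C) x : C :=
  \sum_(i < M.+1) al i * (cis x ^+ (M - i) * (cis x)^* ^+ i).

(** Sampling at the L-th roots of unity, with L above every index that occurs,
    diagonalizes the Toeplitz form: it becomes a sum of values of the trigonometric
    polynomial times squared moduli. *)
Lemma toeplitz_lower (M n : nat) (al : nat -> C) (c : C) (y : nat -> C) :
  (forall x, 0 <= x <= pi *+ 2 -> c <= trig_poly M al x) ->
  c * \sum_(k < n) `|y k| ^+ 2 <=
  \sum_(i < M.+1) al i * \sum_(k < n) \sum_(l < n)
     ((k + (M - i))%N == (l + i)%N)%:R * (y k * (y l)^* ).
Proof.
move=> cle; pose L := (n + M).+1; have L0 : 0 < (L%:R : C) by rewrite ltr0n.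
pose t (p : nat) : R := p%:R * (pi *+ 2 / L%:R).
pose Y p := \sum_(k < n) y k * cis (t p) ^+ k.
rewrite -(ler_pM2r L0) -subr_ge0.
have -> : (\sum_(i < M.+1) al i * \sum_(k < n) \sum_(l < n)
     ((k + (M - i))%N == (l + i)%N)%:R * (y k * (y l)^* )) * L%:R =
    \sum_(p < L) trig_poly M al (t p) * `|Y p| ^+ 2.
  under [RHS]eq_bigr do rewrite /trig_poly mulr_suml.
  rewrite [RHS]exchange_big [LHS]mulr_suml; apply: eq_bigr => i _ /=.
  under [RHS]eq_bigr do rewrite -mulrA.
  rewrite -mulr_sumr -mulrA; congr (_ * _).
  under [RHS]eq_bigr do rewrite normCK /Y rmorph_sum mulr_suml mulr_sumr.
  rewrite [RHS]exchange_big [LHS]mulr_suml; apply: eq_bigr => k _ /=.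
  under [RHS]eq_bigr do rewrite mulr_sumr mulr_sumr.
  rewrite [RHS]exchange_big [LHS]mulr_suml; apply: eq_bigr => l _ /=.
  have kl : (k + (M - i) < L)%N /\ (l + i < L)%N.
    by have := ltn_ord k; have := ltn_ord l; have := ltn_ord i; rewrite /L; lia.
  rewrite mulrAC -cis_orthogonal ?kl.1 ?kl.2 // mulr_suml; apply: eq_bigr => p _.
  by rewrite rmorphM rmorphXn /= !exprD; ring.
have -> : c * (\sum_(k < n) `|y k| ^+ 2) * L%:R = \sum_(p < L) c * `|Y p| ^+ 2.
  rewrite -mulr_sumr -mulrA; congr (_ * _).
  under [RHS]eq_bigr do rewrite normCK /Y rmorph_sum mulr_suml.
  rewrite [RHS]exchange_big [LHS]mulr_suml; apply: eq_bigr => k _ /=.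
  under [RHS]eq_bigr do rewrite mulr_sumr.
  rewrite [RHS]exchange_big [RHS](bigD1 k) //= [X in _ + X]big1 ?addr0 => [|l lk].
    under eq_bigr do rewrite rmorphM rmorphXn /= mulrACA -normCK.
    have kL : (k < L)%N by have := ltn_ord k; rewrite /L; lia.
    by rewrite -mulr_sumr cis_orthogonal // eqxx mul1r.
  under eq_bigr do rewrite rmorphM rmorphXn /= mulrACA.
  rewrite -mulr_sumr cis_orthogonal.
  - by rewrite eq_sym val_eqE (negPf lk) mul0r mulr0.
  - by have := ltn_ord k; rewrite /L; lia.
  - by have := ltn_ord l; rewrite /L; lia.
rewrite -sumrB; apply: sumr_ge0 => p _; rewrite -mulrBl mulr_ge0 ?exprn_ge0 //.
rewrite subr_ge0; apply: cle; have pL := ltn_ord p.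
have pi2 := ltW twopi_gt0.
rewrite /t mulr_ge0 ?divr_ge0 //= mulrCA ler_piMr //.
by rewrite ler_pdivrMr ?ltr0n // mul1r ler_nat ltnW.
Qed.

Lemma continuous_sum_fun n (F : nat -> R -> R) :
  (forall i, continuous (F i)) -> continuous (fun x => \sum_(i < n) F i x).
Proof.
move=> Fc; elim: n => [|n IHn] x.
  by under eq_fun do rewrite big_ord0; apply: cvg_cst.
have -> : (fun z => \sum_(i < n.+1) F i z) = (fun z => \sum_(i < n) F i z + F n z).
  by apply/funext => z; rewrite big_ord_recr.
exact: (cvgD (IHn x) (Fc n x)).
Qed.

Lemma cis_pow_conj x M i : (i <= M)%N ->
  cis x ^+ (M - i) * (cis x)^* ^+ i = cis ((M%:R - i%:R *+ 2) * x).
Proof.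
move=> iM; rewrite cis_conj !cisX -cisD natrB //; congr cis.
by ring.
Qed.

(** A positive continuous function on a compact interval is bounded away from 0. *)
Lemma trig_poly_min (M : nat) (al : nat -> C) :
  (forall x, 0 < trig_poly M al x) ->
  exists2 c : R, 0 < c & forall x, 0 <= x <= pi *+ 2 -> c%:C <= trig_poly M al x.
Proof.
move=> pos; pose g (i : nat) x : R :=
  complex.Re (al i) * cos ((M%:R - i%:R *+ 2) * x) -
  complex.Im (al i) * sin ((M%:R - i%:R *+ 2) * x).
pose G x : R := \sum_(i < M.+1) g i x.
have GE x : trig_poly M al x = (G x)%:C.
  rewrite -[LHS]RRe_real ?gtr0_real //.
  suff -> : complex.Re (trig_poly M al x) = G x by [].
  rewrite /trig_poly /G raddf_sum /=; apply: eq_bigr => i _.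
  rewrite cis_pow_conj; last by rewrite -ltnS.
  by rewrite /g /cis; case: (al i).
have Gc : continuous G.
  apply: continuous_sum_fun => i x.
  have lin : continuous (fun x : R => (M%:R - i%:R *+ 2) * x).
    by move=> z; apply: cvgM; [exact: cvg_cst|exact: cvg_id].
  apply: cvgB; apply: cvgM; try exact: cvg_cst.
    exact: (continuous_comp (lin x) (@continuous_cos _ _)).
  exact: (continuous_comp (lin x) (@continuous_sin _ _)).
have pi2 := ltW twopi_gt0.
have [x0 _ x0P] := EVT_min pi2 (continuous_subspaceT Gc).
exists (G x0); first by rewrite -ltcR -GE.
by move=> x xI; rewrite GE lecR; apply: x0P; rewrite in_itv.
Qed.

End Circle.

(** * The symbol as the leading part of the shift forms *)

Lemma bin2_int (j : nat) : 'C(j, 2)%:Z * 2 = j%:Z * j%:Z - j%:Z.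
Proof. by elim: j => [|j IHj] //; rewrite binS bin1; lia. Qed.

Section Symbol.
Variables (R : realType) (q : R) (hq : 0 < q).
Local Notation C := R[i].
Local Notation s := (Num.sqrt q).
Local Notation x := (qx q).
Local Notation xs := (qxs q).

Let s_gt0 : 0 < s. Proof. by rewrite sqrtr_gt0. Qed.
Let s_neq0 : s != 0. Proof. by rewrite gt_eqF. Qed.

Lemma qX_sqrt n : q ^+ n = s ^ (n%:Z * 2).
Proof. rewrite mulrC -exprz_exp; have -> : s ^ 2 = q by rewrite -exprnP sqr_sqrtr ?ltW.
by []. Qed.

Lemma exprz_expn (z : int) n : (s ^ z) ^+ n = s ^ (z * n%:Z).
Proof. by rewrite exprnP exprz_exp. Qed.

(** On the circle of radius s, the square root of q. The power of s collects the
    moduli in the symbol and the factor q^C(r, 2) that relates (xs x)^r to the monomial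
    basis. *)
Definition symbol_coef (f : qplane q) (i : nat) : C :=
  qcoef f i (qdeg f - i) * (s ^ ((qdeg f)./2%:Z - (i * (qdeg f - i))%:Z))%:C.

(** The symbol contains the half-integral exponents M/2 - i of the angle, for M the
    degree; evaluating it at a square turns them into the exponents M - 2 i. *)
Lemma symbol_trig (f : qplane q) (t : R) : ~~ odd (qdeg f) ->
  qsymbol f (s%:C * cis t ^+ 2) = trig_poly (qdeg f) (symbol_coef f) t.
Proof.
move=> evenM; rewrite /symbol_coef /qsymbol /=.
have bE : qtop f = @qsymbol_form R q (qdeg f) (qsymbol_coef f).
  rewrite /qsymbol_coef; case: xgetP => [b _ //|]; have q0 : q != 0 by rewrite gt_eqF.
  by have [b [bE _]] := qsymbol_form_unique q0 evenM; move/(_ b).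
move: (qsymbol_coef f) bE => B; rewrite qsymbol_formE // /qtop /trig_poly.
move: (qdeg f) B evenM => M B evenM.
have M2 : M = (M./2 + M./2)%N by rewrite addnn -[LHS]odd_double_half (negPf evenM).
pose W (i j : nat) : C := (s ^ (M./2%:Z - (i * j)%:Z))%:C * (cis t ^+ j * (cis t)^* ^+ i).
move/(congr1 (qlam W)); rewrite raddfD /= !raddf_sum /= => e.
have -> : \sum_(i < M.+1) qcoef f i (M - i) *
      (s ^ (M./2%:Z - (i * (M - i))%:Z))%:C *
      (cis t ^+ (M - i) * (cis t)^* ^+ i) =
    \sum_(i < M.+1) qlam W (qcoef f i (M - i) *: (xs ^+ i * x ^+ (M - i))).
  by apply: eq_bigr => i _; rewrite linearZ /= qlam_mon /W -mulrA.
rewrite e {e}.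
have nw : `|s%:C * cis t ^+ 2| = s%:C.
  by rewrite normrM normrX cis_norm expr1n mulr1 ger0_norm // ler0c ltW.
have cis2 n : (cis t ^+ 2) ^+ n = cis ((n%:R *+ 2) * t).
  by rewrite -exprM cisX natrM mulr_natl.
have key (r : nat) : (r <= M./2)%N ->
    (q ^+ 'C(r, 2)) * s ^ (M./2%:Z - (r * (M - r))%:Z) =
    s ^- (r * (M - 2 * r)) * s ^+ (M./2 - r).
  move=> rM; rewrite qX_sqrt !exprnN ?exprnP -!expfzDr //; congr (_ ^ _).
  rewrite bin2_int !PoszM -!subzn ?PoszM; [|lia..].
  by rewrite [in (M : int)]M2; lia.
congr (_ + _); apply: eq_bigr => r _; rewrite linearZ /= qlam_mon /W nw.
  have rM : (r <= M./2)%N by rewrite -ltnS.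
  rewrite cis_pow_conj; last by lia.
  rewrite exprMn cis2 -!mulrA; congr (_ * _).
  rewrite !mulrA -!rmorphXn -fmorphV -!rmorphM key //; congr (_ * cis (_ * _)).
  by rewrite natrB // [in M%:R]M2 natrD; ring.
have rM : (r < M./2)%N by [].
have rM' : (r <= M./2)%N by rewrite ltnW.
have -> : cis t ^+ r * (cis t)^* ^+ (M - r) = cis ((M%:R - (M - r)%:R *+ 2) * t).
  rewrite -cis_pow_conj ?leq_subr // subKn //; lia.
have cis2' n : (cis (- t) ^+ 2) ^+ n = cis ((n%:R *+ 2) * - t).
  by rewrite -exprM cisX natrM mulr_natl.
rewrite rmorphM rmorphXn /= conj_real cis_conj exprMn cis2' -!mulrA; congr (_ * _).
rewrite (mulnC (M - r)%N) [RHS]mulrA -rmorphM key // mulrA mulrAC.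
rewrite -!rmorphXn -fmorphV -rmorphM [s ^+ _ * _]mulrC; congr (_ * cis _).
rewrite !natrB //; last by lia.
have -> : (M%:R : R) = (M./2)%:R *+ 2 by rewrite {1}M2 natrD mulr2n.
by ring.
Qed.
End Symbol.

Section FiberBounds.
Variables (R : realType) (q : R) (hq : 0 < q).
Local Notation C := R[i].
Local Notation s := (Num.sqrt q).
Local Notation x := (qx q).
Local Notation xs := (qxs q).

Let s_gt0 : 0 < s. Proof. by rewrite sqrtr_gt0. Qed.
Let s_neq0 : s != 0. Proof. by rewrite gt_eqF. Qed.

Lemma shift_weightE (r : R) (k j : nat) :
  shift_weight q r k j = (r * s ^- k) ^+ j * s ^- 'C(j, 2).
Proof.
elim: j => [|j IHj]; first by rewrite /shift_weight big_ord0 !mul1r invr1.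
rewrite /shift_weight big_ord_recr /= -/(shift_weight q r k j) IHj binS bin1.
by rewrite [in RHS]addnC !exprD !invfM exprSr; ring.
Qed.

(** On monomials of top degree the shift weights factor through the positions k and
    l, up to a constant that depends on i and j only. Hence the top degree part
    acts as a Toeplitz form on rescaled coordinates. *)
Lemma shift_weight_lead (r : R) (m i j k l : nat) : (i + j = 4 * m)%N ->
  (k + j = l + i)%N ->
  shift_weight q r k j * shift_weight q r l i =
  s ^ ((2 * m)%:Z - (i * j)%:Z) * ((r * s ^- k) ^+ (2 * m) * (r * s ^- l) ^+ (2 * m)).
Proof.
move=> ijm kl; rewrite !shift_weightE !exprMn.
have -> : forall a b c d e g : R, a * b * c * (d * e * g) = (a * d) * (b * c * e * g).
  by move=> *; ring.
rewrite -exprD addnC ijm.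
have -> : forall a b c d e : R, a * (b * c * (d * e)) = (b * d) * (a * c * e).
  by move=> *; ring.
rewrite -exprD; congr (r ^+ _ * _); first by lia.
rewrite -!exprVn -!exprM !exprVn !exprnN -!expfzDr //; congr (_ ^ _).
have bj := bin2_int j; have bi := bin2_int i.
have iE : i%:Z = 4 * m%:Z - j%:Z by lia.
have lE : l%:Z = k%:Z + 2 * j%:Z - 4 * m%:Z by lia.
apply: (@mulIf _ 2) => //; rewrite !PoszM !mulrDl !mulNr bi bj lE iE; lia.
Qed.

(** When k + j = l + i the positions k and l differ by a constant, so the weights
    along both paths are comparable with powers of the weight at either end. *)
Lemma shift_weight_bound (i j : nat) : exists2 K : R, 0 <= K & forall r k l,
  0 <= r -> (k + j = l + i)%N ->
  shift_weight q r k j * shift_weight q r l i <= K * (r * s ^- k) ^+ (i + j) /\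
  shift_weight q r k j * shift_weight q r l i <= K * (r * s ^- l) ^+ (i + j).
Proof.
pose K1 := s ^ ((i%:Z - j%:Z) * i%:Z) * (s ^- 'C(j, 2) * s ^- 'C(i, 2)).
pose K2 := s ^ ((j%:Z - i%:Z) * j%:Z) * (s ^- 'C(j, 2) * s ^- 'C(i, 2)).
have K10 : 0 < K1 by rewrite !mulr_gt0 ?exprz_gt0 ?invr_gt0 ?exprn_gt0.
have K20 : 0 < K2 by rewrite !mulr_gt0 ?exprz_gt0 ?invr_gt0 ?exprn_gt0.
exists (K1 + K2) => [|r k l r0 kl]; first by rewrite ltW ?addr_gt0.
have vE : r * s ^- l = (r * s ^- k) * s ^ (i%:Z - j%:Z).
  by rewrite -mulrA !exprnN -expfzDr //; congr (_ * _ ^ _); lia.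
have vE' : r * s ^- k = (r * s ^- l) * s ^ (j%:Z - i%:Z).
  by rewrite -mulrA !exprnN -expfzDr //; congr (_ * _ ^ _); lia.
have v0 p : 0 <= r * s ^- p by rewrite mulr_ge0 // invr_ge0 exprn_ge0 // ltW.
split.
  apply: (@le_trans _ _ (K1 * (r * s ^- k) ^+ (i + j))); last first.
    by rewrite ler_wpM2r ?exprn_ge0 // lerDl ltW.
  rewrite !shift_weightE vE [(_ * s ^ _) ^+ _]exprMn exprz_expn.
  by rewrite le_eqVlt; apply/orP; left; apply/eqP; rewrite /K1 exprD; ring.
apply: (@le_trans _ _ (K2 * (r * s ^- l) ^+ (i + j))); last first.
  by rewrite ler_wpM2r ?exprn_ge0 // lerDr ltW.
rewrite !shift_weightE vE' [(_ * s ^ _) ^+ _]exprMn exprz_expn.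
by rewrite le_eqVlt; apply/orP; left; apply/eqP; rewrite /K2 exprD; ring.
Qed.

(** The form of h(|T|) at phi, where T acts on e_k with weight r s^-k. *)
Definition wsum (r : R) (n : nat) (phi : nat -> C) (h : R -> R) : C :=
  \sum_(k < n) (h (r * s ^- k))%:C * `|phi k| ^+ 2.

Let v_ge0 r k : 0 <= r -> 0 <= r * s ^- k.
Proof. by move=> r0; rewrite mulr_ge0 // invr_ge0 exprn_ge0 // ltW. Qed.

Lemma ler_wsum r n phi h h' : 0 <= r -> (forall v, 0 <= v -> h v <= h' v) ->
  wsum r n phi h <= wsum r n phi h'.
Proof.
move=> r0 hh; apply: ler_sum => k _; rewrite ler_wpM2r ?exprn_ge0 //.
by rewrite lecR hh // v_ge0.
Qed.

Lemma wsumZ r n phi a h : wsum r n phi (fun v => a * h v) = a%:C * wsum r n phi h.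
Proof. by rewrite /wsum mulr_sumr; apply: eq_bigr => k _; rewrite rmorphM mulrA. Qed.

Lemma wsumD r n phi h h' :
  wsum r n phi (fun v => h v + h' v) = wsum r n phi h + wsum r n phi h'.
Proof. by rewrite -big_split /=; apply: eq_bigr => k _; rewrite rmorphD mulrDl. Qed.

Lemma wsum_ge0 r n phi h : 0 <= r -> (forall v, 0 <= v -> 0 <= h v) ->
  0 <= wsum r n phi h.
Proof.
move=> r0 h0; apply: sumr_ge0 => k _; rewrite mulr_ge0 ?exprn_ge0 //.
by rewrite ler0c h0 // v_ge0.
Qed.

Lemma wsum1 r n phi : wsum r n phi (fun=> 1) = \sum_(k < n) `|phi k| ^+ 2.
Proof. by apply: eq_bigr => k _; rewrite mul1r. Qed.

Lemma sum_indicator (n c : nat) (p : 'I_n -> nat) (F : C) : injective p -> 0 <= F ->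
  \sum_(l < n) (c == p l)%:R * F <= F.
Proof.
move=> pI F0; have [[l cl]|nl] := pselect (exists l, c = p l).
  rewrite (bigD1 l) //= cl eqxx mul1r big1 ?addr0 // => k kl.
  by rewrite (inj_eq pI) eq_sym (negPf kl) mul0r.
rewrite big1 // => l _; case: eqP => [cl|_]; last by rewrite mul0r.
by case: nl; exists l.
Qed.

Lemma shift_weight_ge0 r k j : 0 <= r -> 0 <= shift_weight q r k j.
Proof. by move=> r0; apply: prodr_ge0 => a _; apply: v_ge0. Qed.

Lemma normM_le (a b : C) : `|a * b| <= `|a| ^+ 2 + `|b| ^+ 2.
Proof.
rewrite normrM -subr_ge0.
have -> : `|a| ^+ 2 + `|b| ^+ 2 - `|a| * `|b| = (`|a| - `|b|) ^+ 2 + `|a| * `|b| by ring.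
apply: addr_ge0; last by rewrite mulr_ge0.
by rewrite real_exprn_even_ge0 // rpredB // normr_real.
Qed.

Lemma fiber_mon_bound (i j : nat) : exists2 K : R, 0 <= K & forall r n phi, 0 <= r ->
  `|fiber_mon q r n phi i j| <= K%:C * wsum r n phi (fun v => v ^+ (i + j)).
Proof.
have [K K0 KP] := shift_weight_bound i j.
exists (K * 2) => [|r n phi r0]; first by rewrite mulr_ge0.
pose G k : C := (K * (r * s ^- k) ^+ (i + j))%:C * `|phi k| ^+ 2.
have G0 k : 0 <= G k by rewrite mulr_ge0 ?exprn_ge0 // ler0c mulr_ge0 ?exprn_ge0 ?v_ge0.
have GE : K%:C * wsum r n phi (fun v => v ^+ (i + j)) = \sum_(k < n) G k.
  by rewrite /wsum mulr_sumr; apply: eq_bigr => k _; rewrite /G rmorphM -mulrA.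
rewrite [K * 2]mulr_natr mulr2n rmorphD mulrDl GE.
apply: le_trans (ler_norm_sum _ _ _) _.
apply: (@le_trans _ _ (\sum_(k < n) \sum_(l < n)
    ((k + j)%N == (l + i)%N)%:R * (G k + G l))).
  apply: ler_sum => k _; apply: le_trans (ler_norm_sum _ _ _) _.
  apply: ler_sum => l _; have [kl|_] := eqVneq (k + j)%N (l + i)%N; last first.
    by rewrite !mul0r normr0.
  have [b1 b2] := KP r k l r0 kl.
  rewrite !mul1r normrM ger0_norm ?ler0c ?mulr_ge0 ?shift_weight_ge0 //.
  apply: le_trans (ler_wpM2l _ (normM_le _ _)) _.
    by rewrite ler0c mulr_ge0 ?shift_weight_ge0.
  rewrite norm_conjC mulrDr; apply: lerD; rewrite ler_wpM2r ?exprn_ge0 // lecR //.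
under eq_bigr do under eq_bigr do rewrite mulrDr.
under eq_bigr do rewrite big_split /=.
rewrite big_split /=; apply: lerD.
  apply: ler_sum => k _; apply: sum_indicator => // a b /eqP.
  by rewrite eqn_add2r => /eqP/val_inj.
rewrite exchange_big /=; apply: ler_sum => l _.
under eq_bigr do rewrite eq_sym.
apply: sum_indicator => // a b /eqP.
by rewrite eqn_add2r => /eqP/val_inj.
Qed.

Lemma qlam_fiber_bound (g : qplane q) (h : R -> R) :
  (forall i j, qcoef g i j != 0 -> forall v, 0 <= v -> v ^+ (i + j) <= h v) ->
  exists2 K : R, 0 <= K & forall r n phi, 0 <= r ->
    `|qlam (fiber_mon q r n phi) g| <= K%:C * wsum r n phi h.
Proof.
move=> gh; pose N := (qdeg g).+1.
have /choice[K KP] (p : nat * nat) : exists K : R, 0 <= K /\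
    forall r n phi, 0 <= r ->
      `|qcoef g p.1 p.2 * fiber_mon q r n phi p.1 p.2| <= K%:C * wsum r n phi h.
  case: p => i j /=; have [->|gij] := eqVneq (qcoef g i j) 0.
    by exists 0; split=> // r n phi r0; rewrite !mul0r normr0.
  have [K K0 KP] := fiber_mon_bound i j.
  exists (complex.Re `|qcoef g i j| * K); split=> [|r n phi r0].
    by rewrite mulr_ge0 // -ler0c -normCR.
  rewrite normrM rmorphM /= -normCR -mulrA ler_wpM2l //.
  apply: le_trans (KP r n phi r0) _; rewrite ler_wpM2l ?ler0c //.
  by apply: ler_wsum => //; apply: gh.
exists (\sum_(j < N) \sum_(i < N) K (val i, val j)).
  by apply: sumr_ge0 => j _; apply: sumr_ge0 => i _; have [] := KP (val i, val j).
move=> r n phi r0; rewrite (@qlam_wid _ _ _ _ N) //.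
apply: le_trans (ler_norm_sum _ _ _) _; rewrite rmorph_sum mulr_suml.
apply: ler_sum => j _; apply: le_trans (ler_norm_sum _ _ _) _.
rewrite rmorph_sum mulr_suml; apply: ler_sum => i _.
by have [_] := KP (val i, val j); apply.
Qed.

Section Main.
Variables (f : qplane q) (m : nat).
Hypotheses (hm : (0 < m)%N) (hdeg : qdeg f = (4 * m)%N).
Hypothesis hsymb : forall w : C, `|w| = s%:C -> 0 < qsymbol f w.

(** After the rescaling of [shift_weight_lead] the form of the top degree part is the
    Toeplitz form of the symbol. *)
Lemma fiber_top_lower : exists2 c : R, 0 < c & forall r n phi, 0 <= r ->
  c%:C * wsum r n phi (fun v => v ^+ (4 * m)) <= qlam (fiber_mon q r n phi) (qtop f).
Proof.
have [t|c c0 cP] := @trig_poly_min R (qdeg f) (symbol_coef f).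
  rewrite -symbol_trig ?hdeg ?oddM //; apply: hsymb.
  by rewrite normrM normrX cis_norm expr1n mulr1 ger0_norm // ler0c ltW.
exists c => // r n phi r0.
pose y k := ((r * s ^- k) ^+ (2 * m))%:C * phi k.
have := @toeplitz_lower R (qdeg f) n (symbol_coef f) c%:C y cP.
have -> : \sum_(k < n) `|y k| ^+ 2 = wsum r n phi (fun v => v ^+ (4 * m)).
  apply: eq_bigr => k _; rewrite normrM exprMn ger0_norm ?ler0c ?exprn_ge0 ?v_ge0 //.
  rewrite -rmorphXn -exprM; congr ((_ ^+ _)%:C * _); lia.
move/le_trans; apply; rewrite /qtop raddf_sum /= le_eqVlt; apply/orP; left; apply/eqP.
apply: eq_bigr => i _; rewrite linearZ /= qlam_mon /symbol_coef -mulrA; congr (_ * _).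
rewrite mulr_sumr; apply: eq_bigr => k _; rewrite mulr_sumr; apply: eq_bigr => l _.
have [kl|_] := eqVneq (k + (qdeg f - i))%N (l + i)%N; last by rewrite !mul0r mulr0.
have iM : (i <= 4 * m)%N by rewrite -hdeg -ltnS.
have iM' : (i + (qdeg f - i) = 4 * m)%N by lia.
rewrite !mul1r (@shift_weight_lead r m) //.
have -> : (qdeg f)./2 = (2 * m)%N by lia.
rewrite /y [(_ * phi l)^*]rmorphM /= conj_real [X in _ = X * _]rmorphM [X in _ = _ * X * _]rmorphM -!mulrA.
by congr (_ * (_ * _)); rewrite mulrCA.
Qed.

(** The part of lower degree is at most half of the leading term plus a multiple D
    of the norm squared, and eps times the norm squared is available: a large enough
    multiple of the uniform bound absorbs D. *)
Lemma fiber_lower (eps : R) : 0 < eps ->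
  (forall r n (phi : nat -> C),
    eps%:C * \sum_(k < n) `|phi k| ^+ 2 <= qlam (fiber_mon q r n phi) f) ->
  exists2 d : R, 0 < d & forall r n phi, 0 <= r ->
    d%:C * wsum r n phi (fun v => (1 + v ^+ 2) ^+ (2 * m)) <= qlam (fiber_mon q r n phi) f.
Proof.
move=> eps0 epsP; have [c c0 cP] := fiber_top_lower.
pose M := (4 * m)%N; pose M1 := M.-1.
have MM1 : M = M1.+1 by rewrite /M1 /M; lia.
have M2 : M = (2 * (2 * m))%N by rewrite /M mulnA.
have [|K K0 KP] := @qlam_fiber_bound (f - qtop f) (fun v => 1 + v ^+ M1).
  move=> i j; rewrite qcoefD -scaleN1r qcoefZ qcoef_top.
  have [_|ne] := eqVneq (i + j)%N (qdeg f); first by rewrite mulN1r subrr eqxx.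
  rewrite mulr0 addr0 => fij v v0.
  have ij : (i + j <= M1)%N.
    have /qdegP/(_ i j fij) := leqnn (qdeg f).
    by move: ne; rewrite hdeg -/M MM1; lia.
  have [v1|v1] := leP v 1.
    by apply: (@le_trans _ _ 1); [exact: exprn_ile1 | rewrite lerDl exprn_ge0].
  apply: (@le_trans _ _ (v ^+ M1)); first by rewrite ler_weXn2l // ltW.
  by rewrite lerDr.
(* K v^M1 is at most (c / 2) v^M for v >= 2 K / c and at most
   K (2 K / c)^M1 for smaller v. *)
pose D := K * (2 * K / c) ^+ M1 + K.
have KD v : 0 <= v -> K * (1 + v ^+ M1) <= (c / 2) * v ^+ M + D.
  move=> v0; rewrite mulrDr mulr1 /D addrA [leRHS]addrC lerD2l.
  have [vK|vK] := leP (2 * K / c) v.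
    apply: (@le_trans _ _ (c / 2 * v ^+ M)); last first.
      by rewrite lerDl mulr_ge0 ?exprn_ge0 // divr_ge0 ?mulr_ge0 // ltW.
    rewrite MM1 exprS mulrA ler_wpM2r ?exprn_ge0 //.
    by move: vK; rewrite ler_pdivrMr //; lra.
  apply: (@le_trans _ _ (K * (2 * K / c) ^+ M1)); last first.
    by rewrite lerDr mulr_ge0 ?exprn_ge0 // divr_ge0 // ltW.
  by rewrite ler_wpM2l // lerXn2r ?nnegrE ?(ltW vK) // (le_trans v0 (ltW vK)).
have D0 : 0 <= D.
  by rewrite addr_ge0 // mulr_ge0 ?exprn_ge0 // divr_ge0 ?mulr_ge0 // ltW.
have c20 : 0 < c / 2 by rewrite divr_gt0.
(* Q >= (c / 2) SM - D S0 and Q >= eps S0 together give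
   B Q >= (c / 2) (SM + S0). *)
pose B := 1 + (D + c / 2) / eps.
have B0 : 0 < B by rewrite addr_gt0 // divr_gt0 // ltr_wpDl.
pose d := (c / 2) / (2 ^+ (2 * m) * B).
exists d => [|r n phi r0]; first by rewrite divr_gt0 // mulr_gt0 // exprn_gt0.
set Q := qlam _ f; pose S0 := wsum r n phi (fun=> 1).
pose SM := wsum r n phi (fun v => v ^+ M).
pose W := wsum r n phi (fun v => (1 + v ^+ 2) ^+ (2 * m)).
have S0_ge0 : 0 <= S0 by apply: wsum_ge0.
have SM_ge0 : 0 <= SM by apply: wsum_ge0 => // v v0; rewrite exprn_ge0.
have W_ge0 : 0 <= W by apply: wsum_ge0 => // v v0; rewrite exprn_ge0 // addr_ge0 // exprn_ge0.
have h1 : eps%:C * S0 <= Q by rewrite /S0 wsum1; apply: epsP.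
have Qr : Q \is Num.real.
  by rewrite (ger_real h1) ger0_real // mulr_ge0 // ler0c ltW.
have h2 : c%:C * SM - ((c / 2)%:C * SM + D%:C * S0) <= Q.
  have lead := cP r n phi r0; have low := KP r n phi r0.
  have QE : Q = qlam (fiber_mon q r n phi) (qtop f) + qlam (fiber_mon q r n phi) (f - qtop f).
    by rewrite -raddfD /= addrC subrK.
  have Lr : qlam (fiber_mon q r n phi) (qtop f) \is Num.real.
    by rewrite (ger_real lead) ger0_real // mulr_ge0 // ler0c ltW.
  have lowr : qlam (fiber_mon q r n phi) (f - qtop f) \is Num.real.
    by rewrite raddfB /= rpredB.
  move: low; rewrite real_ler_norml // => /andP[low _].
  rewrite QE; apply: lerD lead _; apply: le_trans low; rewrite lerN2 -!wsumZ -wsumD.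
  by apply: ler_wsum => // v v0; rewrite mulr1; apply: KD.
have h3 : W <= (2 ^+ (2 * m))%:C * (S0 + SM).
  rewrite -wsumD -wsumZ; apply: ler_wsum => // v v0.
  have [v1|v1] := leP v 1.
    apply: (@le_trans _ _ (2 ^+ (2 * m))); last first.
      by rewrite ler_peMr ?exprn_ge0 // lerDl exprn_ge0.
    rewrite lerXn2r ?nnegrE ?addr_ge0 ?exprn_ge0 //.
    by rewrite [2]mulr2n lerD2l exprn_ile1.
  apply: (@le_trans _ _ ((2 * v ^+ 2) ^+ (2 * m))).
    rewrite lerXn2r ?nnegrE ?addr_ge0 ?mulr_ge0 ?exprn_ge0 //.
    by rewrite mulr_natl mulr2n lerD2r exprn_ege1 // ltW.
  by rewrite exprMn -exprM -M2 ler_wpM2l ?exprn_ge0 // lerDr.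
rewrite -/W.
have [a aE] := complex_realP _ (ger0_real S0_ge0).
have [b bE] := complex_realP _ (ger0_real SM_ge0).
have [w wE] := complex_realP _ (ger0_real W_ge0).
have [u uE] := complex_realP _ Qr.
move: h1 h2 h3; rewrite aE bE wE uE -!rmorphM -!rmorphD -rmorphB -!rmorphM !lecR.
move=> h1 h2 h3; rewrite /d.
have P0 : 0 < 2 ^+ (2 * m) :> R by rewrite exprn_gt0.
apply: (@le_trans _ _ ((c / 2) * (a + b) / B)).
  have wP : w / 2 ^+ (2 * m) <= a + b by rewrite ler_pdivrMr // mulrC.
  have -> : c / 2 / (2 ^+ (2 * m) * B) * w = c / 2 / B * (w / 2 ^+ (2 * m)).
    by rewrite invfM !mulrA; ring.
  rewrite [leRHS]mulrAC; apply: ler_wpM2l => //.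
  by rewrite divr_ge0 // ltW.
rewrite ler_pdivrMr // (_ : u * B = u + u * ((D + c / 2) / eps)); last first.
  by rewrite /B mulrDr mulr1.
have e2 : (D + c / 2) * a <= u * ((D + c / 2) / eps).
  have Dc : 0 <= D + c / 2 := addr_ge0 D0 (ltW c20).
  rewrite mulrA ler_pdivlMr // -mulrA [leRHS]mulrC.
  by apply: ler_wpM2l => //; rewrite mulrC.
lra.
Qed.

(** Every monomial of degree at most 4 m is dominated by the weight. *)
Lemma fiber_upper : exists2 K : R, 0 <= K & forall r n phi, 0 <= r ->
  `|qlam (fiber_mon q r n phi) f| <=
    K%:C * wsum r n phi (fun v => (1 + v ^+ 2) ^+ (2 * m)).
Proof.
apply: qlam_fiber_bound => i j fij v v0.
have ij : (i + j <= 4 * m)%N by rewrite -hdeg; apply/qdegP: fij.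
have [v1|v1] := leP v 1.
  by apply: (@le_trans _ _ 1); [exact: exprn_ile1 | rewrite exprn_ege1 // lerDl exprn_ge0].
apply: (@le_trans _ _ (v ^+ (4 * m))); first by rewrite ler_weXn2l // ltW.
have -> : (4 * m = 2 * (2 * m))%N by lia.
rewrite exprM lerXn2r ?nnegrE ?addr_ge0 ?exprn_ge0 // lerDr //.
Qed.

End Main.
End FiberBounds.

(** * The grading and its degree-zero projection *)

Section Grading.
Variables (R : rcfType) (q : R).
Local Notation C := R[i].
Local Notation A := (qplane q).
Local Notation x := (qx q).
Local Notation xs := (qxs q).
Implicit Types a b : A.
Implicit Types P Q : {poly C}.

Lemma qcoef0 i j : qcoef (0 : A) i j = 0.
Proof. by rewrite /qcoef !coef0. Qed.

Lemma qcoef_sum (I : Type) (r : seq I) (D : pred I) (F : I -> A) i j :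
  qcoef (\sum_(k <- r | D k) F k) i j = \sum_(k <- r | D k) qcoef (F k) i j.
Proof.
by elim/big_rec2: _ => [|k y1 y2 _ <-]; rewrite ?qcoef0 ?qcoefD.
Qed.

Lemma qcoefN a i j : qcoef (- a) i j = - qcoef a i j.
Proof. by rewrite -scaleN1r qcoefZ mulN1r. Qed.

Definition qmon (i j : nat) : A := xs ^+ i * x ^+ j.

Lemma qexpand a n : (qdeg a < n)%N ->
  a = \sum_(j < n) \sum_(i < n) qcoef a i j *: qmon i j.
Proof.
move=> an; apply: qcoefP => i j; rewrite qcoef_sum.
have [ij|ij] := ltnP (i + j) n; last first.
  rewrite (@qcoef_gt _ _ a (qdeg a)) ?(leq_trans an) // big1 // => k _.
  rewrite qcoef_sum big1 // => l _; rewrite qcoefZ qcoef_mon.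
  case: eqP => [il|]; last by rewrite mulr0.
  case: eqP => [jk|]; last by rewrite mulr0.
  by rewrite -il -jk (@qcoef_gt _ _ a (qdeg a)) ?mul0r ?(leq_trans an).
have jn : (j < n)%N by lia.
have i_n : (i < n)%N by lia.
rewrite (bigD1 (Ordinal jn)) //= qcoef_sum (bigD1 (Ordinal i_n)) //=.
rewrite qcoefZ qcoef_mon !eqxx mulr1 big1 => [|k ki]; last first.
  rewrite qcoefZ qcoef_mon; case: eqP => [ik|]; last by rewrite mulr0.
  by case/eqP: ki; apply: val_inj.
rewrite addr0 big1 ?addr0 // => k kj; rewrite qcoef_sum big1 // => l _.
rewrite qcoefZ qcoef_mon; case: (j =P k) => [jk|]; last by rewrite andbF mulr0.
by case/eqP: kj; apply: val_inj.
Qed.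

(** The degree j - i of xs^i x^j is the distance by which it moves the basis vectors of
    a bilateral shift. *)
Definition qsupp (S : int -> bool) a := forall i j, qcoef a i j != 0 -> S (j%:Z - i%:Z).

Lemma qsupp_sub (S T : int -> bool) a : (forall d, S d -> T d) -> qsupp S a -> qsupp T a.
Proof. by move=> ST aS i j /aS/ST. Qed.

Lemma qsupp0 S : qsupp S 0.
Proof. by move=> i j; rewrite qcoef0 eqxx. Qed.

Lemma qsuppD S a b : qsupp S a -> qsupp S b -> qsupp S (a + b).
Proof.
move=> aS bS i j; rewrite qcoefD.
have [a0|/aS //] := eqVneq (qcoef a i j) 0.
by have [b0|/bS //] := eqVneq (qcoef b i j) 0; rewrite a0 b0 addr0 eqxx.
Qed.

Lemma qsuppZ S c a : qsupp S a -> qsupp S (c *: a).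
Proof. by move=> aS i j; rewrite qcoefZ mulf_eq0 negb_or => /andP[_ /aS]. Qed.

Lemma qsupp_sum (I : Type) (r : seq I) (D : pred I) (F : I -> A) S :
  (forall k, qsupp S (F k)) -> qsupp S (\sum_(k <- r | D k) F k).
Proof.
move=> FS; elim/big_rec: _ => [|k y _ yS]; [exact: qsupp0|exact: qsuppD].
Qed.

Lemma qsupp_mon (S : int -> bool) i j : S (j%:Z - i%:Z) -> qsupp S (qmon i j).
Proof.
move=> Sij k l; rewrite qcoef_mon; case: (k =P i) => [->|]; last by rewrite eqxx.
by case: (l =P j) => [-> //|]; rewrite eqxx.
Qed.

Lemma qmonM' i j k l : qmon i j * qmon k l = (q ^+ (j * k))%:C *: qmon (i + k) (j + l).
Proof. exact: qmonM. Qed.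

Lemma qsuppM (S T U : int -> bool) a b : (forall d e, S d -> T e -> U (d + e)) ->
  qsupp S a -> qsupp T b -> qsupp U (a * b).
Proof.
move=> STU aS bT; rewrite (qexpand (ltnSn (qdeg a))) (qexpand (ltnSn (qdeg b))).
rewrite mulr_suml; apply: qsupp_sum => j; rewrite mulr_suml; apply: qsupp_sum => i.
rewrite mulr_sumr; apply: qsupp_sum => l; rewrite mulr_sumr; apply: qsupp_sum => k.
have [->|aij] := eqVneq (qcoef a i j) 0; first by rewrite scale0r mul0r; apply: qsupp0.
have [->|bkl] := eqVneq (qcoef b k l) 0; first by rewrite scale0r mulr0; apply: qsupp0.
rewrite -scalerAl -scalerAr qmonM'; do 3!apply: qsuppZ; apply: qsupp_mon.
have := STU _ _ (aS _ _ aij) (bT _ _ bkl); congr U; lia.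
Qed.

Lemma qsupp_star (S T : int -> bool) a : (forall d, S d -> T (- d)) ->
  qsupp S a -> qsupp T (qstar a).
Proof.
move=> ST aS i j; rewrite qcoef_star conjC_eq0 => /aS/ST; congr T; lia.
Qed.

Definition qcomp (d : int) a : A := \sum_(j < (qdeg a).+1) \sum_(i < (qdeg a).+1)
  (if j%:Z - i%:Z == d then qcoef a i j else 0) *: qmon i j.

Lemma qcoef_comp d a i j :
  qcoef (qcomp d a) i j = if j%:Z - i%:Z == d then qcoef a i j else 0.
Proof.
rewrite [in RHS](qexpand (ltnSn (qdeg a))) !qcoef_sum.
case: eqP => ij; [|rewrite big1 // => l _]; last first.
  rewrite qcoef_sum big1 // => k _; rewrite qcoefZ qcoef_mon.
  case: (i =P k) => [ik|]; last by rewrite mulr0.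
  case: (j =P l) => [jl|]; last by rewrite mulr0.
  by rewrite -ik -jl; case: eqP => // _; rewrite mul0r.
apply: eq_bigr => l _; rewrite !qcoef_sum; apply: eq_bigr => k _.
rewrite !qcoefZ qcoef_mon; case: (i =P k) => [<-|]; last by rewrite !mulr0.
by case: (j =P l) => [<-|]; rewrite ?mulr0 // ij eqxx.
Qed.

Lemma qsupp_comp d a : qsupp (pred1 d) (qcomp d a).
Proof. by move=> i j; rewrite qcoef_comp /=; case: ifP => // _; rewrite eqxx. Qed.

Lemma qcomp_star d a : qstar (qcomp d a) = qcomp (- d) (qstar a).
Proof.
apply: qcoefP => i j; rewrite qcoef_star !qcoef_comp qcoef_star.
by rewrite -[_ - _ in RHS]opprB eqr_opp; case: ifP => // _; rewrite conjC0.
Qed.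

Definition qband (L : nat) : int -> bool := fun d => (`|d| <= L)%N.

Lemma qcomp_sum L a : qsupp (qband L) a ->
  a = qcomp 0 a + \sum_(n < L) (qcomp n.+1%:Z a + qcomp (- n.+1%:Z) a).
Proof.
move=> aL; apply: qcoefP => i j; rewrite qcoefD qcoef_comp qcoef_sum.
under eq_bigr do rewrite qcoefD !qcoef_comp.
have [a0|/aL] := eqVneq (qcoef a i j) 0.
  by rewrite a0 !if_same add0r big1 // => n _; rewrite !if_same addr0.
rewrite /qband; set d := j%:Z - i%:Z => dL.
have [->|d0] := eqVneq d 0.
  rewrite big1 => [|n _]; first by rewrite addr0.
  by rewrite /= addr0.
have dn : (`|d|.-1 < L)%N by lia.
rewrite add0r (bigD1 (Ordinal dn)) //= big1 => [|n nd].
  have dE : `|d|.-1.+1 = `|d|%N by lia.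
  rewrite dE addr0; case: (ltrgt0P d) => dd; last by rewrite dd eqxx in d0.
    have -> : `|d|%N%:Z = d by lia.
    by rewrite eqxx ifF ?addr0 //; lia.
  have -> : `|d|%N%:Z = - d by lia.
  by rewrite opprK eqxx ifF ?add0r //; lia.
have nd' : n.+1 != `|d|%N.
  apply: contraNneq nd => e; apply/eqP/val_inj => /=; lia.
by rewrite !ifF ?addr0 //; lia.
Qed.

(** The polynomials in xs * x form the component of degree 0. *)
Definition qpol : {poly C} -> A := horner_alg (xs * x).

HB.instance Definition _ := GRing.LRMorphism.on qpol.

Lemma qpolZ c P : qpol (c *: P) = c *: qpol P.
Proof. by rewrite /qpol linearZ /= mulr_algl. Qed.

Lemma qpolM P Q : qpol (P * Q) = qpol P * qpol Q.
Proof. exact: rmorphM. Qed.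

Lemma qpolB P Q : qpol (P - Q) = qpol P - qpol Q.
Proof. exact: rmorphB. Qed.

Lemma qpolX : qpol 'X = xs * x. Proof. exact: horner_algX. Qed.

Lemma qtX i : (xs * x) ^+ i = (q ^+ 'C(i, 2))%:C *: qmon i i.
Proof.
rewrite /qmon; elim: i => [|i IHi]; first by rewrite !expr0 mulr1 scale1r.
rewrite exprS IHi -scalerAr; have := qmonM q 1 1 i i; rewrite !expr1 => ->.
by rewrite scalerA -rmorphM -exprD !add1n mul1n binS bin1.
Qed.

Lemma qpolE P : qpol P = \sum_(i < size P) (P`_i * (q ^+ 'C(i, 2))%:C) *: qmon i i.
Proof.
rewrite -[in LHS](coefK P) poly_def raddf_sum /=; apply: eq_bigr => i _.
by rewrite qpolZ rmorphXn /= qpolX qtX scalerA.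
Qed.

Lemma qsupp_pol P : qsupp (pred1 0) (qpol P).
Proof.
rewrite qpolE; apply: qsupp_sum => i; apply: qsuppZ; apply: qsupp_mon.
by rewrite /= subrr.
Qed.

Lemma qcoef_pol P i : qcoef (qpol P) i i = P`_i * (q ^+ 'C(i, 2))%:C.
Proof.
rewrite qpolE qcoef_sum; have [iP|Pi] := ltnP i (size P).
  rewrite (bigD1 (Ordinal iP)) //= qcoefZ qcoef_mon !eqxx mulr1 big1 ?addr0 // => k ki.
  rewrite qcoefZ qcoef_mon; case: eqP => [ik|]; last by rewrite mulr0.
  by case/eqP: ki; apply: val_inj.
rewrite nth_default // mul0r big1 // => k _; rewrite qcoefZ qcoef_mon.
case: eqP => [ik|]; last by rewrite mulr0.
by have := ltn_ord k; rewrite -ik ltnNge Pi.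
Qed.

(** The projection to degree 0, read as a polynomial in xs * x. The power of q
    compares the monomial xs^i x^i with the i-th power of xs * x. *)
Definition qexp (a : A) : {poly C} :=
  \poly_(i < (qdeg a).+1) (qcoef a i i * (q ^- 'C(i, 2))%:C).

Lemma coef_qexp a i : (qexp a)`_i = qcoef a i i * (q ^- 'C(i, 2))%:C.
Proof.
rewrite coef_poly ltnS; case: leqP => // ai.
by rewrite (@qcoef_gt _ _ a (qdeg a)) ?mul0r //; lia.
Qed.

Hypothesis hq : 0 < q.
Let q_neq0 : q != 0. Proof. by rewrite gt_eqF. Qed.

Lemma qexp_supp0 a : qsupp (pred1 0) a -> a = qpol (qexp a).
Proof.
move=> a0; apply: qcoefP => i j; have [<-|ij] := eqVneq i j.
  rewrite qcoef_pol coef_qexp -mulrA -rmorphM mulVf ?expf_neq0 //.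
  by rewrite mulr1.
have nz b : qsupp (pred1 0) b -> qcoef b i j = 0.
  move=> b0; apply/eqP; apply: contraNT ij => /b0 /=; rewrite subr_eq0.
  by rewrite eq_sym => /eqP[->].
by rewrite !nz //; apply: qsupp_pol.
Qed.

Lemma qexp_pol P : qexp (qpol P) = P.
Proof.
apply/polyP => i; rewrite coef_qexp qcoef_pol -mulrA -rmorphM mulfV ?expf_neq0 //.
by rewrite mulr1.
Qed.

Lemma qexp_linear : linear qexp.
Proof.
move=> c a b; apply/polyP => i; rewrite coefD coefZ !coef_qexp qcoefD qcoefZ.
by rewrite mulrDl mulrA.
Qed.

HB.instance Definition _ := GRing.isLinear.Build C A {poly C} *:%R qexp qexp_linear.

Lemma qexpD a b : qexp (a + b) = qexp a + qexp b.
Proof. exact: raddfD. Qed.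

Lemma qexpB a b : qexp (a - b) = qexp a - qexp b.
Proof. exact: raddfB. Qed.

Lemma qexpZ (c : C) a : qexp (c *: a) = c *: qexp a.
Proof. exact: linearZ. Qed.

Definition pscale (z : R) P : {poly C} := P \Po (z%:C *: 'X).

Lemma pscaleM z P Q : pscale z (P * Q) = pscale z P * pscale z Q.
Proof. by rewrite /pscale rmorphM. Qed.

Lemma pscale_comp z w P : pscale z (pscale w P) = pscale (z * w) P.
Proof. by rewrite /pscale -comp_polyA comp_polyZ comp_polyX scalerA -rmorphM mulrC. Qed.

Lemma pscale1 P : pscale 1 P = P.
Proof. by rewrite /pscale scale1r comp_polyXr. Qed.

(** Because x (xs x) = q (xs x) x. *)
Lemma qpol_comm d a P : qsupp (pred1 d) a -> a * qpol P = qpol (pscale (q ^ d) P) * a.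
Proof.
move=> ad; rewrite (qexpand (ltnSn (qdeg a))) mulr_suml mulr_sumr.
apply: eq_bigr => j _; rewrite mulr_suml mulr_sumr; apply: eq_bigr => i _.
have [->|/ad /= /eqP dE] := eqVneq (qcoef a i j) 0; first by rewrite !scale0r mul0r mulr0.
rewrite -scalerAl -scalerAr; congr (_ *: _); rewrite -dE {dE}.
have Xcase : qmon i j * (xs * x) = (q ^ (j%:Z - i%:Z))%:C *: ((xs * x) * qmon i j).
  have -> : xs * x = qmon 1 1 by rewrite /qmon !expr1.
  rewrite !qmonM' scalerA -rmorphM addnC [(j + 1)%N]addnC; congr (_%:C *: _).
  rewrite !exprnP -expfzDr //; congr (_ ^ _); lia.
rewrite -[P]coefK poly_def /pscale !raddf_sum mulr_sumr mulr_suml /=.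
apply: eq_bigr => k _; rewrite comp_polyZ !qpolZ -scalerAr -scalerAl; congr (_ *: _).
rewrite rmorphXn /= comp_Xn_poly exprZn qpolZ rmorphXn /= qpolX -scalerAl.
set T := xs * x in Xcase *.
elim: (nat_of_ord k) => [|n IHn]; first by rewrite !expr0 mulr1 mul1r scale1r.
rewrite !exprSr mulrA IHn -scalerAl -(mulrA (T ^+ n)) Xcase -scalerAr scalerA -rmorphXn -rmorphM.
by rewrite -[in RHS](mulrA (T ^+ n)).
Qed.

Lemma qstar_pol P : qstar (qpol P) = qpol (map_poly Num.conj P).
Proof.
apply: qcoefP => i j; have [<-|ij] := eqVneq i j.
  by rewrite qcoef_star !qcoef_pol coef_map rmorphM /= conj_real.
rewrite qcoef_star.
have nz b k l : k != l -> qsupp (pred1 0) b -> qcoef b k l = 0.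
  move=> kl b0; apply/eqP; apply: contraNT kl => /b0 /=; rewrite subr_eq0.
  by rewrite eq_sym => /eqP[->].
rewrite (nz (qpol P) j i); [|by rewrite eq_sym|exact: qsupp_pol].
by rewrite conjC0 nz //; apply: qsupp_pol.
Qed.

Lemma qstar1 : qstar (1 : A) = 1.
Proof. by have := qstar_mon q 0 0; rewrite !expr0 mulr1. Qed.

(** The positivity of a in all representations by shifts, stated inside the algebra:
    the degree-zero projection is a conditional expectation onto functions on the
    half-line of values of xs * x. *)
Definition qpos a := forall b (t : R), 0 <= t -> 0 <= (qexp (qstar b * a * b)).[t%:C].

Lemma qposD a b : qpos a -> qpos b -> qpos (a + b).
Proof.
by move=> a0 b0 c t t0; rewrite mulrDr mulrDl raddfD hornerD addr_ge0 ?a0 ?b0.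
Qed.

Lemma qposZ (c : C) a : 0 <= c -> qpos a -> qpos (c *: a).
Proof.
move=> c0 a0 b t t0; rewrite -scalerAr -scalerAl linearZ hornerZ.
by rewrite mulr_ge0 // a0.
Qed.

Lemma qpos_conj a c : qpos a -> qpos (qstar c * a * c).
Proof.
by move=> a0 b t t0; have := a0 (c * b) t t0; rewrite qstarM !mulrA.
Qed.

End Grading.

(** * Positivity of the degree-zero projection *)

Section FiberVector.
Variables (R : realType) (q : R) (hq : 0 < q).
Local Notation C := R[i].
Local Notation A := (qplane q).
Local Notation s := (Num.sqrt q).
Local Notation W := (shift_weight q).
Implicit Types a g : A.

Let s_gt0 : 0 < s. Proof. by rewrite sqrtr_gt0. Qed.
Let s_neq0 : s != 0. Proof. by rewrite gt_eqF. Qed.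

Lemma scalar_eq (F G : A -> C) (D : nat) : scalar F -> scalar G ->
  (forall i j, (i + j <= D)%N -> F (qmon q i j) = G (qmon q i j)) ->
  forall a, (qdeg a <= D)%N -> F a = G a.
Proof.
have zero (K : A -> C) : scalar K -> K 0 = 0.
  by move=> Ks; have := Ks (- 1) 0 0; rewrite scaler0 addr0 mulN1r addNr.
have sum (K : A -> C) : scalar K -> forall n (e : nat -> C) (u : nat -> A),
    K (\sum_(i < n) e i *: u i) = \sum_(i < n) e i * K (u i).
  move=> Ks n e u; elim: n => [|n IHn]; first by rewrite !big_ord0 zero.
  by rewrite !big_ord_recr /= addrC Ks IHn addrC.
have sum1 (K : A -> C) : scalar K -> forall n (u : nat -> A),
    K (\sum_(i < n) u i) = \sum_(i < n) K (u i).
  move=> Ks n u; have := sum K Ks n (fun=> 1) u.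
  under eq_bigr do rewrite scale1r; move=> ->.
  by apply: eq_bigr => i _; rewrite mul1r.
move=> Fs Gs FG a aD; rewrite (qexpand (ltnSn (qdeg a))).
rewrite (sum1 F Fs _ (fun j => \sum_(i < (qdeg a).+1) qcoef a i j *: qmon q i j)).
rewrite (sum1 G Gs _ (fun j => \sum_(i < (qdeg a).+1) qcoef a i j *: qmon q i j)).
apply: eq_bigr => j _.
rewrite (sum F Fs _ (fun i => qcoef a i j) (fun i => qmon q i j)).
rewrite (sum G Gs _ (fun i => qcoef a i j) (fun i => qmon q i j)).
apply: eq_bigr => i _; have [->|aij] := eqVneq (qcoef a i j) 0; first by rewrite !mul0r.
by congr (_ * _); apply: FG; apply: leq_trans aD; have /qdegP := leqnn (qdeg a); apply.
Qed.

Definition fiber_form (r : R) (n : nat) (phi psi : nat -> C) (i j : nat) : C :=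
  \sum_(k < n) \sum_(l < n) ((k + j)%N == (l + i)%N)%:R *
    (W r k j * W r l i)%:C * (phi k * (psi l)^* ).

(** The coordinates of g(T) e_D. An element g of degree at most D moves e_D to
    positions between 0 and 2 D, so negative indices do not occur. *)
Definition fiber_vec (r : R) (D : nat) g (p : nat) : C :=
  qlam (fun i j => ((D + j)%N == (p + i)%N)%:R * (W r D j * W r p i)%:C) g.

Lemma sum_only n (k0 : nat) (F : nat -> C) : (k0 < n)%N ->
  (forall k, k != k0 -> F k = 0) -> \sum_(k < n) F k = F k0.
Proof.
move=> kn F0; rewrite (bigD1 (Ordinal kn)) //= big1 ?addr0 // => k kk; apply: F0.
by apply: contraNneq kk => e; apply/eqP/val_inj.
Qed.

Lemma qexp_mon i j : qexp (qmon q i j) = (i == j)%:R *: ((q ^- 'C(i, 2))%:C *: 'X^i).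
Proof.
apply/polyP => k; rewrite coef_qexp /qmon qcoef_mon !coefZ coefXn.
have [->|ki] := eqVneq k i; last by rewrite !mulr0 mul0r.
by rewrite mulr1.
Qed.

(** All factors are powers of the square root of t and of q; the total exponents of q
    agree because D, k and l are tied by the three index relations. *)
Lemma fiber_weight_eq (t : R) (D i j i' j' a b k l e : nat) : 0 <= t ->
  (D + j = k + i)%N -> (D + j' = l + i')%N -> (k + b = l + a)%N -> e = (j' + a + i)%N ->
  let r := Num.sqrt t * s ^+ D in
  W r k b * W r l a * (W r D j * W r k i) * (W r D j' * W r l i') =
  q ^+ (i' * a) * q ^+ ((i' + b) * i) * (t ^+ e * q ^- 'C(e, 2)).
Proof.
move=> t0 hk hl hkl he r; rewrite !shift_weightE //.
have vE p n : (r * s ^- p) ^+ n = Num.sqrt t ^+ n * s ^ ((D%:Z - p%:Z) * n%:Z).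
  have -> : r * s ^- p = Num.sqrt t * s ^ (D%:Z - p%:Z).
    by rewrite /r -mulrA exprnN [s ^+ D]exprnP -expfzDr.
  by rewrite exprMn exprz_expn.
rewrite !vE !(qX_sqrt hq) invr_expz !exprnN.
have tE : t ^+ e = Num.sqrt t ^+ (e * 2) by rewrite mulnC exprM sqr_sqrtr.
have eE : (e * 2 = b + a + j + i + j' + i')%N by lia.
rewrite tE eE !exprD.
set A1 := Num.sqrt t ^+ _; set A2 := Num.sqrt t ^+ _; set A3 := Num.sqrt t ^+ _.
set A4 := Num.sqrt t ^+ _; set A5 := Num.sqrt t ^+ _; set A6 := Num.sqrt t ^+ _.
transitivity (A1 * A2 * A3 * A4 * A5 * A6 *
  s ^ (((D%:Z - k%:Z) * b%:Z - 'C(b, 2)%:Z) + ((D%:Z - l%:Z) * a%:Z - 'C(a, 2)%:Z)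
  + ((D%:Z - D%:Z) * j%:Z - 'C(j, 2)%:Z) + ((D%:Z - k%:Z) * i%:Z - 'C(i, 2)%:Z)
  + ((D%:Z - D%:Z) * j'%:Z - 'C(j', 2)%:Z) + ((D%:Z - l%:Z) * i'%:Z - 'C(i', 2)%:Z))).
  by rewrite !expfzDr //; ring.
transitivity (A1 * A2 * A3 * A4 * A5 * A6 *
  s ^ ((i' * a)%:Z * 2 + ((i' + b) * i)%:Z * 2 - 'C(e, 2)%:Z * 2)); last first.
  by rewrite !expfzDr //; ring.
congr (_ * _ ^ _).
have := bin2_int e; have := bin2_int a; have := bin2_int b; have := bin2_int i.
have := bin2_int j; have := bin2_int i'; have := bin2_int j'.
have kE : k%:Z = D%:Z + j%:Z - i%:Z by lia.
have lE : l%:Z = D%:Z + j'%:Z - i'%:Z by lia.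
have bE : b%:Z = j'%:Z + a%:Z + i%:Z - i'%:Z - j%:Z by lia.
have eZ : e%:Z = j'%:Z + a%:Z + i%:Z by lia.
rewrite !PoszM !PoszD kE lE bE eZ => h1 h2 h3 h4 h5 h6 h7.
apply: (@mulIf _ 2) => //; lia.
Qed.

Lemma fiber_vec_mon (t : R) (D i j i' j' a b : nat) : 0 <= t ->
  (i + j <= D)%N -> (i' + j' <= D)%N ->
  let r := Num.sqrt t * s ^+ D in
  (qexp (qstar (qmon q i' j') * qmon q a b * qmon q i j)).[t%:C] =
  fiber_form r (2 * D).+1 (fiber_vec r D (qmon q i j)) (fiber_vec r D (qmon q i' j')) a b.
Proof.
move=> t0 ijD ijD' r.
have -> : qstar (qmon q i' j') = qmon q j' i' by apply: qstar_mon.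
rewrite qmonM' -scalerAl qmonM' !linearZ /= qexp_mon !hornerZ hornerXn.
rewrite /fiber_form.
have vE (u v p : nat) : fiber_vec r D (qmon q u v) p =
    ((D + v)%N == (p + u)%N)%:R * (W r D v * W r p u)%:C by rewrite /fiber_vec qlam_mon.
have kl : (D + j - i < (2 * D).+1)%N /\ (D + j' - i' < (2 * D).+1)%N by lia.
rewrite (@sum_only _ (D + j - i) (fun k => \sum_(l < (2 * D).+1)
   ((k + b)%N == (l + a)%N)%:R * (W r k b * W r l a)%:C *
     (fiber_vec r D (qmon q i j) k * (fiber_vec r D (qmon q i' j') l)^* ))) ?kl.1 //; last first.
  move=> k kk; rewrite big1 // => l _; rewrite vE.
  have -> : ((D + j)%N == (k + i)%N) = false by lia.
  by rewrite !mul0r !mulr0.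
rewrite (@sum_only _ (D + j' - i') (fun l =>
   ((D + j - i + b)%N == (l + a)%N)%:R * (W r (D + j - i) b * W r l a)%:C *
     (fiber_vec r D (qmon q i j) (D + j - i) * (fiber_vec r D (qmon q i' j') l)^* )))
  ?kl.2 //; last first.
  move=> l ll; rewrite !vE.
  have -> : ((D + j')%N == (l + i')%N) = false by lia.
  by rewrite !mul0r conjC0 !mulr0.
rewrite !vE.
have -> : (D + j)%N == (D + j - i + i)%N by lia.
have -> : (D + j')%N == (D + j' - i' + i')%N by lia.
rewrite !mul1r conj_real.
have -> : (D + j - i + b == D + j' - i' + a)%N = (j' + a + i == i' + b + j)%N by lia.
case: eqP => [e|]; last by rewrite !mul0r !mulr0.
rewrite !mul1r -!rmorphXn -!rmorphM; congr (_%:C).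
have h1 : (D + j = D + j - i + i)%N by lia.
have h2 : (D + j' = D + j' - i' + i')%N by lia.
have h3 : (D + j - i + b = D + j' - i' + a)%N by lia.
have /= h := fiber_weight_eq t0 h1 h2 h3 erefl.
by rewrite [RHS]mulrA /r h; ring.
Qed.

Lemma conj_scalar (F : A -> C) : (forall c g h, F (c *: g + h) = c^* * F g + F h) ->
  scalar (fun g => (F g)^* ).
Proof. by move=> FD c g h; rewrite FD rmorphD rmorphM /= conjCK. Qed.

(** For the shift T with weight sqrt t at e_D, both sides are the form of a at the
    vector g(T) e_D: the components of nonzero degree move e_D to orthogonal basis
    vectors, and xs * x acts on e_D as t. Both sides are sesquilinear in g and linear
    in a, so monomials suffice. *)
Lemma qexp_fiber (t : R) (D : nat) g a : 0 <= t -> (qdeg g <= D)%N ->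
  let r := Num.sqrt t * s ^+ D in
  (qexp (qstar g * a * g)).[t%:C] = qlam (fiber_mon q r (2 * D).+1 (fiber_vec r D g)) a.
Proof.
move=> t0 gD r.
pose N := maxn D (qdeg a).
rewrite -[RHS]/(qlam (fiber_form r (2 * D).+1 (fiber_vec r D g) (fiber_vec r D g)) a).
apply: (@scalar_eq (fun a => (qexp (qstar g * a * g)).[t%:C]) _ (qdeg a)) => //.
- by move=> c u v; rewrite mulrDr mulrDl -scalerAr -scalerAl linearP hornerD hornerZ.
- exact: qlam_linear.
move=> k l _; rewrite qlam_mon.
pose F1 g1 g2 := (qexp (qstar g1 * qmon q k l * g2)).[t%:C].
pose F2 g1 g2 := fiber_form r (2 * D).+1 (fiber_vec r D g2) (fiber_vec r D g1) k l.
rewrite -/(F1 g g) -/(F2 g g).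
have F2l g1 : scalar (F2 g1).
  move=> c u v; rewrite /F2 /fiber_form mulr_sumr -big_split /=; apply: eq_bigr => p _.
  rewrite mulr_sumr -big_split /=; apply: eq_bigr => p' _.
  by rewrite {1}/fiber_vec linearP /= -!/(fiber_vec _ _ _ _); ring.
have F2r g2 c u v : F2 (c *: u + v) g2 = c^* * F2 u g2 + F2 v g2.
  rewrite /F2 /fiber_form mulr_sumr -big_split /=; apply: eq_bigr => p _.
  rewrite mulr_sumr -big_split /=; apply: eq_bigr => p' _.
  rewrite {2}/fiber_vec linearP /= -!/(fiber_vec _ _ _ _) rmorphD rmorphM /=; ring.
apply: (@scalar_eq (F1 g) (F2 g) D) => // [c u v|i j ijD].
  by rewrite /F1 mulrDr -scalerAr linearP hornerD hornerZ.
apply: (can_inj (@conjCK _)).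
apply: (@scalar_eq (fun g1 => (F1 g1 (qmon q i j))^* ) (fun g1 => (F2 g1 (qmon q i j))^* ) D) => //.
- apply: conj_scalar => c u v.
  by rewrite /F1 raddfD /= qstarZ !mulrDl -!scalerAl linearP hornerD hornerZ.
- by apply: conj_scalar => c u v; apply: F2r.
by move=> i' j' ijD'; congr (_^* ); apply: fiber_vec_mon.
Qed.

Lemma qlam_fiber_pol r n (phi : nat -> C) (P : {poly C}) :
  qlam (fiber_mon q r n phi) (qpol q P) =
  \sum_(k < n) P.[((r * s ^- k) ^+ 2)%:C] * `|phi k| ^+ 2.
Proof.
rewrite qpolE raddf_sum /=.
under [RHS]eq_bigr do rewrite horner_coef mulr_suml.
rewrite [RHS]exchange_big /=; apply: eq_bigr => i _.
rewrite linearZ /= qlam_mon -mulrA; under [RHS]eq_bigr do rewrite -mulrA.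
rewrite -mulr_sumr; congr (_ * _).
rewrite mulr_sumr; apply: eq_bigr => k _; rewrite (bigD1 k) //= eqxx mul1r big1.
  have e : q ^+ 'C(i, 2) * (W r k i * W r k i) = ((r * s ^- k) ^+ 2) ^+ i.
    rewrite !shift_weightE //.
    have -> : q ^+ 'C(i, 2) = s ^+ 'C(i, 2) * s ^+ 'C(i, 2).
      by rewrite -exprMn -expr2 sqr_sqrtr // ltW.
    rewrite -exprM mul2n -addnn exprD; field.
    by rewrite !expf_neq0.
  by rewrite addr0 -normCK mulrA -rmorphM e rmorphXn.
by move=> l lk; rewrite eqn_add2r eq_sym val_eqE (negPf lk) !mul0r.
Qed.

Section Main.
Variables (f : A) (m : nat).
Local Notation wt := (qpol q ((1 + 'X) ^+ (2 * m))).

Lemma qlam_fiber_wt r n (phi : nat -> C) :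
  qlam (fiber_mon q r n phi) wt = wsum q r n phi (fun v => (1 + v ^+ 2) ^+ (2 * m)).
Proof.
rewrite qlam_fiber_pol; apply: eq_bigr => k _.
by rewrite horner_exp hornerD hornerX hornerC [X in _ = X * _]rmorphXn
  [X in _ = X ^+ _ * _]rmorphD.
Qed.

Hypotheses (hm : (0 < m)%N) (hdeg : qdeg f = (4 * m)%N).
Hypothesis hsymb : forall w : C, `|w| = s%:C -> 0 < qsymbol f w.
Hypothesis hpos : forall (H : hilbertType R) (X : partial_op H), qnormal q X ->
  exists eps : R, 0 < eps /\ forall phi, smooth_dom X phi ->
    eps%:C * hdot H phi phi <= hdot H (qeval f X phi) phi.

(** The two hypotheses on f enter the algebraic part of the argument only through
    this bound and the next one. *)
Lemma qpos_lower : exists2 d : R, 0 < d & qpos (f - d%:C *: wt).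
Proof.
have [eps eps0 epsP] := fiber_positive hq hpos.
have [d d0 dP] := fiber_lower hq hm hdeg hsymb eps0 epsP.
exists d => // g t t0; have r0 : 0 <= Num.sqrt t * s ^+ (qdeg g).
  by rewrite mulr_ge0 ?sqrtr_ge0 // exprn_ge0 // ltW.
rewrite (qexp_fiber _ t0 (leqnn _)) raddfB /= linearZ /= qlam_fiber_wt subr_ge0.
exact: dP.
Qed.

Lemma qpos_upper : exists2 K : R, 0 < K & qpos (K%:C *: wt - f).
Proof.
have [K K0 KP] := fiber_upper hq hm hdeg.
exists (K + 1) => [|g t t0]; first by rewrite ltr_wpDl.
have r0 : 0 <= Num.sqrt t * s ^+ (qdeg g).
  by rewrite mulr_ge0 ?sqrtr_ge0 // exprn_ge0 // ltW.
rewrite (qexp_fiber _ t0 (leqnn _)) raddfB /= linearZ /= qlam_fiber_wt.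
set phi := fiber_vec _ _ _; set Q := qlam _ f; set w := wsum _ _ _ _ _.
have [eps eps0 epsP] := fiber_positive hq hpos.
have w0 : 0 <= w.
  by apply: wsum_ge0 => // v v0; rewrite exprn_ge0 // addr_ge0 // exprn_ge0.
have Q0 : 0 <= Q.
  apply: le_trans (epsP _ _ _); rewrite mulr_ge0 ?ler0c ?(ltW eps0) // sumr_ge0 // => k _.
  exact: exprn_ge0.
rewrite subr_ge0 -[Q]ger0_norm //; apply: le_trans (KP _ _ _ r0) _.
by rewrite ler_wpM2r // lecR lerDl.
Qed.

End Main.
End FiberVector.

(** * Nonnegative polynomials as sums of squares *)

Section NonnegPoly.
Variable R : rcfType.
Local Notation C := R[i].
Local Notation toC := (map_poly (real_complex R)).
Local Notation conjp := (map_poly (Num.conj : C -> C)).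
Implicit Types p : {poly R}.
Implicit Types F : {poly C}.

Lemma conjp_toC p : conjp (toC p) = toC p.
Proof. by apply/polyP => i; rewrite !coef_map /= conj_real. Qed.

(** Otherwise the product would change sign at a. *)
Lemma nonneg_root_double p (a : R) : (forall y, 0 <= ((('X - a%:P) * p).[y])) -> p.[a] = 0.
Proof.
move=> p0; apply/eqP; apply: contraT => pa.
have [|d d0 dP] := @poly_cont R a p `|p.[a]|; first by rewrite normr_gt0.
have val y : ((('X - a%:P) * p).[y]) = (y - a) * p.[y] by rewrite hornerM hornerXsubC.
have d2 : 0 < d / 2 by rewrite divr_gt0.
have dd : d / 2 < d by rewrite ltr_pdivrMr // mulr_natr mulr2n ltrDl.
move: pa; rewrite neq_lt => /orP[] pa.
  have := dP (a + d / 2); rewrite addrAC subrr add0r gtr0_norm // => /(_ dd).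
  rewrite (ltr0_norm pa) ltr_norml => /andP[_]; rewrite ltrBlDr addNr => neg.
  have := p0 (a + d / 2); rewrite val addrAC subrr add0r.
  by rewrite pmulr_rge0 // leNgt neg.
have := dP (a - d / 2); rewrite addrAC subrr add0r normrN gtr0_norm // => /(_ dd).
rewrite (gtr0_norm pa) ltr_norml => /andP[+ _]; rewrite ltrBrDr addNr => neg.
have := p0 (a - d / 2); rewrite val addrAC subrr add0r mulNr oppr_ge0.
by rewrite pmulr_rle0 // leNgt neg.
Qed.

(** Induction on the degree: real roots are double, and a nonreal root z contributes
    a positive real quadratic factor that splits as F times its conjugate. *)
Lemma nonneg_poly_square p : (forall y, 0 <= p.[y]) ->
  exists F, toC p = F * conjp F.
Proof.
have [n] := ubnP (size p); elim: n p => // n IHn p pn p0.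
have [p_const|p_nc] := leqP (size p) 1.
  have [c pc] : exists c, p = c%:P by exists p`_0; apply: size1_polyC.
  have c0 : 0 <= c by have := p0 0; rewrite pc hornerC.
  exists (Num.sqrt c)%:C%:P; rewrite pc !map_polyC /= conj_real -polyCM -rmorphM.
  by rewrite -expr2 sqr_sqrtr.
have [z pz] : exists z, root (toC p) z.
  by apply/closed_rootP; rewrite size_map_poly neq_ltn p_nc orbT.
have conj_factor (w : C) G : conjp (('X - w%:P) * G) = ('X - (w^* )%:P) * conjp G.
  by rewrite rmorphM rmorphB /= map_polyX map_polyC.
have size_ltn d p1 : p = d * p1 -> (1 < size d)%N -> (size p1 < size p)%N.
  move=> pE d1; have p_n0 : p != 0 by rewrite -size_poly_gt0; lia.
  have [dn0 p1n0] : d != 0 /\ p1 != 0.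
    by split; apply: contraNneq p_n0 => e; rewrite pE e ?mul0r ?mulr0.
  by rewrite pE size_mul //; case: (size d) d1 => [|[|k]] // _; rewrite !addSn ltnS leq_addl.
have [zr|zr] := eqVneq (complex.Im z) 0.
  have zE : z = (complex.Re z)%:C by case: (z) zr => a b /= ->.
  set a := complex.Re z in zE.
  have /factor_theorem[p1 pE1] : root p a.
    by move: pz; rewrite zE /root horner_map fmorph_eq0.
  have pE : p = ('X - a%:P) * p1 by rewrite mulrC.
  have /factor_theorem[p2 pE2] : root p1 a.
    by apply/eqP; apply: nonneg_root_double => y; rewrite -pE.
  have {}pE : p = ('X - a%:P) ^+ 2 * p2 by rewrite pE pE2 expr2 -mulrA [p2 * _]mulrC.
  have p2n : (size p2 < n)%N.
    have : (size p2 < size p)%N by apply: size_ltn pE _; rewrite size_exp_XsubC.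
    by lia.
  have p20 y : 0 <= p2.[y].
    have nn u : u != a -> 0 <= p2.[u].
      move=> ua; have := p0 u; rewrite pE hornerM horner_exp hornerXsubC.
      by rewrite pmulr_rge0 // exprn_even_gt0 //= subr_eq0.
    have [->|] := eqVneq y a; last exact: nn.
    rewrite leNgt; apply/negP => neg.
    have [|d d0 dP] := @poly_cont R a p2 `|p2.[a]|.
      by rewrite normr_gt0 lt_eqF.
    have d2 : 0 < d / 2 by rewrite divr_gt0.
    have := dP (a + d / 2); rewrite addrAC subrr add0r gtr0_norm //.
    have dd : d / 2 < d by rewrite ltr_pdivrMr // mulr_natr mulr2n ltrDl.
    move=> /(_ dd); rewrite (ltr0_norm neg) ltr_norml => /andP[_].
    rewrite ltrBlDr addNr ltNge nn //.
    by rewrite -subr_eq0 addrAC subrr add0r gt_eqF.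
  have [F FE] := IHn p2 p2n p20.
  exists (('X - z%:P) * F); rewrite conj_factor pE rmorphM rmorphXn rmorphB /= map_polyX.
  by rewrite map_polyC /= FE zE conj_real; ring.
pose a := complex.Re z; pose b := complex.Im z.
pose d : {poly R} := ('X - a%:P) ^+ 2 + (b ^+ 2)%:P.
have dE : toC d = ('X - z%:P) * ('X - (z^* )%:P).
  rewrite rmorphD rmorphXn rmorphB /= map_polyX !map_polyC /=.
  have -> : z^* = a%:C - 'i%C * b%:C by rewrite {1}[z]complexE -/a -/b; simpc.
  have -> : z%:P = a%:C%:P + 'i%C%:P * b%:C%:P by rewrite {1}[z]complexE polyCD polyCM.
  rewrite polyCB polyCM.
  have -> : (b ^+ 2)%:C%:P = - ('i%C%:P * b%:C%:P) ^+ 2 :> {poly C}.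
    by rewrite -polyCM -!polyC_exp -polyCN exprMn sqr_i mulN1r opprK -rmorphXn.
  by ring.
have dvd : d %| p.
  rewrite -(dvdp_map (real_complex R)) dE Gauss_dvdp; last first.
    apply: coprimep_XsubC2; rewrite subr_eq0; apply: contraNneq zr => e.
    by have := congr1 (@complex.Im R) e; case: (z) => u v /= h; apply/eqP; lra.
  rewrite !dvdp_XsubCl pz /= -complex_root_conj -[map_poly _ _]/(conjp (toC p)).
  by rewrite conjp_toC.
pose p1 := p %/ d; have pE : p = d * p1 by rewrite mulrC divpK.
have sz_d : size d = 3%N.
  by rewrite -(size_map_poly (real_complex R)) dE size_mul ?polyXsubC_eq0 // !size_XsubC.
have d0 y : 0 < d.[y].
  rewrite hornerD horner_exp hornerXsubC hornerC ltr_wpDl ?sqr_ge0 //.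
  by rewrite exprn_even_gt0.
have p1n : (size p1 < n)%N.
  have : (size p1 < size p)%N by apply: size_ltn pE _; rewrite sz_d.
  by lia.
have [y|F FE] := IHn _ p1n; first by have := p0 y; rewrite {1}pE hornerM pmulr_rge0.
by exists (('X - z%:P) * F); rewrite conj_factor pE rmorphM /= FE dE; ring.
Qed.

(** Write p(y^2) as F(y) times its conjugate and separate the even part of F from the
    odd part. The mixed terms form an odd function of y that equals an even one,
    hence vanish. *)
Lemma nonneg_halfline p : (forall t, 0 <= t -> 0 <= p.[t]) ->
  exists F G, toC p = F * conjp F + 'X * (G * conjp G).
Proof.
move=> p0; have [y|F FE] := @nonneg_poly_square (p \Po 'X^2).
  by rewrite horner_comp hornerXn p0 // sqr_ge0.
(* A and B compare the two sides; A(y^2) = y B(y^2), and replacing y by -y gives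
   A = 0. *)
exists (even_poly F), (odd_poly F).
pose A := toC p - (even_poly F * conjp (even_poly F) + 'X * (odd_poly F * conjp (odd_poly F))).
pose B := even_poly F * conjp (odd_poly F) + odd_poly F * conjp (even_poly F).
have hE y : A.[y ^+ 2] = B.[y ^+ 2] * y.
  have h1 G : (conjp G).[y ^+ 2] = (conjp (G \Po 'X^2)).[y].
    by rewrite map_comp_poly /= map_polyXn horner_comp hornerXn.
  have h2 G : G.[y ^+ 2] = (G \Po 'X^2).[y] by rewrite horner_comp hornerXn.
  have := congr1 (horner^~ y) FE.
  rewrite map_comp_poly /= map_polyXn horner_comp hornerXn hornerM => e.
  have dec := poly_even_odd F.
  have e1 : F.[y] = (even_poly F).[y ^+ 2] + (odd_poly F).[y ^+ 2] * y.
    by rewrite -[in LHS]dec hornerD hornerM hornerX !h2.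
  have e2 : (conjp F).[y] = (conjp (even_poly F)).[y ^+ 2] + (conjp (odd_poly F)).[y ^+ 2] * y.
    by rewrite -[in LHS]dec rmorphD rmorphM /= map_polyX hornerD hornerM hornerX !h1.
  rewrite /A /B hornerD hornerN e e1 e2 !hornerD !hornerM hornerX.
  by ring.
have A0 : A = 0.
  apply/eqP; apply: contraT => /closed_nonrootP[z /negP[]].
  have h1 := hE (sqrtC z); have h2 := hE (- sqrtC z).
  rewrite sqrtCK in h1; rewrite sqrrN sqrtCK mulrN in h2.
  have : A.[z] *+ 2 = 0 by rewrite mulr2n {1}h1 h2 subrr.
  by move/eqP; rewrite mulrn_eq0 /= => /eqP Az; apply/rootP.
by apply/eqP; rewrite -subr_eq0 -/A A0.
Qed.

End NonnegPoly.

Section Sos.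
Variables (R : realType) (q : R) (hq : 0 < q).
Local Notation C := R[i].
Local Notation A := (qplane q).
Local Notation x := (qx q).
Local Notation xs := (qxs q).
Local Notation conjp := (map_poly (Num.conj : C -> C)).
Implicit Types a b : A.

Lemma qsos0 : qsos (0 : A).
Proof. by exists [::]; rewrite big_nil. Qed.

Lemma qsosD a b : qsos a -> qsos b -> qsos (a + b).
Proof. by move=> [s ->] [t ->]; exists (s ++ t); rewrite big_cat. Qed.

Lemma qsos_sum n (F : 'I_n -> A) : (forall i, qsos (F i)) -> qsos (\sum_(i < n) F i).
Proof. by move=> F0; elim/big_rec: _ => [|i y _]; [exact: qsos0|exact: qsosD]. Qed.

Lemma qsos_sq a : qsos (qstar a * a).
Proof. by exists [:: a]; rewrite big_seq1. Qed.

Lemma qsos_conj c a : qsos a -> qsos (qstar c * a * c).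
Proof.
move=> [s ->]; exists [seq g * c | g <- s]; rewrite big_map mulr_sumr mulr_suml.
by apply: eq_bigr => g _; rewrite qstarM !mulrA.
Qed.

Lemma qsosZ (c : R) a : 0 <= c -> qsos a -> qsos (c%:C *: a).
Proof.
move=> c0 [s ->]; exists [seq (Num.sqrt c)%:C *: g | g <- s].
rewrite big_map scaler_sumr; apply: eq_bigr => g _.
by rewrite qstarZ -scalerAl -scalerAr scalerA conj_real -rmorphM -expr2 sqr_sqrtr.
Qed.

Lemma real_polyP (P : {poly C}) : conjp P = P ->
  P = map_poly (real_complex R) (map_poly (@complex.Re R) P).
Proof.
move=> Pc; apply/polyP => i; rewrite coef_map coef_map_id0 //=.
have := congr1 (fun Q : {poly C} => Q`_i) Pc; rewrite coef_map /= => /eqP.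
by rewrite -CrealE => /RRe_real.
Qed.

(** In the decomposition F F^* + X G G^* the indeterminate X stands for xs * x, which is
    itself of the form star g * g. *)
Lemma qsos_pol (P : {poly C}) : conjp P = P ->
  (forall t : R, 0 <= t -> 0 <= P.[t%:C]) -> qsos (qpol q P).
Proof.
move=> Pc P0; have PE := real_polyP Pc; set p := map_poly (@complex.Re R) P in PE.
have [t t0|F [G FE]] := @nonneg_halfline R p.
  by have := P0 t t0; rewrite PE horner_map ler0c.
rewrite PE FE rmorphD /=; apply: qsosD.
  by rewrite mulrC rmorphM /= -qstar_pol; apply: qsos_sq.
have -> : qpol q ('X * (G * conjp G)) = qstar (x * qpol q G) * (x * qpol q G).
  rewrite qstarM qstar_qx qstar_pol -!mulrA (mulrA xs) -qpolX -!rmorphM /=.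
  by congr (qpol q _); ring.
exact: qsos_sq.
Qed.

Lemma qpos1 : qpos (1 : A).
Proof.
move=> g t t0; rewrite (qexp_fiber hq _ t0 (leqnn _)).
have -> : (1 : A) = qpol q 1 by rewrite rmorph1.
rewrite qlam_fiber_pol //; apply: sumr_ge0 => k _.
by rewrite hornerC mul1r exprn_ge0.
Qed.

Lemma qpos_sq a : qpos (qstar a * a).
Proof. by have := qpos_conj a qpos1; rewrite mulr1. Qed.

End Sos.

(** * Denominators and the size of off-diagonal components *)

Section Denominators.
Variables (R : realType) (q : R) (hq : 0 < q).
Local Notation C := R[i].
Local Notation A := (qplane q).
Local Notation conjp := (map_poly (Num.conj : C -> C)).
Local Notation pol := (@qpol R q).
Implicit Types a e y E : A.
Implicit Types P Q W : {poly C}.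

Let q_neq0 : q != 0. Proof. by rewrite gt_eqF. Qed.

(** The denominators, as polynomials in xs * x. *)
Definition affine_prod P := exists s : seq int, P = \prod_(k <- s) ((q ^ k)%:C *: 'X + 1).

Lemma affine_prod1 : affine_prod 1.
Proof. by exists [::]; rewrite big_nil. Qed.

Lemma affine_prodM P Q : affine_prod P -> affine_prod Q -> affine_prod (P * Q).
Proof. by move=> [s ->] [t ->]; exists (s ++ t); rewrite big_cat. Qed.

Lemma affine_prod_exp P n : affine_prod P -> affine_prod (P ^+ n).
Proof.
by move=> hP; elim: n => [|n IHn]; [exact: affine_prod1|rewrite exprS; apply: affine_prodM].
Qed.

Lemma affine_prod_prod (I : Type) (r : seq I) (D : pred I) (F : I -> {poly C}) :
  (forall i, affine_prod (F i)) -> affine_prod (\prod_(i <- r | D i) F i).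
Proof.
by move=> hF; elim/big_rec: _ => [|i P _]; [exact: affine_prod1|exact: affine_prodM].
Qed.

Lemma affine_prod_1X : affine_prod (1 + 'X).
Proof. by exists [:: 0]; rewrite big_seq1 expr0z scale1r addrC. Qed.

Lemma affine_prod_scale d P : affine_prod P -> affine_prod (pscale (q ^ d) P).
Proof.
move=> [s ->]; exists [seq k + d | k <- s]; rewrite big_map /pscale rmorph_prod.
apply: eq_bigr => k _; rewrite /= comp_polyD comp_polyZ comp_polyX comp_polyC scalerA.
by rewrite -rmorphM -expfzDr.
Qed.

Lemma affine_prod_gt0 P (t : R) : affine_prod P -> 0 <= t -> 0 < P.[t%:C].
Proof.
move=> [s ->] t0; rewrite horner_prod; apply: prodr_gt0 => k _.
rewrite hornerD hornerZ hornerX hornerC ltr_wpDl // -rmorphM ler0c.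
by rewrite mulr_ge0 // exprz_ge0 // ltW.
Qed.

Lemma affine_prod_conj P : affine_prod P -> conjp P = P.
Proof.
move=> [s ->]; rewrite rmorph_prod; apply: eq_bigr => k _.
by rewrite rmorphD rmorph1 /= map_polyZ /= conj_real map_polyX.
Qed.

Lemma qstar_affine P : affine_prod P -> qstar (pol P) = pol P.
Proof. by move=> hP; rewrite qstar_pol affine_prod_conj. Qed.

Lemma qden_affine P : affine_prod P -> qden (pol P).
Proof.
move=> [s ->]; exists s; rewrite rmorph_prod; apply: eq_bigr => k _.
by rewrite rmorphD rmorph1 /= qpolZ qpolX.
Qed.

(** A component of degree d of a turns a denominator into its image under scaling
    by q^d. The product of all scalings of W by exponents between -L and L thus has W
    as a factor after it has been moved past any component of a. *)
Lemma affine_ore (L : nat) W : affine_prod W -> exists2 W', affine_prod W' &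
  forall a, qsupp (qband L) a ->
    exists2 a', qsupp (qband L) a' & a * pol W' = pol W * a'.
Proof.
move=> hW; pose F (n : nat) := pscale (q ^ (n%:Z - L%:Z)) W.
exists (\prod_(n < (2 * L).+1) F n).
  by apply: affine_prod_prod => n; apply: affine_prod_scale.
set W' := \prod_(n < _) _.
pose good a := exists2 a', qsupp (qband L) a' & a * pol W' = pol W * a'.
have goodD a b : good a -> good b -> good (a + b).
  move=> [a' a1 a2] [b' b1 b2]; exists (a' + b'); first exact: qsuppD.
  by rewrite mulrDl mulrDr a2 b2.
have good_comp d a : (`|d| <= L)%N -> good (qcomp d a).
  (* Scaling by q ^ d turns the factor of index L - d back into W. *)
  move=> dL; have nP : (`|L%:Z - d| < (2 * L).+1)%N by lia.
  pose n0 := Ordinal nP.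
  exists (pol (pscale (q ^ d) (\prod_(n < (2 * L).+1 | n != n0) F n)) * qcomp d a).
    apply: (@qsuppM _ _ (pred1 0) (pred1 d)); [|exact: qsupp_pol|exact: qsupp_comp].
    by move=> k l /= /eqP-> /eqP->; rewrite add0r.
  rewrite (qpol_comm hq _ (@qsupp_comp _ _ d a)) mulrA -rmorphM; congr (pol _ * _).
  rewrite /W' (bigD1 n0) //= pscaleM; congr (_ * _).
  rewrite /F pscale_comp -expfzDr //.
  have -> : d + ((n0 : nat)%:Z - L%:Z) = 0 by rewrite /=; lia.
  by rewrite expr0z pscale1.
move=> a aL; rewrite -/(good a) (qcomp_sum aL); apply: (goodD _ _); first exact: good_comp.
elim/big_rec: _ => [|n b _ hb].
  by exists 0; [exact: qsupp0|rewrite mul0r mulr0].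
apply: (goodD _ _) hb; apply: (goodD _ _); apply: good_comp; have := ltn_ord n; lia.
Qed.

Lemma qexp_comp0 a : qexp (qcomp 0 a) = qexp a.
Proof. by apply/polyP => i; rewrite !coef_qexp qcoef_comp subrr eqxx. Qed.

Lemma qexp_star a : qexp (qstar a) = conjp (qexp a).
Proof.
by apply/polyP => i; rewrite coef_map /= !coef_qexp qcoef_star rmorphM /= conj_real.
Qed.

Lemma qexp_off a : qsupp (predC1 0) a -> qexp a = 0.
Proof.
move=> ha; apply/polyP => i; rewrite coef_qexp coef0.
have [->|/ha /=] := eqVneq (qcoef a i i) 0; first by rewrite mul0r.
by rewrite subrr eqxx.
Qed.

Lemma qsupp_compC d a : qsupp (predC1 d) (a - qcomp d a).
Proof.
move=> i j; rewrite qcoefD qcoefN qcoef_comp /=.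
by have [_|] := eqVneq (j%:Z - i%:Z) d; first by rewrite subrr eqxx.
Qed.

Lemma qexp_star_comp d y a P : qsupp (pred1 d) y ->
  qexp (qstar y * a * pol P) = qexp (qstar y * qcomp d a * pol P).
Proof.
move=> yd; apply/eqP; rewrite -subr_eq0 -raddfB /= -mulrBl -mulrBr; apply/eqP.
apply: qexp_off; apply: (@qsuppM _ _ (predC1 0) (pred1 0)); [|..|exact: qsupp_pol].
  by move=> k l /= k0 /eqP->; rewrite addr0.
apply: (@qsuppM _ _ (pred1 (- d)) (predC1 d)); [|..|exact: qsupp_compC].
  by move=> k l /= /eqP->; rewrite addrC subr_eq0.
by apply: qsupp_star yd => k /= /eqP->.
Qed.

Lemma qexp_form_expand E (u v : A) (c : C) : c^* = c ->
  qexp (qstar (u - c *: v) * E * (u - c *: v)) =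
  qexp (qstar u * E * u) - c *: qexp (qstar u * E * v) - c *: qexp (qstar v * E * u)
  + c ^+ 2 *: qexp (qstar v * E * v).
Proof.
move=> cr; rewrite raddfB /= qstarZ cr.
have -> : (qstar u - c *: qstar v) * E * (u - c *: v) = qstar u * E * u
    - c *: (qstar u * E * v) - c *: (qstar v * E * u) + c ^+ 2 *: (qstar v * E * v).
  rewrite !mulrBl !mulrBr -!scalerAl -!scalerAr scalerA -expr2 opprB.
  by rewrite addrA addrAC.
by rewrite qexpD !qexpB !qexpZ.
Qed.

Lemma qexp_bound_expand E (F u v : A) (c : C) :
  qexp (u * (c *: F - E) * v) = c *: qexp (u * F * v) - qexp (u * E * v).
Proof. by rewrite mulrBr mulrBl -scalerAr -scalerAl qexpB qexpZ. Qed.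

(** A Cauchy-Schwarz inequality between the summands of degree 0 and d of a vector:
    if 0 <= E <= eta beta^2, then the component of E of degree d is at most eta times the
    product of the values of beta at the two ends. It comes from 0 <= E evaluated at
    y - lambda B. *)
Lemma qpos_offdiag beta D E (eta : R) d (t : R) :
    affine_prod beta -> affine_prod D -> 0 < eta -> qstar E = E -> qpos E ->
    qpos (eta%:C *: pol (beta ^+ 2) - E) -> 0 <= t ->
  (qexp (qstar (qcomp d E * pol D) * (qcomp d E * pol D))).[t%:C] <=
  eta%:C ^+ 2 * (beta * (D * pscale (q ^ (- d)) beta)).[t%:C] ^+ 2.
Proof.
move=> hbeta hD eta0 Estar E0 Eeta t0.
set y : A := _ * pol D; set B : {poly C} := D * _.
pose bn := pscale (q ^ (- d)) beta; pose Y := qexp (qstar y * y).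
have hbn : affine_prod bn by apply: affine_prod_scale.
have hB : affine_prod B by apply: affine_prodM.
have yd : qsupp (pred1 d) y.
  apply: (@qsuppM _ _ (pred1 d) (pred1 0)); [|exact: qsupp_comp|exact: qsupp_pol].
  by move=> k l /= /eqP-> /eqP->; rewrite addr0.
have ysd : qsupp (pred1 (- d)) (qstar y) by apply: qsupp_star yd => k /= /eqP->.
have yyE : qstar y * y = pol Y.
  apply: qexp_supp0 => //; apply: (@qsuppM _ _ (pred1 (- d)) (pred1 d)) => //.
  by move=> k l /= /eqP-> /eqP->; rewrite addNr.
have YE P : qexp (qstar y * pol P * y) = pscale (q ^ (- d)) P * Y.
  by rewrite (qpol_comm hq _ ysd) -mulrA yyE -rmorphM qexp_pol.
have yB : qcomp d E * pol B = pol beta * y.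
  rewrite rmorphM mulrA -/y (qpol_comm hq _ yd) /bn pscale_comp -expfzDr //.
  by rewrite subrr expr0z pscale1.
have X1 : qexp (qstar y * E * pol B) = bn * Y.
  by rewrite (qexp_star_comp _ _ yd) -mulrA yB mulrA YE.
have X2 : qexp (pol B * E * y) = bn * Y.
  have <- : qstar (qstar y * E * pol B) = pol B * E * y.
    by rewrite (qstarM _ (pol B)) (qstarM _ E) qstarK Estar qstar_affine // mulrA.
  rewrite qexp_star X1 rmorphM /= affine_prod_conj // -qexp_star qstarM qstarK.
  by [].
have X3 := Eeta y t t0.
have X4 := Eeta (pol B) t t0.
pose l := bn.[t%:C]; have l0 : 0 < l by apply: affine_prod_gt0.
have eC : 0 < eta%:C :> C by rewrite ltcR.
(* This lambda is optimal when the claim is an equality, and it makes the difference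
   of the two sides appear as a factor. *)
pose lam : C := eta%:C * l; have lam_real : lam^* = lam.
  by apply/CrealP/ger0_real; rewrite mulr_ge0 // ltW.
have := E0 (y - lam *: pol B : A) t t0.
rewrite qexp_form_expand // !qstar_affine // X1 X2.
move: X3 X4; rewrite qstar_affine // !qexp_bound_expand YE -!rmorphM qexp_pol // -/Y.
rewrite expr2 pscaleM -/bn !hornerD !hornerN !hornerZ !hornerM -/l.
set u := (qexp (_ * y)).[_]; set v := (qexp (pol B * _ * _)).[_].
set z := Y.[_]; set b := beta.[_]; set r := D.[_] => h1 h2 h3.
have lam2 : 0 <= lam ^+ 2 by rewrite exprn_ge0 // mulr_ge0 // ltW.
have pos : 0 < eta%:C * l ^+ 2 by rewrite mulr_gt0 // exprn_gt0.
rewrite -subr_ge0 -(pmulr_rge0 _ pos).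
have := addr_ge0 (addr_ge0 h3 h1) (mulr_ge0 lam2 h2); congr (0 <= _).
by rewrite /lam; ring.
Qed.

End Denominators.

(** * A small perturbation of a square is a sum of squares *)

Section Remainder.
Variables (R : realType) (q : R) (hq : 0 < q).
Local Notation C := R[i].
Local Notation A := (qplane q).
Local Notation conjp := (map_poly (Num.conj : C -> C)).
Local Notation pol := (@qpol R q).
Local Notation affine_prod := (affine_prod q).
Implicit Types a e y E : A.
Implicit Types P Q W : {poly C}.

Let q_neq0 : q != 0. Proof. by rewrite gt_eqF. Qed.

Lemma completed_square (eta : C) (b : A) (y : A) : eta != 0 -> eta^* = eta -> qstar b = b ->
  2 * eta *: (b * b) - b * y - qstar y * b =
  eta *: (qstar (b - eta^-1 *: y) * (b - eta^-1 *: y))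
  + (eta *: (b * b) - eta^-1 *: (qstar y * y)).
Proof.
move=> eta0 er bs; rewrite raddfB /= qstarZ bs.
have -> : (eta^-1)^* = eta^-1 by rewrite fmorphV /= er.
rewrite !mulrBl !mulrBr -!scalerAl -!scalerAr !scalerBr !scalerA mulfV // !scale1r.
rewrite mul1r mulr_natl mulr2n scalerDl opprB addrACA.
by rewrite [X in _ = X + _]addrAC [X in _ = _ + (X - _)]addrC addrK.
Qed.

Lemma expand_conj (a u e e' : A) (c : C) :
  a * (c *: u - (e + e')) * a = c *: (a * u * a) - a * (e * a) - a * e' * a.
Proof.
by rewrite opprD addrA !mulrDr !mulrDl !mulrN !mulNr -scalerAr -scalerAl (mulrA a e).
Qed.

Lemma expand_conj3 (a u v w : A) :
  a * (u + v + w) * a = a * u * a + a * v * a + a * w * a.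
Proof. by rewrite !mulrDr !mulrDl. Qed.

(** Complete the square: star S * S with S = beta B - y / eta accounts for the mixed terms
    once B has cleared the denominators, and what remains is a polynomial in xs * x that
    [qpos_offdiag] shows to be nonnegative. *)
Lemma qsos_offdiag beta D E (eta : R) d :
    affine_prod beta -> affine_prod D -> 0 < eta -> qstar E = E -> qpos E ->
    qpos (eta%:C *: pol (beta ^+ 2) - E) ->
  let B := D * pscale (q ^ (- d)) beta in
  qsos (pol B * (2 * eta%:C *: pol (beta ^+ 2) - (qcomp d E + qcomp (- d) E)) * pol B).
Proof.
move=> hbeta hD eta0 Es E0 Eeta B.
have hB : affine_prod B by apply: affine_prodM => //; apply: affine_prod_scale.
pose y := qcomp d E * pol D.
have yd : qsupp (pred1 d) y.
  apply: (@qsuppM _ _ (pred1 d) (pred1 0)); [|exact: qsupp_comp|exact: qsupp_pol].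
  by move=> k l /= /eqP-> /eqP->; rewrite addr0.
have yB : qcomp d E * pol B = pol beta * y.
  rewrite rmorphM mulrA -/y (qpol_comm hq _ yd) pscale_comp -expfzDr //.
  by rewrite subrr expr0z pscale1.
have eC : 0 < eta%:C :> C by rewrite ltcR.
have hb : affine_prod (beta * B) by apply: affine_prodM.
have -> : pol B * (2 * eta%:C *: pol (beta ^+ 2) - (qcomp d E + qcomp (- d) E)) * pol B
    = 2 * eta%:C *: (pol (beta * B) * pol (beta * B)) - pol (beta * B) * y
      - qstar y * pol (beta * B).
  have -> : pol B * (2 * eta%:C *: pol (beta ^+ 2) - (qcomp d E + qcomp (- d) E)) * pol B
    = 2 * eta%:C *: (pol B * pol (beta ^+ 2) * pol B) - pol B * (qcomp d E * pol B)
      - pol B * qcomp (- d) E * pol B.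
    exact: expand_conj.
  have -> : pol B * qcomp (- d) E = qstar (qcomp d E * pol B).
    by rewrite qstarM qcomp_star Es qstar_affine.
  rewrite yB qstarM (qstar_affine hbeta) mulrA.
  rewrite -[_ * pol beta * pol B]mulrA -!qpolM.
  congr (_ *: pol _ - pol _ * _ - _).
  - by ring.
  - by rewrite mulrC.
rewrite completed_square ?gt_eqF ?conj_real ?qstar_affine //.
apply: qsosD; first by apply: qsosZ; [exact: ltW|exact: qsos_sq].
pose Y := qexp (qstar y * y).
have yyE : qstar y * y = pol Y.
  apply: qexp_supp0 => //; apply: (@qsuppM _ _ (pred1 (- d)) (pred1 d)) => //.
    by move=> k l /= /eqP-> /eqP->; rewrite addNr.
  by apply: qsupp_star yd => k /= /eqP->.
rewrite yyE -qpolM -!qpolZ -qpolB; apply: qsos_pol => //.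
  rewrite rmorphB /= !map_polyZ /= (affine_prod_conj (affine_prodM hb hb)).
  rewrite conj_real fmorphV /= conj_real; congr (_ - _ *: _).
  by rewrite -qexp_star qstarM qstarK.
move=> t t0; rewrite hornerD hornerN !hornerZ hornerM subr_ge0.
rewrite ler_pdivrMl // -expr2 mulrA -expr2.
exact: qpos_offdiag.
Qed.

(** Distribute the weight delta beta^2 over the components of E. The pair of degrees d and
    -d consumes 2 eta beta^2, the component of degree 0 consumes eta beta^2, and the
    common denominator of all these steps is the product of the scalings of beta. *)
Lemma qsos_remainder (L : nat) beta E (eta delta : R) :
    affine_prod beta -> 0 < eta -> qstar E = E -> qsupp (qband L) E -> qpos E ->
    qpos (eta%:C *: pol (beta ^+ 2) - E) -> eta * (1 + 2 * L%:R) <= delta ->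
  exists2 D, affine_prod D & qsos (pol D * (delta%:C *: pol (beta ^+ 2) - E) * pol D).
Proof.
move=> hbeta eta0 Es EL E0 Eeta hdelta.
pose F (n : nat) := pscale (q ^ (- n.+1%:Z)) beta.
have hF n : affine_prod (F n) by apply: affine_prod_scale.
exists (\prod_(n < L) F n); first exact: affine_prod_prod.
set D := \prod_(n < L) _; have hD : affine_prod D by apply: affine_prod_prod.
have split : delta%:C *: pol (beta ^+ 2) - E =
    (delta - eta * (1 + 2 * L%:R))%:C *: pol (beta ^+ 2)
    + (eta%:C *: pol (beta ^+ 2) - qcomp 0 E)
    + \sum_(n < L) (2 * eta%:C *: pol (beta ^+ 2)
                    - (qcomp n.+1%:Z E + qcomp (- n.+1%:Z) E)).
  rewrite sumrB sumr_const card_ord [in LHS](qcomp_sum EL) opprD !addrA.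
  congr (_ - _); rewrite addrAC; congr (_ - _).
  rewrite scalerMnl -!scalerDl; congr (_ *: _); rewrite -mulr_natr.
  rewrite rmorphB rmorphM rmorphD rmorphM /= !rmorph_nat rmorph1.
  by ring.
rewrite split expand_conj3 mulr_sumr mulr_suml.
have Dpol Q : conjp Q = Q -> (forall t : R, 0 <= t -> 0 <= Q.[t%:C]) -> qsos (pol D * pol Q * pol D).
  by move=> Qc Q0; rewrite -{1}(qstar_affine hD); apply: qsos_conj; apply: qsos_pol.
have b2 : conjp (beta ^+ 2) = beta ^+ 2 by apply/(@affine_prod_conj R q)/affine_prod_exp.
apply: qsosD; first apply: qsosD.
- rewrite -qpolZ; apply: Dpol => [|t t0]; first by rewrite map_polyZ /= conj_real b2.
  rewrite hornerZ mulr_ge0 ?ler0c ?subr_ge0 // horner_exp exprn_ge0 //.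
  by apply: ltW; apply: (affine_prod_gt0 hq).
- have -> : qcomp 0 E = pol (qexp E).
    by rewrite (qexp_supp0 hq (@qsupp_comp _ _ 0 E)) qexp_comp0.
  rewrite -qpolZ -qpolB; apply: Dpol => [|t t0].
    by rewrite rmorphB /= map_polyZ /= conj_real b2 -qexp_star Es.
  have := Eeta 1 t t0; rewrite qstar1 mul1r mulr1 qexpB qexpZ qexp_pol //.
apply: qsos_sum => n.
have -> : D = (\prod_(k < L | k != n) F k) * F n by rewrite /D (bigD1 n) // mulrC.
by apply: qsos_offdiag => //; apply: affine_prod_prod.
Qed.

End Remainder.

(** * Powers of a bounded element with cleared denominators *)

Section Chain.
Variables (R : realType) (q : R).
Local Notation C := R[i].
Local Notation A := (qplane q).
Local Notation pol := (@qpol R q).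
Local Notation affine_prod := (affine_prod q).
Hypothesis hq : 0 < q.

(** The element z j plays the role of the j-th power of w^-1 c applied to a common
    denominator P, where w = W(xs * x): at each step the Ore condition makes room for one more
    division by w, at the price of enlarging P. *)
Lemma ore_chain (M N : nat) (c : A) W : qsupp (qband M) c -> affine_prod W ->
  exists P (z : nat -> A), [/\ affine_prod P, z 0 = pol P,
    forall j, (j <= N)%N -> qsupp (qband (M * j)) (z j) &
    forall j, (j < N)%N -> c * z j = pol W * z j.+1].
Proof.
move=> cM hW; elim: N => [|N [P [z [hP z0 zM zc]]]].
  exists 1, (fun=> 1); split=> //; first exact: affine_prod1.
    by rewrite rmorph1.
  move=> j _; rewrite -(rmorph1 (@qpol R q)); apply: qsupp_sub (@qsupp_pol _ _ 1).
  by move=> d /= /eqP->; rewrite /qband absz0.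
have [W' hW' ore] := affine_ore hq (M * N.+1) hW.
have [|z' z'M z'E] := ore (c * z N).
  apply: (@qsuppM _ _ (qband M) (qband (M * N))) => //; last exact: zM.
  by move=> k l; rewrite /qband; lia.
exists (P * W'), (fun j => if (j <= N)%N then z j * pol W' else z').
split=> [||j jN|j].
- exact: affine_prodM.
- by rewrite /= z0 qpolM.
- case: leqP => jN'; last first.
    have -> : j = N.+1 by lia.
    exact: z'M.
  apply: (@qsuppM _ _ (qband (M * j)) (pred1 0)); [|exact: zM|exact: qsupp_pol].
  by move=> k l kM /= /eqP->; rewrite addr0.
move=> jN1; have [jN|->] : (j < N)%N \/ j = N by lia.
  by rewrite (ltnW jN) jN mulrA zc // mulrA.
by rewrite leqnn ltnn mulrA z'E.
Qed.

End Chain.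

Section Moment.
Variables (R : realType) (q : R).
Local Notation C := R[i].
Local Notation A := (qplane q).
Implicit Types P Q : {poly C}.

(** The value of a polynomial at an element whose powers are replaced by the members of
    a sequence. *)
Definition moment K (g : nat -> A) P := \sum_(n < K) P`_n *: g n.

Lemma momentD K g P Q : moment K g (P + Q) = moment K g P + moment K g Q.
Proof. by rewrite /moment -big_split; apply: eq_bigr => n _; rewrite coefD scalerDl. Qed.

Lemma momentZ K g (l : C) P : moment K g (l *: P) = l *: moment K g P.
Proof. by rewrite /moment scaler_sumr; apply: eq_bigr => n _; rewrite coefZ scalerA. Qed.

Lemma momentXn K g n : (n < K)%N -> moment K g 'X^n = g n.
Proof.
move=> nK; rewrite /moment (bigD1 (Ordinal nK)) //= coefXn eqxx scale1r.
rewrite big1 ?addr0 // => k kn; rewrite coefXn.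
by rewrite (_ : (k == n :> nat) = false) ?scale0r //; apply: contraNF kn => /eqP e; apply/eqP/val_inj.
Qed.

Lemma moment_sum K g n (F : 'I_n -> {poly C}) :
  moment K g (\sum_(i < n) F i) = \sum_(i < n) moment K g (F i).
Proof.
apply: (big_morph _ (momentD K g)).
by rewrite /moment big1 // => i _; rewrite coef0 scale0r.
Qed.

Lemma moment_mul N g (F Q : {poly C}) : (size F <= N.+1)%N -> (size Q <= N.+1)%N ->
  moment (2 * N).+1 g (F * Q) =
  \sum_(i < N.+1) \sum_(j < N.+1) (F`_i * Q`_j) *: g (i + j)%N.
Proof.
have expand (H : {poly C}) : (size H <= N.+1)%N -> H = \sum_(i < N.+1) H`_i *: 'X^i.
  move=> sH; rewrite -poly_def; apply/polyP => i; rewrite coef_poly.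
  by case: ltnP => // iN; rewrite nth_default // (leq_trans sH).
move=> sF sQ; rewrite {1}(expand F sF) mulr_suml moment_sum; apply: eq_bigr => i _.
rewrite {1}(expand Q sQ) mulr_sumr moment_sum; apply: eq_bigr => j _.
rewrite -scalerAl -scalerAr scalerA momentZ -exprD momentXn //.
by have := ltn_ord i; have := ltn_ord j; lia.
Qed.

End Moment.

Lemma gram_telescope (C : numFieldType) (V : lmodType C) (r : C) (a b g h : V) : r != 0 ->
  r^-1 *: (r ^+ 2 *: a - r *: h - (r *: h - b) + (r *: h - b) + r ^+ 2 *: (r *: g - a))
  = r ^+ 2 *: g - h.
Proof.
move=> r0; rewrite subrK scalerBr addrC addrA subrK scalerA.
by rewrite scalerBr !scalerA mulVf // scale1r -exprSr exprS mulKf.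
Qed.

Section Gram.
Variables (R : realType) (q : R).
Local Notation C := R[i].
Local Notation A := (qplane q).
Local Notation conjp := (map_poly (Num.conj : C -> C)).
Variables (N : nat) (c w : A) (z : nat -> A).
Hypotheses (cs : qstar c = c) (ws : qstar w = w).
Hypothesis zc : forall j, (j < N)%N -> c * z j = w * z j.+1.

(** In terms of the hermitian element h = w^(-1/2) c w^(-1/2) this is
    star P w^(1/2) h^(i + j) w^(1/2) P, where P is z 0. *)
Definition gram i j := qstar (z i) * w * z j.

(** The hermitian element c moves from one side of w^-1 to the other. *)
Lemma gram_swap i j : (i < N)%N -> (j < N)%N -> gram i.+1 j = gram i j.+1.
Proof.
move=> iN jN; rewrite /gram -[in RHS]mulrA -zc // mulrA.
have -> : qstar (z i) * c = qstar (c * z i) by rewrite qstarM cs.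
by rewrite zc // qstarM ws.
Qed.

Lemma gram_shift i j k : (i + k <= N)%N -> (j + k <= N)%N -> gram (i + k) j = gram i (j + k).
Proof.
elim: k j => [|k IHk] j; first by rewrite !addn0.
rewrite !addnS => ik jk; rewrite gram_swap ?IHk ?addSn //; lia.
Qed.

(** Any splitting of n into two indices at most N will do; see [gram_hankel]. *)
Definition hankel n := gram (minn n N) (n - minn n N).

Lemma gram_hankel i j : (i <= N)%N -> (j <= N)%N -> gram i j = hankel (i + j).
Proof.
move=> iN jN; rewrite /hankel; set k := (minn (i + j) N - i)%N.
have -> : minn (i + j) N = (i + k)%N by rewrite /k; lia.
have jE : j = (i + j - (i + k) + k)%N by rewrite /k; lia.
by rewrite {1}jE -gram_shift //; rewrite /k; lia.
Qed.

(** This is h^(2 j) <= rho^(2 j) for 0 <= h <= rho, one factor h^2 at a time: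
    rho^2 - h^2 is proportional to
    (rho - h) h (rho - h) + h (rho - h) h + rho^2 (rho - h). *)
Lemma qpos_gram (rho : R) : 0 < rho -> qpos c -> qpos (rho%:C *: w - c) ->
  forall j, (j <= N)%N -> qpos ((rho ^+ (2 * j))%:C *: gram 0 0 - gram j j).
Proof.
move=> rho0 c0 wc; have rC : 0 < rho%:C :> C by rewrite ltcR.
have step j : (j < N)%N -> qpos (rho%:C ^+ 2 *: gram j j - gram j.+1 j.+1).
  move=> jN; pose h : A := rho%:C *: z j - z j.+1.
  suff -> : rho%:C ^+ 2 *: gram j j - gram j.+1 j.+1 = rho%:C^-1 *:
      (qstar h * c * h + qstar (z j.+1) * (rho%:C *: w - c) * z j.+1
       + rho%:C ^+ 2 *: (qstar (z j) * (rho%:C *: w - c) * z j)).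
    apply: qposZ; first by rewrite invr_ge0 ltW.
    apply: qposD; [apply: qposD|apply: qposZ]; try exact: qpos_conj.
    by rewrite exprn_ge0 // ltW.
  have czE : qstar (z j) * c * z j.+1 = gram j.+1 j.+1.
    have -> : qstar (z j) * c = qstar (c * z j) by rewrite qstarM cs.
    by rewrite zc // qstarM ws.
  have zcE : qstar (z j.+1) * c * z j = gram j.+1 j.+1.
    by rewrite -mulrA zc // mulrA.
  pose a : A := qstar (z j) * c * z j; pose b : A := qstar (z j.+1) * c * z j.+1.
  have hE : qstar h * c * h = rho%:C ^+ 2 *: a - rho%:C *: gram j.+1 j.+1
      - (rho%:C *: gram j.+1 j.+1 - b).
    rewrite /h raddfB /= qstarZ conj_real !mulrBl !mulrBr -!scalerAl -!scalerAr scalerA.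
    by rewrite -expr2 czE zcE.
  have bE k : qstar (z k) * (rho%:C *: w - c) * z k
      = rho%:C *: gram k k - qstar (z k) * c * z k.
    by rewrite mulrBr mulrBl -scalerAr -scalerAl.
  by rewrite hE !bE -/a -/b; apply/esym/gram_telescope; rewrite gt_eqF.
elim=> [|j IHj] jN.
  rewrite muln0 expr0 scale1r subrr => g t t0.
  by rewrite mulr0 mul0r raddf0 horner0.
have -> : (rho ^+ (2 * j.+1))%:C *: gram 0 0 - gram j.+1 j.+1 =
    rho%:C ^+ 2 *: ((rho ^+ (2 * j))%:C *: gram 0 0 - gram j j)
    + (rho%:C ^+ 2 *: gram j j - gram j.+1 j.+1).
  rewrite scalerBr addrA subrK scalerA mulnS exprD rmorphM; congr (_ * _ *: _ - _).
  by rewrite rmorphXn.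
apply: qposD; last exact: step.
by apply: qposZ; [rewrite exprn_ge0 // ltW|apply: IHj; apply: ltnW].
Qed.

(** A polynomial that is nonnegative on the whole line is F times its conjugate, and the
    Hankel structure turns it into star(F(h)) F(h). *)
Lemma qsos_hankel (u : A) (p : {poly R}) : w = qstar u * u ->
    (size p <= (2 * N).+1)%N -> (forall y : R, 0 <= p.[y]) ->
  qsos (moment (2 * N).+1 hankel (map_poly (real_complex R) p)).
Proof.
move=> wE sp p0; have [F FE] := nonneg_poly_square p0.
have sconj (H : {poly C}) : size (conjp H) = size H by rewrite size_map_poly.
have sF : (size F <= N.+1)%N.
  have [->|F0] := eqVneq F 0; first by rewrite size_poly0.
  have := congr1 (fun H : {poly C} => size H) FE; rewrite size_map_poly size_mul ?map_poly_eq0 //.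
  rewrite sconj addnn => sE; move: sp; rewrite sE; case: (size F) => // n.
  by rewrite doubleS /= ltnS mul2n leq_double.
rewrite FE mulrC moment_mul ?sconj //.
suff -> : \sum_(i < N.+1) \sum_(j < N.+1) ((conjp F)`_i * F`_j) *: hankel (i + j) =
    qstar (\sum_(j < N.+1) F`_j *: (u * z j)) * (\sum_(j < N.+1) F`_j *: (u * z j)).
  exact: qsos_sq.
rewrite raddf_sum /= mulr_suml; apply: eq_bigr => i _; rewrite mulr_sumr.
apply: eq_bigr => j _; rewrite -(gram_hankel (ltn_ord i) (ltn_ord j)) coef_map /= qstarZ.
by rewrite -scalerAl -scalerAr scalerA qstarM /gram wE !mulrA.
Qed.

End Gram.

(** * Clearing denominators *)

Section Final.

Lemma shifted_power_nonneg (F : realFieldType) (alpha y : F) N : 0 < alpha -> (0 < N)%N ->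
  0 <= alpha - y + alpha / alpha ^+ (2 * N) * y ^+ (2 * N).
Proof.
move=> a0 N0; have an0 : alpha != 0 by rewrite gt_eqF.
have -> : alpha - y + alpha / alpha ^+ (2 * N) * y ^+ (2 * N) =
    alpha * (1 - y / alpha + (y / alpha) ^+ (2 * N)).
  by rewrite expr_div_n; field; rewrite an0 expf_neq0.
rewrite pmulr_rge0 //; set t := y / alpha.
have [t1|t1] := leP t 1.
  by rewrite addr_ge0 ?subr_ge0 // exprM exprn_ge0 // sqr_ge0.
rewrite addrAC -addrA addr_ge0 // subr_ge0.
by apply: ler_eXnr; [lia|exact: ltW].
Qed.

(** The line alpha - X, made nonnegative everywhere by an even power which on any interval
    [0, rho] with rho < alpha tends to 0 geometrically in N. *)
Definition even_lift (F : realFieldType) (alpha : F) N : {poly F} :=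
  alpha *: 'X^0 - 'X^1 + (alpha / alpha ^+ (2 * N)) *: 'X^(2 * N).

Lemma even_lift_ge0 (F : realFieldType) (alpha y : F) N : 0 < alpha -> (0 < N)%N ->
  0 <= (even_lift alpha N).[y].
Proof.
rewrite !hornerD hornerN !hornerZ !hornerXn expr0 expr1 mulr1.
exact: shifted_power_nonneg.
Qed.

Lemma size_even_lift (F : realFieldType) (alpha : F) N : (0 < N)%N ->
  (size (even_lift alpha N) <= (2 * N).+1)%N.
Proof.
move=> N0; apply: leq_trans (size_polyD _ _) _; rewrite geq_max.
rewrite (leq_trans (size_scale_leq _ _)) ?size_polyXn // andbT.
apply: leq_trans (size_polyD _ _) _; rewrite geq_max size_polyN size_polyXn.
by rewrite (leq_trans (size_scale_leq _ _)) ?size_polyXn //= ltnS muln_gt0.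
Qed.

Lemma moment_even_lift (R : realType) (q : R) (g : nat -> qplane q) (alpha : R) N :
    (0 < N)%N ->
  moment (2 * N).+1 g (map_poly (real_complex R) (even_lift alpha N)) =
  alpha%:C *: g 0 - g 1 + (alpha / alpha ^+ (2 * N))%:C *: g (2 * N)%N.
Proof.
move=> N0; rewrite /even_lift; set kappa := alpha / _.
have -> : map_poly (real_complex R) (alpha *: 'X^0 - 'X^1 + kappa *: 'X^(2 * N)) =
    alpha%:C *: 'X^0 + (-1) *: 'X^1 + kappa%:C *: 'X^(2 * N).
  by rewrite rmorphD rmorphB /= !map_polyZ /= !map_polyXn scaleN1r.
by rewrite 2!momentD !momentZ !momentXn ?scaleN1r // ltnS muln_gt0.
Qed.

Lemma bernoulli_le (F : realFieldType) (s : F) n : 0 <= s -> 1 + s * n%:R <= (1 + s) ^+ n.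
Proof.
move=> s0; elim: n => [|n IHn]; first by rewrite mulr0 addr0 expr0.
rewrite exprS; apply: le_trans (ler_wpM2l _ IHn); last by rewrite addr_ge0.
rewrite -natr1 -subr_ge0 (_ : _ - _ = s ^+ 2 * n%:R); last by ring.
by rewrite mulr_ge0 ?sqr_ge0.
Qed.

(** The left-hand side is a geometric sequence of ratio (rho / alpha)^2 times a linear
    one; Bernoulli's inequality for alpha / rho suffices. *)
Lemma geometric_small (R : realType) (alpha rho a delta : R) :
    0 < rho -> rho < alpha -> 0 < delta -> 0 <= a ->
  exists2 N, (0 < N)%N & alpha / alpha ^+ (2 * N) * rho ^+ (2 * N) * (1 + a * N%:R) <= delta.
Proof.
move=> r0 ra d0 a0; pose s := alpha / rho - 1.
have al0 : 0 < alpha by apply: lt_trans ra.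
have s0 : 0 < s by rewrite subr_gt0 ltr_pdivlMr // mul1r.
have ds0 : 0 < delta * s ^+ 2 by rewrite mulr_gt0 // exprn_gt0.
have a1 : 0 < 1 + a by rewrite ltr_pwDl.
pose b := alpha * (1 + a) / (delta * s ^+ 2).
have b0 : 0 < b by rewrite divr_gt0 // mulr_gt0.
pose N := Num.bound b; have NP : b < N%:R by apply: archi_boundP; apply: ltW.
have N0 : (0 < N)%N by rewrite -(ltr_nat R) (lt_trans b0).
have N1 : 1 <= N%:R :> R by rewrite (ler_nat _ 1).
exists N => //; pose y := alpha / rho.
have y0 : 0 < y by rewrite divr_gt0.
have -> : alpha / alpha ^+ (2 * N) * rho ^+ (2 * N) * (1 + a * N%:R) =
    alpha * (1 + a * N%:R) / y ^+ (2 * N).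
  by rewrite expr_div_n; field; rewrite !expf_neq0 ?gt_eqF.
rewrite ler_pdivrMr ?exprn_gt0 //.
apply: (@le_trans _ _ (delta * (s * N%:R) ^+ 2)); last first.
  rewrite ler_pM2l // [(2 * N)%N]mulnC exprM.
  have yN : s * N%:R <= y ^+ N.
    apply: (@le_trans _ _ (1 + s * N%:R)); first by rewrite lerDr.
    have -> : y = 1 + s by rewrite /s addrC subrK.
    by apply: bernoulli_le; apply: ltW.
  have sN : 0 <= s * N%:R by rewrite mulr_ge0 // ltW.
  by rewrite lerXn2r // nnegrE // (le_trans sN).
apply: (@le_trans _ _ (alpha * (1 + a) * N%:R)).
  by rewrite -mulrA ler_pM2l // mulrDl mul1r lerD2r.
have : b * (delta * s ^+ 2) <= N%:R * (delta * s ^+ 2).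
  by rewrite ler_pM2r // ltW.
rewrite divfK ?gt_eqF // => /(ler_wpM2r (ler0n R N)) /le_trans; apply.
by rewrite le_eqVlt; apply/orP; left; apply/eqP; ring.
Qed.

Lemma qsupp_gram (R : realType) (q : R) (L : nat) (w : qplane q) z j :
  qsupp (pred1 0) w -> qsupp (qband L) (z j) -> qsupp (qband (2 * L)) (gram w z j j).
Proof.
move=> w0 zL; apply: (@qsuppM _ _ (qband L) (qband L)) => //.
  by move=> k l; rewrite /qband; lia.
apply: (@qsuppM _ _ (qband L) (pred1 0)) => //.
  by move=> k l h /= /eqP->; rewrite addr0.
by apply: qsupp_star zL => k; rewrite /qband abszN.
Qed.

(** With c = (K + d) w - f and alpha = K + d/2, and with the powers of h represented by
    the chain of [ore_chain], the element star P f P is the sum of the value of [even_lift]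
    at h, which is a square, and of (d/2) beta^2 - E, where E is the small even power. The
    band of E grows linearly in N while its size decreases geometrically, so
    [qsos_remainder] applies for large N. *)
Lemma qsos_of_weight_bounds (R : realType) (q : R) (hq : 0 < q) (f : qplane q) (m : nat)
    (d K : R) : qstar f = f -> qsupp (qband (4 * m)) f -> 0 < d -> 0 < K ->
    let wt : qplane q := qpol q ((1 + 'X) ^+ (2 * m)) in
    qpos (f - d%:C *: wt) -> qpos (K%:C *: wt - f) ->
  exists b, qden b /\ qsos (qstar b * f * b).
Proof.
move=> fs fM d0 K0 wt flow fup.
have hU : affine_prod q ((1 + 'X) ^+ m) by apply/affine_prod_exp/affine_prod_1X.
have hW : affine_prod q ((1 + 'X) ^+ (2 * m)) by apply/affine_prod_exp/affine_prod_1X.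
have ws : qstar wt = wt by apply: qstar_affine.
have wE : wt = qstar (qpol q ((1 + 'X) ^+ m)) * qpol q ((1 + 'X) ^+ m).
  by rewrite qstar_affine // -qpolM -exprD addnn -mul2n.
have wpos : qpos wt by rewrite wE; apply: qpos_sq.
pose c : qplane q := (K + d)%:C *: wt - f.
have cs : qstar c = c by rewrite /c raddfB /= qstarZ conj_real ws fs.
have cM : qsupp (qband (4 * m)) c.
  rewrite /c -scaleN1r; apply: qsuppD; apply: qsuppZ => //.
  by apply: qsupp_sub (@qsupp_pol _ _ _) => k /= /eqP->.
have c0 : qpos c.
  have -> : c = (K%:C *: wt - f) + d%:C *: wt.
    by rewrite /c rmorphD scalerDl addrAC.
  by apply: qposD => //; apply: qposZ => //; rewrite ler0c ltW.
have wc : qpos (K%:C *: wt - c).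
  have -> : K%:C *: wt - c = f - d%:C *: wt; last exact: flow.
  by rewrite /c rmorphD scalerDl opprB opprD addrCA (addrA (_ *: wt)) subrr add0r.
pose alpha := K + d / 2; have d2 : 0 < d / 2 by rewrite divr_gt0.
have al0 : 0 < alpha by rewrite addr_gt0.
have Kal : K < alpha by rewrite ltrDl.
have a0 : 0 <= (4 * (4 * m))%:R :> R by rewrite ler0n.
have [N N0 NP] := geometric_small K0 Kal d2 a0.
(* E <= eta beta^2 with eta = kappa K^(2 N), and E has degrees at most 8 m N. *)
pose kappa := alpha / alpha ^+ (2 * N).
have k0 : 0 < kappa by rewrite divr_gt0 // exprn_gt0.
have kC : 0 <= kappa%:C :> R[i] by rewrite ler0c ltW.
have [P [z [hP z0 zM zc]]] := ore_chain hq N cM hW.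
pose E : qplane q := kappa%:C *: gram wt z N N.
pose beta := (1 + 'X) ^+ m * P; have hbeta : affine_prod q beta by apply: affine_prodM.
have g00 : gram wt z 0 0 = qpol q (beta ^+ 2).
  rewrite /gram z0 qstar_affine // -!qpolM; congr (qpol q _).
  by rewrite /beta exprMn -exprM [(2 * m)%N]mulnC; ring.
have Es : qstar E = E.
  by rewrite /E qstarZ conj_real /gram !qstarM qstarK ws mulrA.
have EM : qsupp (qband (2 * (4 * m * N))) E.
  by apply/qsuppZ/qsupp_gram; [exact: qsupp_pol|exact: zM].
have Epos : qpos E by apply: qposZ => //; apply: qpos_conj.
have Eeta : qpos ((kappa * K ^+ (2 * N))%:C *: qpol q (beta ^+ 2) - E).
  by rewrite -g00 rmorphM -scalerA -scalerBr; apply: qposZ => //; apply: (qpos_gram cs ws zc).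
have hdelta : kappa * K ^+ (2 * N) * (1 + 2 * (2 * (4 * m * N))%:R) <= d / 2.
  have -> : 2 * (2 * (4 * m * N))%:R = (4 * (4 * m))%:R * N%:R :> R by rewrite !natrM; ring.
  exact: NP.
have eta0 : 0 < kappa * K ^+ (2 * N) by rewrite mulr_gt0 // exprn_gt0.
have [D hD hsos] := qsos_remainder hq hbeta eta0 Es EM Epos Eeta hdelta.
exists (qpol q (P * D)); split; first exact/qden_affine/affine_prodM.
pose p := even_lift alpha N.
have pE : moment (2 * N).+1 (hankel N wt z) (map_poly (real_complex R) p) =
    alpha%:C *: gram wt z 0 0 - gram wt z 0 1 + E.
  rewrite moment_even_lift // (gram_hankel cs ws zc (leq0n N) (leq0n N)).
  rewrite (gram_hankel cs ws zc (leq0n N) N0).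
  by rewrite /E (gram_hankel cs ws zc (leqnn N) (leqnn N)) (addnn N) -mul2n.
have fE : qpol q P * f * qpol q P =
    moment (2 * N).+1 (hankel N wt z) (map_poly (real_complex R) p)
    + ((d / 2)%:C *: qpol q (beta ^+ 2) - E).
  have -> : f = (K + d)%:C *: wt - c by rewrite /c opprB addrC subrK.
  have h0 : qpol q P * wt * qpol q P = gram wt z 0 0 by rewrite /gram z0 qstar_affine.
  have h1 : qpol q P * c * qpol q P = gram wt z 0 1.
    by rewrite -mulrA -z0 zc // mulrA /gram z0 qstar_affine.
  rewrite mulrBr mulrBl -scalerAr -scalerAl h0 h1 pE -g00.
  have -> : K + d = alpha + d / 2 by rewrite /alpha; lra.
  rewrite rmorphD scalerDl (addrC _ (- E)) addrA addrK.
  by rewrite addrAC.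
have -> : qstar (qpol q (P * D)) * f * qpol q (P * D) =
    qpol q D * (qpol q P * f * qpol q P) * qpol q D.
  by rewrite qpolM qstarM !qstar_affine // !mulrA.
rewrite fE mulrDr mulrDl; apply: qsosD => //.
rewrite -{1}(qstar_affine hD); apply: qsos_conj.
apply: (qsos_hankel cs ws zc wE); first exact: size_even_lift.
by move=> y; apply: even_lift_ge0.
Qed.

Theorem theorem6 (R : realType) (q : R) (hq : 0 < q) (f : qplane q) (m : nat)
    (hm : (0 < m)%N) (hf : qstar f = f) (hdeg : qdeg f = (4 * m)%N)
    (hpos : forall (H : hilbertType R) (X : partial_op H), qnormal q X ->
      exists eps : R, 0 < eps /\
        forall phi, smooth_dom X phi ->
          eps%:C * hdot H phi phi <= hdot H (qeval f X phi) phi)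
    (hsymb : forall w : R[i], `|w| = (Num.sqrt q)%:C -> 0 < qsymbol f w) :
  exists b : qplane q, qden b /\ qsos (qstar b * f * b).
Proof.
have [d d0 flow] := qpos_lower hq hm hdeg hsymb hpos.
have [K K0 fup] := qpos_upper hq hm hdeg hpos.
apply: (@qsos_of_weight_bounds R q hq f m d K) => //.
move=> i j; apply: contraR; rewrite /qband => ij.
by rewrite (@qcoef_gt _ _ f (4 * m)) ?eqxx // ?hdeg //; lia.
Qed.

End Final.
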